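(* Let $\mu$ be a strongly almost periodic measure on $\widehat{\mathbb{R}^d}$. Then $\mu$ is the Fourier transform of a measure (i.e. there is a Fourier transformable measure $\nu$ on $\mathbb{R}^d$ with $\widehat\nu=\mu$) if and only if its Fourier–Bohr series $\mathcal{F}_{\mathsf d}(\mu)$ is a measure. Moreover, in this case the Fourier transform of $(\mathcal{F}_{\mathsf d}(\mu))^\dagger$ is $\mu$.
   Context: Here $X=\mathbb{R}^d$ with Lebesgue measure, and $\widehat{\mathbb{R}^d}$ is identified with $\mathbb{R}^d$ via the characters $\chi_y(x)=e^{2\pi i x\cdot y}$. $C_c(X)$: continuous compactly supported functions; $C_u(X)$: bounded uniformly continuous functions, with sup norm. $\check f(y)=\int f(x)e^{2\pi i x\cdot y}\,dx$; $\widetilde f(x)=\overline{f(-x)}$; $f^\dagger(x)=f(-x)$; $f*g$ is convolution. Measures. A measure on $X$ is a linear functional $\mu:C_c(X)\to\mathbb{C}$ such that for each compact $K\subset X$ there is $C_K$ with $|\mu(f)|\le C_K\|f\|_\infty$ for all $f\in C_c(X)$ supported in $K$ (a complex Radon measure, possibly unbounded); $|\mu|$ is its variation; $\mu^\dagger(f)=\mu(f^\dagger)$. $\mu$ is translation bounded if $\sup_{x\in X}|\mu|(x+K)<\infty$ for every compact $K$. $(f*\mu)(x)=\int f(x-y)\,d\mu(y)$. Fourier transformability. A measure $\nu$ is Fourier transformable if there is a measure $\widehat\nu$ on $\widehat{\mathbb{R}^d}$ (its Fourier transform) such that for all $f\in C_c(\mathbb{R}^d)$: $|\check f|^2\in L^1(|\widehat\nu|)$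 and $\langle\nu,f*\widetilde f\rangle=\langle\widehat\nu,|\check f|^2\rangle$. Almost periodicity. $f\in C_u(X)$ is strongly (resp. weakly) almost periodic if the closure of the set of its translates is compact in the norm topology (resp. weak topology) of $(C_u(X),\|\cdot\|_\infty)$. A translation bounded measure $\mu$ is strongly (resp. weakly) almost periodic if $f*\mu$ is so for every $f\in C_c(X)$. A weakly almost periodic function $f$ has a mean $M(f)$, the limit of its averages along any Følner sequence. A weakly almost periodic measure $\mu$ has a mean $M(\mu)$, the number with $M(\mu*f)=M(\mu)\int_X f(t)\,dt$ for all $f\in C_c(X)$. Fourier–Bohr series. A formal sum is an expression $\omega=\sum_{y\in\mathbb{R}^d}\omega_y\delta_y$ with $\omega_y\in\mathbb{C}$; it is a measure if $\sum_y|f(y)\omega_y|<\infty$ for all $f\in C_c(\mathbb{R}^d)$ and $f\mapsto\sum_y f(y)\omega_y$ is a measure (it is then identified with this pure point measure). For a weakly almost periodic $\mu$, $c_y(\mu)=M(\overline{\chi_y}\mu)$ and $\mathcal{F}_{\mathsf d}(\mu)=\sum_{y\in\mathbb{R}^d}c_y(\mu)\delta_y$. *)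

(* Defs.v *)
From HB Require Import structures.
From mathcomp Require Import all_boot all_order all_algebra.
From mathcomp Require Import complex.
From mathcomp Require Import all_classical all_reals all_analysis.

Set Implicit Arguments.
Unset Strict Implicit.
Unset Printing Implicit Defensive.

Import Order.TTheory GRing.Theory Num.Theory.
Import numFieldNormedType.Exports.

Local Open Scope classical_set_scope.
Local Open Scope ring_scope.

(* Lebesgue measure on R^d = 'rV[R]_d, as an iterated product of the
   one-dimensional Lebesgue measure.  The sigma-algebra is the one generated by
   the coordinates, as the library does for tuples; since R is second countable
   it is the Borel sigma-algebra of the topology of 'rV[R]_d. *)

Definition rV_display : measure_display.
Proof. exact: default_measure_display. Qed.

Section rV_measurable.
Context (R : realType) (d : nat).

Definition rV_coord (i : 'I_d) (x : 'rV[R]_d) : measurableTypeR R := x 0 i.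

HB.instance Definition _ := @isMeasurable.Build rV_display 'rV[R]_d
  (g_sigma_preimage rV_coord) (@sigma_algebra0 _ setT _) (@sigma_algebraC _ _)
  (@sigma_algebra_bigcup _ setT _).

Lemma measurable_rV_coord i : measurable_fun setT (rV_coord i).
Proof.
move=> _ Y mY; rewrite setTI; apply: sub_sigma_algebra => /=.
rewrite -bigcup_seq/=; exists i => /=; first by rewrite mem_index_enum.
by exists Y => //; rewrite setTI.
Qed.

Lemma measurable_fun_rV_coordP d' (T : measurableType d') (f : T -> 'rV[R]_d) :
  measurable_fun setT f <-> forall i, measurable_fun setT (rV_coord i \o f).
Proof.
split=> [mf i|mf].
  by apply: measurableT_comp mf; exact: measurable_rV_coord.
move=> _ A mA; rewrite setTI.
suff : g_sigma_preimage rV_coord `<=` [set B | measurable (f @^-1` B)].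
  by apply.
apply: smallest_sub.
  split => /=.
  - by rewrite preimage_set0.
  - by move=> B mB; rewrite setTD preimage_setC; exact: measurableC.
  - by move=> F mF; rewrite preimage_bigcup; exact: bigcupT_measurable.
rewrite -bigcup_seq => B [i _ [C mC <-]] /=.
by rewrite setTI -(setTI (_ @^-1` _)); apply: (mf i).
Qed.

End rV_measurable.

Section rV_cons.
Context (R : realType) (d : nat).

Definition rV_cons (p : measurableTypeR R * 'rV[R]_d) : 'rV[R]_d.+1 :=
  row_mx (const_mx p.1 : 'rV[R]_1) p.2.

Definition rV_uncons (x : 'rV[R]_d.+1) : measurableTypeR R * 'rV[R]_d :=
  (x 0 0, rsubmx (x : 'rV[R]_(1 + d))).

Lemma rV_consK : cancel rV_cons rV_uncons.
Proof.
move=> [t v]; rewrite /rV_cons /rV_uncons row_mxKr; congr pair.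
rewrite (_ : 0 = lshift d (0 : 'I_1)); last exact: val_inj.
by rewrite (row_mxEl (const_mx t : 'rV[R]_1) v) mxE.
Qed.

Lemma measurable_rV_cons : measurable_fun setT rV_cons.
Proof.
apply/measurable_fun_rV_coordP => i.
case: (splitP (i : 'I_(1 + d))) => j ij.
  rewrite (_ : _ \o _ = fst); first exact: measurable_fst.
  apply/funext => p; rewrite /rV_coord /rV_cons /=.
  rewrite (_ : i = lshift d j); last exact: val_inj.
  by rewrite (row_mxEl (const_mx p.1 : 'rV[R]_1) p.2) mxE.
rewrite (_ : _ \o _ = rV_coord j \o snd).
  by apply: measurableT_comp; [exact: measurable_rV_coord|exact: measurable_snd].
apply/funext => p; rewrite /rV_coord /rV_cons /=.
rewrite (_ : i = rshift 1 j); last exact: val_inj.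
by rewrite (row_mxEr (const_mx p.1 : 'rV[R]_1) p.2).
Qed.

Lemma measurable_rV_uncons : measurable_fun setT rV_uncons.
Proof.
apply/measurable_fun_pairP; split => /=; first exact: (measurable_rV_coord 0).
apply/measurable_fun_rV_coordP => i.
rewrite (_ : _ \o _ = @rV_coord R d.+1 (rshift 1 i)).
  exact: measurable_rV_coord.
by apply/funext => x; rewrite /rV_coord /rV_uncons /= mxE.
Qed.

Variable m : {sigma_finite_measure set 'rV[R]_d -> \bar R}.

Definition lebesgue_cons : set 'rV[R]_d.+1 -> \bar R :=
  pushforward (lebesgue_measure \x m)%E rV_cons.

HB.instance Definition _ :=
  isMeasurableFun.Build _ _ _ _ rV_cons measurable_rV_cons.

Let lebesgue_cons0 : lebesgue_cons set0 = 0%E.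
Proof. exact: measure0. Qed.

Let lebesgue_cons_ge0 A : (0 <= lebesgue_cons A)%E.
Proof. exact: measure_ge0. Qed.

Let lebesgue_cons_sigma_additive : semi_sigma_additive lebesgue_cons.
Proof. exact: measure_semi_sigma_additive. Qed.

HB.instance Definition _ := isMeasure.Build _ _ _ lebesgue_cons
  lebesgue_cons0 lebesgue_cons_ge0 lebesgue_cons_sigma_additive.

Lemma sigma_finite_lebesgue_cons : sigma_finite setT lebesgue_cons.
Proof.
have /sigma_finiteP[F [TF ndF Foo]] :=
  sigma_finiteT (lebesgue_measure : {sigma_finite_measure set (measurableTypeR R) -> \bar R}).
have /sigma_finiteP[G [TG ndG Goo]] := sigma_finiteT m.
exists (fun n => rV_uncons @^-1` (F n `*` G n)).
  apply/esym; rewrite -subTset => x _.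
  have [n _ Fn] : (\bigcup_n F n) (rV_uncons x).1 by rewrite -TF.
  have [k _ Gk] : (\bigcup_n G n) (rV_uncons x).2 by rewrite -TG.
  exists (maxn n k) => //; split.
    by move: Fn; exact/subsetPset/ndF/leq_maxl.
  by move: Gk; exact/subsetPset/ndG/leq_maxr.
move=> n; have [mF Fn] := Foo n; have [mG Gn] := Goo n; split.
  rewrite -[X in measurable X]setTI; apply: measurable_rV_uncons => //.
  exact: measurableX.
rewrite /lebesgue_cons /pushforward -comp_preimage.
rewrite (_ : rV_uncons \o rV_cons = id); last exact/funext/rV_consK.
by rewrite preimage_id product_measure1E// lte_mul_pinfty// ge0_fin_numE.
Qed.

HB.instance Definition _ := Measure_isSigmaFinite.Build _ _ _ lebesgue_cons
  sigma_finite_lebesgue_cons.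

End rV_cons.

Fixpoint lebesgue_rV (R : realType) (d : nat) :
    {sigma_finite_measure set 'rV[R]_d -> \bar R} :=
  match d with
  | 0 => \d_(0 : 'rV[R]_0)
  | d'.+1 => lebesgue_cons (lebesgue_rV R d')
  end.

Section cc_functions.
Context (R : realType) (d : nat).

(* R[i] through its numFieldType instance, hence with the topology of its
   norm. *)
Local Notation C :=
  (Num.NumField.sort (ComplexField.complex_complex__canonical__Num_NumField R)).
Local Notation X := 'rV[R]_d.
Implicit Types (f g : X -> C) (x y t : X).

Definition supp f : set X := closure [set x | f x != 0].

Definition Cc f : Prop := continuous f /\ compact (supp f).

Definition sup_norm f : R := sup [set Normc.normc (f x) | x in setT].

Definition integral_rV (A : set X) f : C :=
  (\int[lebesgue_rV R d]_(x in A) complex.Re (f x)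
   +i* \int[lebesgue_rV R d]_(x in A) complex.Im (f x))%C.

Definition dotp x y : R := \sum_(i < d) x 0 i * y 0 i.

Definition chi y x : C :=
  (cos (2 * pi * dotp x y) +i* sin (2 * pi * dotp x y))%C.

Definition inv_fourier f y : C := integral_rV setT (fun x => f x * chi y x).

Definition tilde f x : C := (f (- x))^*%C.

Definition dagger f x : C := f (- x).

Definition convolve f g x : C := integral_rV setT (fun t => f (x - t) * g t).

End cc_functions.

Section measures.
Context (R : realType) (d : nat).

Local Notation C :=
  (Num.NumField.sort (ComplexField.complex_complex__canonical__Num_NumField R)).
Local Notation X := 'rV[R]_d.

(* A functional on C_c(X) is represented by a total function; its values
   outside C_c(X) are never used. *)
Definition functional : Type := (X -> C) -> C.

Implicit Types (mu nu : functional) (f g : X -> C) (x y t : X).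

Definition radon_measure mu : Prop :=
  (forall (a : C) f g, Cc f -> Cc g ->
     mu (fun x => a * f x + g x) = a * mu f + mu g) /\
  (forall K : set X, compact K -> exists CK : R,
     forall f, Cc f -> supp f `<=` K ->
       Normc.normc (mu f) <= CK * sup_norm f).

(* |mu|(h) for h nonnegative and lower semicontinuous. *)
Definition variation_lsc mu (h : X -> \bar R) : \bar R :=
  ereal_sup [set (Normc.normc (mu g))%:E |
    g in [set g | Cc g /\ forall x, ((Normc.normc (g x))%:E <= h x)%E]].

(* The upper integral of h >= 0 with respect to |mu|, as in Bourbaki; on
   indicator functions it is the outer measure associated with |mu|, which is
   |mu|(A) when A is compact. *)
Definition upper_integral mu (h : X -> \bar R) : \bar R :=
  ereal_inf [set variation_lsc mu k |
    k in [set k : X -> \bar R |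
      lower_semicontinuous k /\ forall x, (h x <= k x)%E]].

Definition variation mu (A : set X) : \bar R :=
  upper_integral mu (fun x => (\1_A x)%:E).

(* L^1(|mu|) is the closure of C_c(X) for the seminorm |mu|^*(|.|), and the
   integral is the continuous extension of mu to it. *)
Definition L1 mu (g : X -> C) : Prop :=
  forall e : R, 0 < e -> exists2 f, Cc f &
    (upper_integral mu (fun x => (Normc.normc (g x - f x))%:E) < e%:E)%E.

Definition has_integral mu (g : X -> C) (z : C) : Prop :=
  forall e : R, 0 < e -> exists f, [/\ Cc f,
    (upper_integral mu (fun x => (Normc.normc (g x - f x))%:E) < e%:E)%E &
    Normc.normc (mu f - z) < e].

Definition dagger_measure mu : functional := fun f => mu (dagger f).

Definition translate x (A : set X) : set X := [set x + a | a in A].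

Definition translation_bounded mu : Prop :=
  forall K : set X, compact K ->
    (ereal_sup [set variation mu (translate x K) | x in setT] < +oo)%E.

Definition convolve_measure f mu : X -> C := fun x => mu (fun y => f (x - y)).

Definition is_fourier_transform nu nuhat : Prop :=
  [/\ radon_measure nu, radon_measure nuhat &
   forall f, Cc f ->
     L1 nuhat (fun y => `|inv_fourier f y| ^+ 2) /\
     has_integral nuhat (fun y => `|inv_fourier f y| ^+ 2)
       (nu (convolve f (tilde f)))].

Definition Cu f : Prop :=
  (exists M : R, forall x, Normc.normc (f x) <= M) /\ unif_continuous f.

(* C_u(X) is closed in the space of all functions with the uniform topology,
   and that topology restricts on C_u(X) to the one of the sup norm, so the
   closure may be taken in {uniform X -> C}. *)
Definition strongly_ap_fun f : Prop :=
  Cu f /\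
  compact (closure
    ([set (fun x => f (x - t)) | t in setT] : set {uniform X -> C})).

Definition strongly_ap mu : Prop :=
  [/\ radon_measure mu, translation_bounded mu &
   forall f, Cc f -> strongly_ap_fun (convolve_measure f mu)].

Definition folner (A : (set X)^nat) : Prop :=
  (forall n, [/\ measurable (A n), compact (closure (A n)) &
     (0 < lebesgue_rV R d (A n))%E]) /\
  (forall x, (fun n =>
     fine (lebesgue_rV R d (A n `+` translate x (A n)))
       / fine (lebesgue_rV R d (A n))) @ \oo --> (0 : R)).

Definition has_mean f (m : C) : Prop :=
  forall A, folner A ->
    (fun n => integral_rV (A n) f / (fine (lebesgue_rV R d (A n)))%:C%C : C)
      @ \oo --> m.

Definition measure_has_mean mu (m : C) : Prop :=
  forall f, Cc f -> has_mean (convolve_measure f mu) (m * integral_rV setT f).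

(* The default value 0 is never used on weakly, hence on strongly, almost
   periodic measures. *)
Definition mean mu : C := xget (0 : C) [set m | measure_has_mean mu m].

Definition twist y mu : functional := fun f => mu (fun x => (chi y x)^*%C * f x).

(* A formal sum is given by its family of coefficients. *)
Definition fourier_bohr mu : X -> C := fun y => mean (twist y mu).

Definition rsum (a : X -> R) : R :=
  fine (esum setT (EFin \o a)^\+%E - esum setT (EFin \o a)^\-%E)%E.

Definition formal_sum (w : X -> C) : functional := fun f =>
  (rsum (fun y => complex.Re (f y * w y))
   +i* rsum (fun y => complex.Im (f y * w y)))%C.

Definition formal_sum_is_measure (w : X -> C) : Prop :=
  (forall f, Cc f ->
     (\esum_(y in setT) (Normc.normc (f y * w y))%:E < +oo)%E) /\
  radon_measure (formal_sum w).

End measures.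

(* Main.v *)
Require Import Defs.
From HB Require Import structures.
From mathcomp Require Import all_boot all_order all_algebra.
From mathcomp Require Import complex ring lra zify.
From mathcomp Require Import all_classical all_reals all_analysis measurable_realfun.

Set Implicit Arguments.
Unset Strict Implicit.
Unset Printing Implicit Defensive.

Import Order.TTheory GRing.Theory Num.Theory.
Import numFieldNormedType.Exports.

Local Open Scope classical_set_scope.
Local Open Scope ring_scope.

(** Write [h] for the power spectrum [|inv_fourier f|^2] of a test function [f],
    and [P] for its autocorrelation [f * tilde f]. The whole argument is about
    one function on the frequency side,
      [F(a) = integral of h (x - a) with respect to mu].

    The integral makes sense because the suprema of [h] over the unit cells of
    the lattice are summable ([amal_power]), whereas a translation bounded
    measure has uniformly bounded mass on the cells; so [F] is the uniform limit
    of the convolutions of [mu] with truncations of [h]. These convolutions are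
    almost periodic, hence so is [F], and its Fourier-Bohr coefficient at [y] is
    the coefficient of [mu] at [y] times the integral of [h] against [chi y],
    that is, times [P (- y)] by Fourier inversion ([power_ext]). The functional
    sending [g] to the mean of [(g * mu) conj(chi y)] is a twisted Haar integral,
    so uniqueness of Haar measure is what makes the coefficients of [mu] exist
    and factor out ([bohr_coefficient], [fourier_bohrP]).

    If the Fourier-Bohr series of [mu] is a measure, the coefficients of [F] are
    absolutely summable, because [P] has compact support. An almost periodic
    function is determined by its coefficients ([vec_uniqueness]), so [F] is the
    sum of its Bohr series ([bohr_expansion]); at the origin this reads
      [integral of |inv_fourier f|^2 with respect to mu
         = sum over y of (coefficient of mu at y) * P (- y)],
    which says that [mu] is the transform of the reflected series.

    If [mu] is the transform of [nu], modulating [f] gives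
    [F(a) = nu (P * conj(chi a))]. Test the coefficients of [F] on a finite set
    of frequencies against phases and replace the mean by an average over a
    grid: their absolute sum becomes, up to a small error, [nu] applied to [P]
    times a combination of Dirichlet kernels. On the support of [P] these
    kernels are concentrated at separated points, so the sum is bounded
    independently of the finite set ([transform_coefficients]). Taking for [f] a
    wide cutoff, [P] is at least [1] on a given ball, so the coefficients of [mu]
    are locally summable, which makes the series a measure.

    Three classical facts carry this. Almost periodic functions are
    treated on arbitrary abelian groups, and their mean is a limit of averages
    of translates, which agrees with the mean along Folner sequences
    ([has_mean_ap]). Uniqueness of the coefficients is proved for sequences
    ([int_uniqueness]), then on the line ([real_uniqueness]), then one
    coordinate at a time. The Plancherel formula and Fourier inversion come from
    the case of the Dirac comb of the integer lattice, where the function [F]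
    above is computed by the Parseval identity for periodic functions
    ([period_meanE], [plancherel], [inversion]). *)


Notation CC R :=
  (Num.NumField.sort (ComplexField.complex_complex__canonical__Num_NumField R)).
Notation nrm := Normc.normc.
Notation cj z := (z^*%C).
Notation rc r := (r%:C%C).

(** * Complex numbers and the exponential *)

Section complex_norm.
Variable R : realType.
Local Notation C := (CC R).
Implicit Types (z w : C) (r : R).

Lemma nrm0 : nrm (0 : C) = 0. Proof. exact: Normc.normc0. Qed.
Lemma nrm1 : nrm (1 : C) = 1. Proof. exact: Normc.normc1. Qed.
Lemma nrmM z w : nrm (z * w) = nrm z * nrm w. Proof. exact: Normc.normcM. Qed.
Lemma nrmD z w : nrm (z + w) <= nrm z + nrm w. Proof. exact: le_normcD. Qed.
Lemma nrmN z : nrm (- z) = nrm z. Proof. exact: normcN. Qed.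
Lemma nrmE z : `|z| = rc (nrm z). Proof. by case: z. Qed.

Lemma nrm_ge0 z : 0 <= nrm z. Proof. by case: z => a b; exact: sqrtr_ge0. Qed.
Lemma nrm_eq0 z : (nrm z == 0) = (z == 0).
Proof. by apply/eqP/eqP => [/Normc.eq0_normc //|->]; exact: nrm0. Qed.
Lemma nrmC z w : nrm (z - w) = nrm (w - z). Proof. by rewrite -nrmN opprB. Qed.
Lemma nrm_tri z w u : nrm (z - u) <= nrm (z - w) + nrm (w - u).
Proof. by have := nrmD (z - w) (w - u); rewrite subrKA. Qed.
Lemma nrmB z w : nrm (z - w) <= nrm z + nrm w.
Proof. by rewrite -(nrmN w) nrmD. Qed.
Lemma nrm_dist z w : `|nrm z - nrm w| <= nrm (z - w).
Proof.
have h1 := nrmD (z - w) w; have h2 := nrmD (w - z) z.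
rewrite !subrK in h1 h2; rewrite nrmC in h2; rewrite ler_norml; lra.
Qed.
Lemma nrm_sum (I : Type) (s : seq I) (P : pred I) (F : I -> C) :
  nrm (\sum_(i <- s | P i) F i) <= \sum_(i <- s | P i) nrm (F i).
Proof.
elim/big_ind2: _ => //; first by rewrite nrm0.
by move=> a b c e ab ce; have := nrmD b e; lra.
Qed.
Lemma nrm_conj z : nrm (cj z) = nrm z.
Proof. by case: z => a b /=; rewrite sqrrN. Qed.
Lemma nrm_real r : nrm (rc r : C) = `|r|.
Proof. by rewrite /= expr0n /= addr0 sqrtr_sqr. Qed.
Lemma nrm_nat n : nrm (n%:R : C) = n%:R.
Proof. by rewrite -[n%:R in LHS](rmorph_nat (real_complex R)) nrm_real ger0_norm. Qed.
Lemma nrmV z : nrm z^-1 = (nrm z)^-1. Proof. exact: Normc.normcV. Qed.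
Lemma nrmX z n : nrm (z ^+ n) = nrm z ^+ n.
Proof. by elim: n => [|n IH]; rewrite ?expr0 ?nrm1// !exprS nrmM IH. Qed.
Lemma Re_nrm z : `|complex.Re z| <= nrm z.
Proof. by have := normc_ge_Re z; rewrite nrmE lecR. Qed.
Lemma Im_nrm z : `|complex.Im z| <= nrm z.
Proof.
case: z => a b /=; rewrite -(sqrtr_sqr b) ler_sqrt ?addr_ge0 ?sqr_ge0//.
by rewrite lerDr sqr_ge0.
Qed.
Lemma Re_lenrm z : complex.Re z <= nrm z.
Proof. exact: le_trans (ler_norm _) (Re_nrm z). Qed.
Lemma nrm_ReIm z : nrm z <= `|complex.Re z| + `|complex.Im z|.
Proof.
case: z => a b.
have -> : (a +i* b)%C = rc a + rc b * 'i%C :> C by simpc.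
apply: le_trans (nrmD _ _) _; rewrite nrmM !nrm_real.
have -> : nrm ('i%C : C) = 1 by rewrite /= expr0n/= add0r expr1n sqrtr1.
by rewrite mulr1 /= !(mul0r,mulr0,addr0,mul1r,mulr1,subr0,add0r) lexx.
Qed.
Lemma mulcJ z : z * cj z = rc (nrm z ^+ 2).
Proof. by rewrite -sqr_normc nrmE rmorphXn. Qed.
Lemma ReD z w : complex.Re (z + w) = complex.Re z + complex.Re w.
Proof. by case: z w => a b [c e]. Qed.
Lemma ImD z w : complex.Im (z + w) = complex.Im z + complex.Im w.
Proof. by case: z w => a b [c e]. Qed.
Lemma ReN z : complex.Re (- z) = - complex.Re z. Proof. by case: z. Qed.
Lemma Re_sum (I : Type) (s : seq I) (P : pred I) (F : I -> C) :
  complex.Re (\sum_(i <- s | P i) F i) = \sum_(i <- s | P i) complex.Re (F i).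
Proof. by elim/big_ind2: _ => // a b c e <- <-; rewrite ReD. Qed.
Lemma cjM z w : cj (z * w) = cj z * cj w. Proof. exact: rmorphM. Qed.
Lemma cjD z w : cj (z + w) = cj z + cj w. Proof. exact: rmorphD. Qed.
Lemma cjB z w : cj (z - w) = cj z - cj w. Proof. exact: rmorphB. Qed.
Lemma cjK z : cj (cj z) = z. Proof. exact: conjcK. Qed.
Lemma cj_sum (I : Type) (s : seq I) (P : pred I) (F : I -> C) :
  cj (\sum_(i <- s | P i) F i) = \sum_(i <- s | P i) cj (F i).
Proof. exact: rmorph_sum. Qed.
Lemma nrm_le0 z : (forall e, 0 < e -> nrm z <= e) -> z = 0.
Proof.
move=> h; apply/eqP; rewrite -nrm_eq0 eq_le nrm_ge0 andbT.
apply/ler_addgt0Pr => e e0; rewrite add0r; exact: h.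
Qed.
Lemma nrm_eq z w : (forall e, 0 < e -> nrm (z - w) <= e) -> z = w.
Proof. by move=> h; apply/eqP; rewrite -subr_eq0; apply/eqP/nrm_le0. Qed.

End complex_norm.

Section exponential.
Variable R : realType.
Local Notation C := (CC R).
Implicit Types (s t u : R).

(** The character [exp (2 pi i t)] of the line. *)
Definition ee t : C := (cos (2 * pi * t) +i* sin (2 * pi * t))%C.

Lemma eeD s t : ee (s + t) = ee s * ee t.
Proof.
rewrite /ee; set a := 2 * pi * s; set b := 2 * pi * t.
have -> : 2 * pi * (s + t) = a + b by rewrite /a /b; ring.
rewrite cosD sinD; simpc; congr (_ +i* _)%C; ring.
Qed.
Lemma ee0 : ee 0 = 1. Proof. by rewrite /ee mulr0 cos0 sin0. Qed.
Lemma cj_ee t : cj (ee t) = ee (- t).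
Proof. by rewrite /ee mulrN cosN sinN. Qed.
Lemma nrm_ee t : nrm (ee t) = 1.
Proof. by rewrite /ee /= cos2Dsin2 sqrtr1. Qed.
Lemma ee_nat n : ee n%:R = 1.
Proof.
elim: n => [|n IH]; first exact: ee0.
rewrite -natr1 eeD IH mul1r /ee mulr1 mulr_natl cos2pi sin2pi; by [].
Qed.
Lemma ee_int (n : int) : ee n%:~R = 1.
Proof.
case: n => n; first exact: ee_nat.
by rewrite NegzE mulrNz -cj_ee ee_nat /= oppr0.
Qed.
Lemma ee_half : ee (1 / 2) = -1.
Proof.
rewrite /ee; have -> : 2 * pi * (1 / 2) = pi :> R by field.
by rewrite cospi sinpi; apply/eqP; rewrite eq_complex /= oppr0 !eqxx.
Qed.
Lemma eeMn t n : ee (t *+ n) = ee t ^+ n.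
Proof. by elim: n => [|n IH]; rewrite ?mulr0n ?ee0// mulrS exprS eeD IH. Qed.

Lemma sin_le_norm t : `|sin t| <= `|t|.
Proof.
wlog t0 : t / 0 <= t.
  move=> h; case: (leP 0 t) => [/h//|/ltW tn].
  by rewrite -normrN -sinN -(normrN t) h// oppr_ge0.
move: t0; rewrite le_eqVlt => /orP[/eqP<-|t0]; first by rewrite sin0.
have [c _] := @MVT _ sin cos 0 t t0 (fun x _ => is_derive_sin x)
  (continuous_subspaceT (@continuous_sin R)).
rewrite sin0 !subr0 => ->; rewrite normrM ler_piMl//; exact: cos_max.
Qed.

(** [|ee u - 1| = 2 |sin (pi u)|], a chord of the unit circle. *)
Lemma nrm_ee1 u : nrm (ee u - 1) ^+ 2 = 2 - 2 * cos (2 * pi * u).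
Proof.
rewrite /ee /= sqr_sqrtr ?addr_ge0 ?sqr_ge0//.
rewrite ?subr0 ?oppr0 ?addr0; have := cos2Dsin2 (2 * pi * u); move: (cos _) (sin _) => a b; nra.
Qed.

Lemma ee_lip u : nrm (ee u - 1) <= 2 * pi * `|u|.
Proof.
have p0 : 0 <= pi :> R := pi_ge0 R.
have n0 := nrm_ge0 (ee u - 1).
rewrite -(ler_pXn2r (n := 2)) ?nnegrE ?mulr_ge0//.
rewrite nrm_ee1.
have -> : 2 * pi * u = (pi * u) *+ 2 by rewrite -mulr_natl; ring.
rewrite cos_mulr2n; have h2 := cos2Dsin2 (pi * u).
have h1 : sin (pi * u) ^+ 2 <= (pi * u) ^+ 2.
  rewrite -(real_normK (num_real (sin _))) -(real_normK (num_real (pi * u))).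
  by rewrite ler_pXn2r ?nnegrE//; exact: sin_le_norm.
rewrite !exprMn real_normK ?num_real// in h1 *.
rewrite -[_ *+ 2]mulr_natl; lra.
Qed.

Lemma ee_dist s t : nrm (ee s - ee t) <= 2 * pi * `|s - t|.
Proof.
have -> : ee s - ee t = ee t * (ee (s - t) - 1).
  by rewrite mulrBr mulr1 -eeD [t + _]addrC subrK.
by rewrite nrmM nrm_ee mul1r; exact: ee_lip.
Qed.

(** On [[-1/2, 1/2]] the cosine of [2 pi u] is close to [1] only for [u] close
    to [0]. *)
Lemma cos_small (eta : R) : 0 < eta -> eta <= 1/2 ->
  exists2 g : R, g < 1 & forall u, eta <= `|u| -> `|u| <= 1/2 ->
    cos (2 * pi * u) <= g.
Proof.
move=> e0 e2; have p0 : 0 < pi :> R := pi_gt0 R.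
have in0 (x : R) : 0 <= x -> x <= 1/2 -> 2 * pi * x \in `[0, pi].
  move=> x0 x1; rewrite in_itv /= !mulr_ge0 ?(ltW p0)//=.
  have -> : 2 * pi * x = pi * (2 * x) by ring.
  by rewrite ler_piMr ?(ltW p0)//; lra.
exists (cos (2 * pi * eta)).
  rewrite -[ltRHS](cos0 R) ltr_cos; last first.
  - by apply: in0; lra.
  - by rewrite in_itv /= lexx ltW.
  - by rewrite !mulr_gt0.
move=> u eu u2; rewrite -(cos_norm (_ * u)) normrM (ger0_norm (x := 2 * pi)) ?mulr_ge0 ?(ltW p0)//.
rewrite le_eqVlt; case: (eqVneq eta `|u|) => [->|ne]; first by rewrite eqxx.
rewrite ltr_cos; [|apply: in0; lra|apply: in0; lra].
have : eta < `|u| by rewrite lt_neqAle ne.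
by move=> ?; apply/orP; right; rewrite ltr_pM2l// mulr_gt0.
Qed.

Lemma floor_half u : exists n : int, `|u - n%:~R| <= 1/2.
Proof.
exists (Num.floor (u + 1/2)).
have /andP[] := floor_itv (u + 1/2).
rewrite ler_norml intrD => h1 h2; apply/andP; split; lra.
Qed.

Lemma ee_cos_close (eta : R) : 0 < eta ->
  exists2 g : R, 0 <= g < 1 & forall u, g < cos (2 * pi * u) ->
    exists n : int, `|u - n%:~R| < eta.
Proof.
move=> e0; pose eta' := Num.min eta (1/2).
have e'0 : 0 < eta' by rewrite lt_min e0; lra.
have e'2 : eta' <= 1/2 by rewrite ge_min lexx orbT.
have e'e : eta' <= eta by rewrite ge_min lexx.
have [g g1 hg] := cos_small e'0 e'2.
exists (Num.max 0 g); first by rewrite le_max lexx gt_max g1 ltr01.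
move=> u; rewrite gt_max => /andP[_ gu].
have [n nu] := floor_half u; exists n.
rewrite (lt_le_trans _ e'e)// ltNge; apply/negP => /hg/(_ nu).
suff -> : cos (2 * pi * (u - n%:~R)) = cos (2 * pi * u) by rewrite leNgt gu.
have : ee (u - n%:~R) = ee u by rewrite eeD -mulrNz ee_int mulr1.
by rewrite /ee => -[].
Qed.

(** A lower bound away from the integers: it makes geometric sums of powers of
    [ee u] small off the peaks of a Dirichlet kernel. *)
Lemma ee_away (eta : R) : 0 < eta -> eta <= 1/2 ->
  exists2 c : R, 0 < c & forall u, eta <= `|u| -> `|u| <= 1/2 ->
    c <= nrm (ee u - 1).
Proof.
move=> e0 e2; have [g g1 hg] := cos_small e0 e2.
exists (Num.sqrt (2 - 2 * g)); first by rewrite sqrtr_gt0; lra.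
move=> u u1 u2; rewrite -(ler_pXn2r (n := 2)) ?nnegrE ?sqrtr_ge0 ?nrm_ge0//.
rewrite sqr_sqrtr ?nrm_ee1; have := hg u u1 u2; lra.
Qed.

End exponential.

(** * Almost periodic functions and their means *)

Section completeness.
Variable R : realType.
Local Notation C := (CC R).

Lemma real_seq_complete (u : nat -> R) :
  (forall e, 0 < e -> exists N, forall n m, (N <= n)%N -> (N <= m)%N ->
     `|u n - u m| <= e) ->
  exists l, forall e, 0 < e -> exists N, forall n, (N <= n)%N -> `|u n - l| <= e.
Proof.
move=> cu.
have /cauchy_cvgP ucv : cauchy (u @ \oo).
  apply: cauchy_exP => e e0; have [N hN] := cu (e / 2) (divr_gt0 e0 (ltr0Sn _ _)).
  exists (u N); exists N => // n /= Nn.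
  by rewrite /ball /=; have := hN N n (leqnn _) Nn; lra.
exists (lim (u @ \oo)) => e e0.
have /cvgrPdist_le/(_ e e0)[N _ hN] := ucv.
by exists N => n Nn; rewrite distrC; exact: hN.
Qed.

Lemma complex_seq_complete (u : nat -> C) :
  (forall e, 0 < e -> exists N, forall n m, (N <= n)%N -> (N <= m)%N ->
     nrm (u n - u m) <= e) ->
  exists l, forall e, 0 < e -> exists N, forall n, (N <= n)%N -> nrm (u n - l) <= e.
Proof.
move=> cu.
have [e e0|a ha] := @real_seq_complete (fun n => complex.Re (u n)).
  have [N hN] := cu e e0; exists N => n m Nn Nm.
  by apply: le_trans (hN n m Nn Nm); rewrite -ReN -ReD Re_nrm.
have [e e0|b hb] := @real_seq_complete (fun n => complex.Im (u n)).
  have [N hN] := cu e e0; exists N => n m Nn Nm.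
  apply: le_trans (hN n m Nn Nm); apply: le_trans (Im_nrm _).
  by rewrite ImD; case: (u m).
exists (a +i* b)%C => e e0; have e20 : 0 < e / 2 by lra.
have [N1 h1] := ha _ e20; have [N2 h2] := hb _ e20.
exists (maxn N1 N2) => n; rewrite geq_max => /andP[n1 n2].
apply: le_trans (nrm_ReIm _) _.
have := h1 n n1; have := h2 n n2; case: (u n) => c f /=; lra.
Qed.

End completeness.

Section almost_periodic.
Variables (R : realType) (G : zmodType).
Local Notation C := (CC R).
Implicit Types (f g : G -> C) (x y t : G) (e : R).

(** Total boundedness of the set of translates, for the sup norm. The group
    carries no topology, so the notion and the mean below serve the integers,
    the line, row vectors and products at once. *)
Definition ap f := forall e, 0 < e -> exists s : seq G,
  forall t, exists2 t', t' \in s & forall x, nrm (f (x + t) - f (x + t')) <= e.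

Lemma ap_bounded f : ap f -> exists2 M, 0 <= M & forall x, nrm (f x) <= M.
Proof.
move=> /(_ 1 ltr01)[s hs]; exists (1 + \sum_(t <- s) nrm (f t)).
  by rewrite addr_ge0// sumr_ge0// => i _; exact: nrm_ge0.
move=> x; have [t' t's /(_ 0)] := hs x; rewrite !add0r => h.
have : nrm (f t') <= \sum_(t <- s) nrm (f t).
  rewrite (big_rem t')//= lerDl sumr_ge0// => i _; exact: nrm_ge0.
have := nrmD (f x - f t') (f t'); rewrite subrK; lra.
Qed.

(** The translations of the nets of [f] and [g] cannot be used for both; in each
    class common to the two nets one actual translation is selected. *)
Lemma ap_common f g e : ap f -> ap g -> 0 < e -> exists s : seq G,
  forall t, exists2 t', t' \in s & forall x,
    nrm (f (x + t) - f (x + t')) <= e /\ nrm (g (x + t) - g (x + t')) <= e.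
Proof.
move=> af ag e0; have e20 : 0 < e / 2 by lra.
have [s1 h1] := af _ e20; have [s2 h2] := ag _ e20.
pose P a b t := forall x,
  nrm (f (x + t) - f (x + a)) <= e / 2 /\ nrm (g (x + t) - g (x + b)) <= e / 2.
exists [seq xget 0 [set t | P a b t] | a <- s1, b <- s2] => t.
have [a as1 ha] := h1 t; have [b bs2 hb] := h2 t.
have : P a b (xget 0 [set t | P a b t]).
  by apply: (@xgetPex _ 0 [set t | P a b t]); exists t => x; split.
move=> hP; exists (xget 0 [set t | P a b t]).
  by apply/allpairsP; exists (a, b).
move=> x; have [] := hP x; have := ha x; have := hb x.
set t' := xget _ _ => h3 h4 h5 h6; split.
  by have := nrm_tri (f (x + t)) (f (x + a)) (f (x + t')); rewrite (nrmC (f (x + a))); lra.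
by have := nrm_tri (g (x + t)) (g (x + b)) (g (x + t')); rewrite (nrmC (g (x + b))); lra.
Qed.

Lemma ap_add f g : ap f -> ap g -> ap (fun x => f x + g x).
Proof.
move=> af ag e e0; have [|s hs] := ap_common (e := e / 2) af ag; first by lra.
exists s => t; have [t' t's h] := hs t; exists t' => // x; have [h1 h2] := h x.
rewrite opprD addrACA; apply: le_trans (nrmD _ _) _; lra.
Qed.

Lemma ap_mul f g : ap f -> ap g -> ap (fun x => f x * g x).
Proof.
move=> af ag e e0; have [M M0 hM] := ap_bounded af; have [N N0 hN] := ap_bounded ag.
have d0 : 0 < e / (M + N + 1) by apply: divr_gt0 => //; lra.
have [s hs] := ap_common af ag d0.
exists s => t; have [t' t's h] := hs t; exists t' => // x; have [h1 h2] := h x.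
have -> : f (x + t) * g (x + t) - f (x + t') * g (x + t') =
  (f (x + t) - f (x + t')) * g (x + t) + f (x + t') * (g (x + t) - g (x + t')) by ring.
apply: le_trans (nrmD _ _) _; rewrite !nrmM.
have l1 : nrm (f (x + t) - f (x + t')) * nrm (g (x + t)) <= e / (M + N + 1) * N.
  by rewrite ler_pM ?nrm_ge0.
have l2 : nrm (f (x + t')) * nrm (g (x + t) - g (x + t')) <= M * (e / (M + N + 1)).
  by rewrite ler_pM ?nrm_ge0.
have : e / (M + N + 1) * (M + N + 1) = e by rewrite divfK//; lra.
lra.
Qed.

Lemma ap_lip f (h : C -> C) : (forall a b, nrm (h a - h b) <= nrm (a - b)) ->
  ap f -> ap (fun x => h (f x)).
Proof.
move=> hh af e e0; have [s hs] := af e e0; exists s => t.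
by have [t' t's ht] := hs t; exists t' => // x; exact: le_trans (hh _ _) (ht x).
Qed.

Lemma ap_conj f : ap f -> ap (fun x => cj (f x)).
Proof. by apply: ap_lip => a b; rewrite -cjB nrm_conj. Qed.

Lemma ap_cst (c : C) : ap (fun=> c).
Proof.
by move=> e e0; exists [:: 0] => t; exists 0; rewrite ?inE// => x; rewrite subrr nrm0 ltW.
Qed.

Lemma ap_scale (c : C) f : ap f -> ap (fun x => c * f x).
Proof. by move=> af; apply: (@ap_mul (fun=> c) f) => //; exact: ap_cst. Qed.

Lemma ap_opp f : ap f -> ap (fun x => - f x).
Proof. by apply: (@ap_lip f -%R) => a b; rewrite -opprD nrmN. Qed.

Lemma ap_sub f g : ap f -> ap g -> ap (fun x => f x - g x).
Proof. by move=> af /ap_opp; exact: ap_add. Qed.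

Lemma ap_sum (I : Type) (r : seq I) (F : I -> G -> C) :
  (forall i, ap (F i)) -> ap (fun x => \sum_(i <- r) F i x).
Proof.
move=> aF; elim: r => [|i r IH].
  by under eq_fun do rewrite big_nil; exact: (@ap_cst 0).
by under eq_fun do rewrite big_cons; exact: ap_add (aF i) IH.
Qed.

Lemma ap_nrm f : ap f -> ap (fun x => rc (nrm (f x))).
Proof.
apply: (@ap_lip f (fun z => rc (nrm z) : C)) => a b.
by rewrite -rmorphB nrm_real nrm_dist.
Qed.

Lemma ap_shift f a : ap f -> ap (fun x => f (x + a)).
Proof.
move=> af e e0; have [s hs] := af e e0; exists s => t.
have [t' t's h] := hs t; exists t' => // x.
by have := h (x + a); rewrite addrAC (addrAC x a).
Qed.

Lemma ap_lim f : (forall e, 0 < e -> exists2 g, ap g & forall x, nrm (f x - g x) <= e) ->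
  ap f.
Proof.
move=> h e e0; have [|g ag hg] := h (e / 3); first by lra.
have [|s hs] := ag (e / 3); first by lra.
exists s => t; have [t' t's ht] := hs t; exists t' => // x.
have h1 := nrm_tri (f (x + t)) (g (x + t)) (f (x + t')).
have h2 := nrm_tri (g (x + t)) (g (x + t')) (f (x + t')).
have h3 := hg (x + t); have h4 := hg (x + t'); have h5 := ht x.
rewrite nrmC in h4; lra.
Qed.

End almost_periodic.

Section averages.
Variables (R : realType) (H G : zmodType) (phi : H -> G).
Hypothesis phiD : {morph phi : a b / a + b >-> a + b}.
Local Notation C := (CC R).
Implicit Types (f g : G -> C) (x y : G) (e : R) (p q : seq H).

Definition avg p f x : C := (size p)%:R^-1 * \sum_(t <- p) f (x + phi t).
(** The index set of a composition of two averages. *)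
Definition padd p q : seq H := [seq a + b | a <- p, b <- q].

Lemma size_neq0 p : p != [::] -> (size p)%:R != 0 :> C.
Proof. by rewrite pnatr_eq0 size_eq0. Qed.

Lemma padd_neq0 p q : p != [::] -> q != [::] -> padd p q != [::].
Proof.
by move=> p0 q0; rewrite -size_eq0 size_allpairs muln_eq0 !size_eq0 negb_or p0.
Qed.

Lemma avg_avg p q f x : avg p (avg q f) x = avg (padd p q) f x.
Proof.
rewrite /avg size_allpairs big_allpairs_dep natrM invfM -mulrA; congr (_ * _).
rewrite mulr_sumr; apply: eq_bigr => a _; congr (_ * _); apply: eq_bigr => b _.
by rewrite phiD addrA.
Qed.

Lemma avg_avgC p q f x : avg p (avg q f) x = avg q (avg p f) x.
Proof.
rewrite /avg -[RHS]mulrC -[LHS]mulrC.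
under eq_bigr do rewrite mulrC.
under [in RHS]eq_bigr do rewrite mulrC.
rewrite -!mulr_suml mulrAC; congr (_ * _ * _); rewrite exchange_big/=.
by apply: eq_bigr => a _; apply: eq_bigr => b _; rewrite addrAC.
Qed.

Lemma avg_dist p f g x e : p != [::] -> (forall y, nrm (f y - g y) <= e) ->
  nrm (avg p f x - avg p g x) <= e.
Proof.
move=> p0 h; rewrite /avg -mulrBr -sumrB nrmM nrmV nrm_nat.
have s0 : 0 < (size p)%:R :> R by rewrite ltr0n lt0n size_eq0.
rewrite ler_pdivrMl//; apply: le_trans (nrm_sum _ _ _) _.
have -> : (size p)%:R * e = \sum_(i <- p) e.
  by rewrite big_const_seq count_predT iter_addr_0 mulr_natl.
by apply: ler_sum => i _; exact: h.
Qed.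

Lemma avg_id p f x c : p != [::] -> (forall h, f (x + phi h) = c) -> avg p f x = c.
Proof.
move=> p0 h; rewrite /avg; under eq_bigr do rewrite h.
rewrite big_const_seq count_predT iter_addr_0 -[c *+ _]mulr_natl mulKf//.
exact: size_neq0.
Qed.

Lemma avgD p f g x : avg p (fun y => f y + g y) x = avg p f x + avg p g x.
Proof. by rewrite /avg big_split mulrDr. Qed.

Lemma avgZ p (c : G -> C) f x : (forall y h, c (y + phi h) = c y) ->
  avg p (fun y => c y * f y) x = c x * avg p f x.
Proof.
move=> hc; rewrite /avg mulrCA; congr (_ * _); rewrite mulr_sumr.
by apply: eq_bigr => t _; rewrite hc.
Qed.

Lemma ap_avg p f : ap f -> ap (avg p f).
Proof.
move=> af; apply: ap_mul; first exact: ap_cst.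
by apply: ap_sum => t; exact: ap_shift.
Qed.

(** The net of [f] need not consist of translations in the image of [phi]; one
    such translation is selected in each class that contains any. *)
Lemma ap_along f e : ap f -> 0 < e -> exists s : seq H,
  forall t, exists2 t', t' \in s & forall x, nrm (f (x + phi t) - f (x + phi t')) <= e.
Proof.
move=> af e0; have [|s hs] := af (e / 2); first by lra.
pose P a t := forall x, nrm (f (x + phi t) - f (x + a)) <= e / 2.
exists [seq xget 0 [set t | P a t] | a <- s] => t.
have [a sa ha] := hs (phi t).
exists (xget 0 [set t | P a t]); first exact: map_f.
have : P a (xget 0 [set t | P a t]).
  by apply: (@xgetPex _ 0 [set t | P a t]); exists t.
set t' := xget _ _ => h x; have := h x; have := ha x.
have := nrm_tri (f (x + phi t)) (f (x + a)) (f (x + phi t')).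
rewrite (nrmC (f (x + a))); lra.
Qed.

(** Averaging a function over a long progression of step [t] makes it nearly
    invariant under [t]; composing such averages over a finite net of
    translates makes it nearly invariant under all translations. *)
Lemma avg_flat f e : ap f -> 0 < e -> exists2 p, p != [::] &
  forall x h, nrm (avg p f (x + phi h) - avg p f x) <= e.
Proof.
move=> af e0; have [|s hs] := @ap_along f (e / 2) af; first by lra.
have [M M0 hM] := ap_bounded af.
pose n := (Num.truncn (2 * M / (e / 2))).+1.
have nM : 2 * M / n%:R <= e / 2.
  have ne : 2 * M / (e / 2) < n%:R by exact: truncnS_gt.
  rewrite ler_pdivrMr ?ltr0n// [e / 2 * _]mulrC -ler_pdivrMr; last by lra.
  exact: (ltW ne).
pose prog (t : H) := [seq t *+ k | k <- iota 0 n].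
have prog0 t : prog t != [::] by rewrite -size_eq0 size_map size_iota.
have hprog t x : nrm (avg (prog t) f (x + phi t) - avg (prog t) f x) <= e / 2.
  apply: le_trans nM; rewrite /avg !size_map size_iota -mulrBr nrmM nrmV nrm_nat.
  rewrite mulrC ler_pM2r ?invr_gt0 ?ltr0n// !big_map -sumrB.
  rewrite -[iota 0 n]/(index_iota 0 n).
  under eq_bigr do rewrite -addrA -phiD -mulrS.
  rewrite (@telescope_sumr _ 0 n (fun k => f (x + phi (t *+ k))))//.
  by apply: le_trans (nrmB _ _) _; have := hM (x + phi (t *+ n)); have := hM (x + phi (t *+ 0)); lra.
pose P := foldr (fun t q => padd (prog t) q) [:: (0 : H)].
have P0 r : P r != [::] by elim: r => // a r IH; exact: padd_neq0.
have hP r t : t \in r -> forall x, nrm (avg (P r) f (x + phi t) - avg (P r) f x) <= e / 2.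
  elim: r => // a r IH; rewrite inE => /orP[/eqP ->|tr] x.
    rewrite /= -!avg_avg !(avg_avgC (prog a)).
    have -> : avg (P r) (avg (prog a) f) (x + phi a) =
      avg (P r) (fun y => avg (prog a) f (y + phi a)) x.
      by rewrite {1 3}/avg; congr (_ * _); apply: eq_bigr => i _; rewrite addrAC.
    exact: avg_dist.
  rewrite /= -!avg_avg.
  have -> : avg (prog a) (avg (P r) f) (x + phi t) =
    avg (prog a) (fun y => avg (P r) f (y + phi t)) x.
    by rewrite {1 3}/avg; congr (_ * _); apply: eq_bigr => i _; rewrite addrAC.
  by apply: avg_dist => // y; exact: IH.
exists (P s) => // x h; have [t' t's ht] := hs h.
have h1 : nrm (avg (P s) f (x + phi h) - avg (P s) f (x + phi t')) <= e / 2.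
  have hs' a : avg (P s) f (x + phi a) = avg (P s) (fun y => f (y + phi a)) x.
    by rewrite /avg; congr (_ * _); apply: eq_bigr => i _; rewrite addrAC.
  by rewrite !hs'; apply: (avg_dist _ (P0 s)) => y; exact: ht.
have h2 := hP _ _ t's x.
have := nrm_tri (avg (P s) f (x + phi h)) (avg (P s) f (x + phi t')) (avg (P s) f x).
lra.
Qed.

(** [m] is the conditional expectation of [f] given the translations by the
    image of [phi]: a uniform limit of averages of translates. *)
Definition isexp f m :=
  (forall x h, m (x + phi h) = m x) /\
  forall e, 0 < e -> exists2 p, p != [::] & forall x, nrm (avg p f x - m x) <= e.

(** Further averaging does not spoil the approximation of an invariant function,
    so averaging sets that are good for different functions can be merged. *)
Lemma isexp_avg p q f m x e : p != [::] -> q != [::] ->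
  (forall y h, m (y + phi h) = m y) ->
  (forall y, nrm (avg p f y - m y) <= e) -> nrm (avg (padd p q) f x - m x) <= e.
Proof.
move=> p0 q0 hm hp; rewrite -avg_avg avg_avgC -[m x](@avg_id q m x)//.
exact: avg_dist.
Qed.

Lemma isexp_common f g m m' e : isexp f m -> isexp g m' -> 0 < e ->
  exists2 p, p != [::] & forall x,
    nrm (avg p f x - m x) <= e /\ nrm (avg p g x - m' x) <= e.
Proof.
move=> [i1 h1] [i2 h2] e0; have [p p0 hp] := h1 e e0; have [q q0 hq] := h2 e e0.
exists (padd p q); first exact: padd_neq0.
move=> x; split; first exact: isexp_avg.
by rewrite -avg_avg -[m' x](@avg_id p m' x)//; exact: avg_dist.
Qed.

End averages.

Section expectation.
Variables (R : realType) (H G : zmodType) (phi : H -> G).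
Hypothesis phiD : {morph phi : a b / a + b >-> a + b}.
Local Notation C := (CC R).
Local Notation isexp := (isexp phi).
Local Notation av := (avg phi).
Implicit Types (f g m : G -> C) (x y : G) (e : R) (p q : seq H).

Lemma avg_near q f x (c : C) e : q != [::] ->
  (forall h, nrm (f (x + phi h) - c) <= e) -> nrm (av q f x - c) <= e.
Proof.
move=> q0 hf; rewrite -[c](@avg_id R H G phi q (fun=> c) x)//.
have -> g : av q g x = avg id q (fun h => g (x + phi h)) 0.
  by rewrite /avg; congr (_ * _); apply: eq_bigr => i _; rewrite add0r.
rewrite (_ : av q (fun=> c) x = avg id q (fun=> c) 0)//.
exact: avg_dist.
Qed.

Lemma isexp_dist f g m m' e : isexp f m -> isexp g m' ->
  (forall x, nrm (f x - g x) <= e) -> forall x, nrm (m x - m' x) <= e.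
Proof.
move=> fm gm fg x; apply/ler_addgt0Pr => d d0.
have [|p p0 hp] := isexp_common phiD (e := d / 2) fm gm; first by lra.
have [h1 h2] := hp x; have h3 := avg_dist phi x p0 fg; rewrite nrmC in h1.
have := nrm_tri (m x) (av p f x) (m' x).
have := nrm_tri (av p f x) (av p g x) (m' x); lra.
Qed.

Lemma isexp_uniq f m m' : isexp f m -> isexp f m' -> m = m'.
Proof.
move=> h1 h2; apply/funext => x; apply/nrm_eq => e e0.
by apply: (isexp_dist h1 h2) => y; rewrite subrr nrm0 ltW.
Qed.

(** The averages that are nearly invariant form a Cauchy sequence: two of them
    commute, and averaging a nearly constant function hardly changes it. *)
Lemma isexp_exists f : ap f -> exists m, isexp f m.
Proof.
move=> af.
pose u (n : nat) : R := n.+1%:R^-1.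
have u0 n : 0 < u n by rewrite invr_gt0 ltr0n.
have inv_small e : 0 < e -> exists N : nat, forall n, (N <= n)%N -> u n <= e.
  move=> e0; exists (Num.truncn e^-1) => n Nn.
  rewrite -[e]invrK lef_pV2 ?posrE ?invr_gt0 ?ltr0n//.
  by apply: ltW; apply: lt_le_trans (truncnS_gt _) _; rewrite ler_nat ltnS.
clearbody u.
have step (n : nat) : {p | p != [::] &
    forall x h, nrm (av p f (x + phi h) - av p f x) <= u n}.
  by apply: cid2; exact: avg_flat.
pose p n := s2val (step n).
have p0 n : p n != [::] := s2valP (step n).
have pf n x h : nrm (av (p n) f (x + phi h) - av (p n) f x) <= u n
  := s2valP' (step n) x h.
(* both averages are compared with their composition *)
have cau n k x : nrm (av (p n) f x - av (p k) f x) <= u n + (u k).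
  have h1 := @avg_near (p n) (av (p k) f) x (av (p k) f x) (u k) (p0 n) (pf k x).
  have h2 := @avg_near (p k) (av (p n) f) x (av (p n) f x) (u n) (p0 k) (pf n x).
  rewrite avg_avgC nrmC in h2.
  exact: le_trans (nrm_tri _ (av (p n) (av (p k) f) x) _) (lerD h2 h1).
have lims x : exists l, forall e, 0 < e -> exists N, forall n, (N <= n)%N ->
    nrm (av (p n) f x - l) <= e.
  apply: complex_seq_complete => e e0; have [|N hN] := inv_small (e / 2); first by lra.
  by exists N => n k Nn Nk; have := cau n k x; have := hN n Nn; have := hN k Nk; lra.
have [m hm] := choice lims.
have near n x : nrm (av (p n) f x - m x) <= u n.
  apply/ler_addgt0Pr => e e0; have [|N hN] := hm x (e / 2); first by lra.
  have [|N' hN'] := inv_small (e / 2); first by lra.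
  have h1 := hN (maxn N N') (leq_maxl _ _); have h2 := hN' (maxn N N') (leq_maxr _ _).
  have h3 := cau n (maxn N N') x.
  by have := nrm_tri (av (p n) f x) (av (p (maxn N N')) f x) (m x); lra.
exists m; split=> [x h|e e0]; last first.
  have [N hN] := inv_small e e0; exists (p N) => // x.
  exact: le_trans (near N x) (hN N (leqnn N)).
apply/nrm_eq => e e0; have [|N hN] := inv_small (e / 3); first by lra.
have hNN := hN N (leqnn N); have h1 := near N x; have h2 := near N (x + phi h).
have h3 := pf N x h.
have h4 := nrm_tri (m (x + phi h)) (av (p N) f (x + phi h)) (m x).
have h5 := nrm_tri (av (p N) f (x + phi h)) (av (p N) f x) (m x).
rewrite nrmC in h2; lra.
Qed.

Definition expect f : G -> C := xget (fun=> 0) [set m | isexp f m].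

Lemma isexp_E f m : isexp f m -> expect f = m.
Proof.
move=> fm; apply: (@isexp_uniq f) => //.
by apply: (@xgetPex _ _ [set m | isexp f m]); exists m.
Qed.

Lemma expectP f : ap f -> isexp f (expect f).
Proof.
move=> /isexp_exists ex; exact: (@xgetPex _ _ [set m | isexp f m]).
Qed.

Lemma isexpD f g m m' : isexp f m -> isexp g m' ->
  isexp (fun x => f x + g x) (fun x => m x + m' x).
Proof.
move=> fm gm; split=> [x h|e e0]; first by rewrite fm.1 gm.1.
have [|p p0 hp] := isexp_common phiD (e := e / 2) fm gm; first by lra.
exists p => // x; have [h1 h2] := hp x; rewrite avgD opprD addrACA.
by apply: le_trans (nrmD _ _) _; lra.
Qed.

Lemma isexpZ (c : G -> C) f m K : (forall x h, c (x + phi h) = c x) ->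
  (forall x, nrm (c x) <= K) -> isexp f m ->
  isexp (fun x => c x * f x) (fun x => c x * m x).
Proof.
move=> ci cK [mi fm]; split=> [x h|e e0]; first by rewrite ci mi.
have K0 : 0 <= K := le_trans (nrm_ge0 _) (cK 0).
have [|p p0 hp] := fm (e / (K + 1)); first by apply: divr_gt0 => //; lra.
exists p => // x; rewrite avgZ// -mulrBr nrmM.
have : nrm (c x) * nrm (av p f x - m x) <= K * (e / (K + 1)).
  by rewrite ler_pM ?nrm_ge0.
have : e / (K + 1) * (K + 1) = e by rewrite divfK//; lra.
have : 0 < e / (K + 1) by apply: divr_gt0 => //; lra.
lra.
Qed.

Lemma isexp_conj f m : isexp f m -> isexp (fun x => cj (f x)) (fun x => cj (m x)).
Proof.
move=> [mi fm]; split=> [x h|e e0]; first by rewrite mi.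
have [p p0 hp] := fm e e0; exists p => // x.
apply: le_trans (hp x); rewrite -[leRHS]nrm_conj cjB /avg cjM cj_sum fmorphV rmorph_nat.
exact: lexx.
Qed.

Lemma isexp_shift f m a : isexp f m ->
  isexp (fun x => f (x + a)) (fun x => m (x + a)).
Proof.
move=> [mi fm]; split=> [x h|e e0]; first by rewrite addrAC mi.
have [p p0 hp] := fm e e0; exists p => // x; apply: le_trans (hp (x + a)).
rewrite /avg; under eq_bigr do rewrite addrAC; exact: lexx.
Qed.

Lemma isexp_ap f m : ap f -> isexp f m -> ap m.
Proof.
move=> af [_ fm]; apply: ap_lim => e e0; have [p p0 hp] := fm e e0.
by exists (av p f); [exact: ap_avg|move=> x; rewrite nrmC; exact: hp].
Qed.

Lemma isexp_Re f m (c : R) : isexp f m -> (forall x, c <= complex.Re (f x)) ->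
  forall x, c <= complex.Re (m x).
Proof.
move=> [_ fm] hc x; apply/ler_addgt0Pr => e e0; have [p p0 hp] := fm e e0.
have := le_trans (Re_nrm _) (hp x); rewrite ReD ReN.
suff : c <= complex.Re (av p f x) by move=> h1 /ler_normlP[]; lra.
have s0 : 0 < (size p)%:R :> R by rewrite ltr0n lt0n size_eq0.
have -> : av p f x = rc ((size p)%:R^-1 * \sum_(t <- p) complex.Re (f (x + phi t))) +
  'i%C * rc ((size p)%:R^-1 * \sum_(t <- p) complex.Im (f (x + phi t))).
  rewrite /avg !rmorphM/= !fmorphV !rmorph_nat mulrCA -mulrDr; congr (_ * _).
  rewrite !rmorph_sum mulr_sumr -big_split /=; apply: eq_bigr => t _.
  by case: (f _) => a b /=; simpc.
rewrite ReD/= !(mul0r,mul1r,mulr0,subr0,addr0,add0r) ?oppr0 ?addr0.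
rewrite ler_pdivlMl// mulr_natl.
have -> : c *+ size p = \sum_(i <- p) c by rewrite big_const_seq count_predT iter_addr_0.
by apply: ler_sum => t _.
Qed.

End expectation.

Section mean.
Variables (R : realType) (G : zmodType).
Local Notation C := (CC R).
Implicit Types (f g : G -> C) (x y : G) (e : R).

Let idD : {morph (id : G -> G) : a b / a + b >-> a + b}. Proof. by []. Qed.

(** With respect to all translations the conditional expectation is constant,
    so its value at any point is the mean. *)
Definition Mean f : C := expect (id : G -> G) f 0.

Lemma MeanP f : ap f -> isexp id f (fun=> Mean f).
Proof.
move=> af; have h := expectP idD af.
suff -> : (fun=> Mean f) = expect id f by [].
by apply/funext => x; rewrite /Mean -[in RHS](add0r x) h.1.
Qed.

Lemma Mean_isexp f (m : C) : isexp id f (fun=> m) -> Mean f = m.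
Proof. by move=> /(isexp_E idD); rewrite /Mean => ->. Qed.

Lemma MeanD f g : ap f -> ap g -> Mean (fun x => f x + g x) = Mean f + Mean g.
Proof. by move=> /MeanP hf /MeanP hg; exact: Mean_isexp (isexpD idD hf hg). Qed.

Lemma MeanZ f (c : C) : ap f -> Mean (fun x => c * f x) = c * Mean f.
Proof.
move=> /MeanP hf; apply: Mean_isexp.
by apply: (@isexpZ R G G id (fun=> c) f (fun=> Mean f) (nrm c)).
Qed.

Lemma MeanN f : ap f -> Mean (fun x => - f x) = - Mean f.
Proof. by move=> af; rewrite -mulN1r -MeanZ//; congr Mean; apply/funext => x; rewrite mulN1r. Qed.

Lemma MeanB f g : ap f -> ap g -> Mean (fun x => f x - g x) = Mean f - Mean g.
Proof. by move=> af ag; rewrite MeanD ?MeanN//; exact: ap_opp. Qed.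

Lemma Mean_conj f : ap f -> Mean (fun x => cj (f x)) = cj (Mean f).
Proof. by move=> /MeanP/isexp_conj; exact: Mean_isexp. Qed.

Lemma Mean_shift f a : ap f -> Mean (fun x => f (x + a)) = Mean f.
Proof. by move=> /MeanP/(isexp_shift a); exact: Mean_isexp. Qed.

Lemma Mean_cst (c : C) : Mean (fun=> c) = c.
Proof.
apply: Mean_isexp; split=> // e e0; exists [:: 0] => // x.
by rewrite (@avg_id _ _ _ _ _ _ _ c)// subrr nrm0 ltW.
Qed.

Lemma Mean_sum (I : Type) (r : seq I) (F : I -> G -> C) : (forall i, ap (F i)) ->
  Mean (fun x => \sum_(i <- r) F i x) = \sum_(i <- r) Mean (F i).
Proof.
move=> aF; elim: r => [|i r IH].
  by rewrite big_nil; under eq_fun do rewrite big_nil; exact: Mean_cst.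
rewrite big_cons -IH; under eq_fun do rewrite big_cons.
by rewrite MeanD//; exact: ap_sum.
Qed.

Lemma Mean_dist f g e : ap f -> ap g -> (forall x, nrm (f x - g x) <= e) ->
  nrm (Mean f - Mean g) <= e.
Proof. by move=> /MeanP hf /MeanP hg h; exact: (isexp_dist idD hf hg h 0). Qed.

Lemma Mean_le f e : ap f -> (forall x, nrm (f x) <= e) -> nrm (Mean f) <= e.
Proof.
move=> af h; rewrite -[Mean f]subr0 -[X in _ - X](Mean_cst 0).
by apply: Mean_dist => // [|x]; [exact: ap_cst|rewrite subr0].
Qed.

Lemma Mean_Re f c : ap f -> (forall x, c <= complex.Re (f x)) -> c <= complex.Re (Mean f).
Proof. by move=> /MeanP hf h; exact: (isexp_Re hf h 0). Qed.

Lemma Mean_Re_mono f g : ap f -> ap g ->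
  (forall x, complex.Re (f x) <= complex.Re (g x)) ->
  complex.Re (Mean f) <= complex.Re (Mean g).
Proof.
move=> af ag h; rewrite -subr_ge0 -ReN -ReD -MeanB//.
by apply: Mean_Re => [|x]; [exact: ap_sub|rewrite ReD ReN subr_ge0].
Qed.

Lemma Mean_nrm f : ap f -> nrm (Mean f) <= complex.Re (Mean (fun x => rc (nrm (f x)) : C)).
Proof.
move=> af; have an := ap_nrm af.
have [->|m0] := eqVneq (Mean f) 0.
  by rewrite nrm0; apply: Mean_Re => // x; exact: nrm_ge0.
pose c := cj (Mean f) / rc (nrm (Mean f)) : C.
have n0 : rc (nrm (Mean f)) != 0 :> C.
  by rewrite -[0]/(rc 0 : C) (inj_eq (@complexI _)) nrm_eq0.
have nc : nrm c = 1 by rewrite nrmM nrmV nrm_conj nrm_real (ger0_norm (nrm_ge0 _)) divff// nrm_eq0.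
have -> : nrm (Mean f) = complex.Re (Mean (fun x => c * f x)).
  rewrite MeanZ// /c mulrAC [_ * Mean f]mulrC mulcJ rmorphXn expr2 mulfK//=.
apply: Mean_Re_mono => // [|x]; first by apply: ap_mul => //; exact: ap_cst.
by apply: le_trans (Re_lenrm _) _; rewrite nrmM nc mul1r.
Qed.

Lemma Mean_avg (H : zmodType) (phi : H -> G) p f : p != [::] -> ap f ->
  Mean (avg phi p f) = Mean f.
Proof.
move=> p0 af; rewrite /avg MeanZ; last by apply: ap_sum => i; exact: ap_shift.
rewrite Mean_sum; last by move=> i; exact: ap_shift.
under eq_bigr do rewrite Mean_shift//.
rewrite big_const_seq count_predT iter_addr_0 -[Mean f *+ _]mulr_natl mulKf//.
exact: size_neq0.
Qed.

(** The tower property: averages of translates do not change the mean, nor does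
    their uniform limit. *)
Lemma Mean_expect (H : zmodType) (phi : H -> G) f :
  {morph phi : a b / a + b >-> a + b} -> ap f -> Mean (expect phi f) = Mean f.
Proof.
move=> phiD af; have h := expectP phiD af; apply/nrm_eq => e e0.
have [p p0 hp] := h.2 e e0; rewrite nrmC -(Mean_avg phi p0 af).
by apply: Mean_dist => //; [exact: ap_avg|exact: isexp_ap h].
Qed.

(** Finitely many translates of the set where [f] is large cover the group. *)
Lemma Mean_gt0 f x0 : ap f -> (forall x, 0 <= complex.Re (f x)) ->
  0 < complex.Re (f x0) -> 0 < complex.Re (Mean f).
Proof.
move=> af f0 fx; set c := complex.Re (f x0) in fx.
have [|s hs] := af (c / 2); first by lra.
have s0 : s != [::] by have [t'] := hs 0; case: s {hs}.
have p0 : [seq x0 - t | t <- s] != [::] by rewrite -size_eq0 size_map size_eq0.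
have n0 : 0 < (size s)%:R :> R by rewrite ltr0n lt0n size_eq0.
rewrite -(Mean_avg id p0 af); apply: (@lt_le_trans _ _ ((size s)%:R^-1 * (c / 2))).
  by rewrite mulr_gt0 ?invr_gt0//; lra.
apply: Mean_Re; first exact: ap_avg.
move=> x; rewrite /avg size_map big_map.
have -> (z : C) : complex.Re ((size s)%:R^-1 * z) = (size s)%:R^-1 * complex.Re z.
  rewrite -(rmorph_nat (real_complex R)) -fmorphV; case: z => a b /=.
  by rewrite mul0r subr0.
rewrite ler_pM2l ?invr_gt0// Re_sum.
have [t' t's] := hs x; move=> /(_ (x0 - t')); rewrite subrK => h.
rewrite (big_rem t')//= -[leLHS]addr0 lerD//; last by apply: sumr_ge0.
have := le_trans (Re_nrm _) h; rewrite ReD ReN [x0 - t' + x]addrC.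
by rewrite -/c => /ler_normlP[]; lra.
Qed.

End mean.

Section lines.
Variables (R : realType) (H G : zmodType) (phi : H -> G).
Hypothesis phiD : {morph phi : a b / a + b >-> a + b}.
Local Notation C := (CC R).
Implicit Types (f : G -> C).

Lemma ap_line f x : ap f -> ap (fun h => f (x + phi h)).
Proof.
move=> af e e0; have [s hs] := ap_along phi af e0; exists s => t.
have [t' t's ht] := hs t; exists t' => // h.
by rewrite !phiD !addrA.
Qed.

(** Averages that converge uniformly on the group converge uniformly on each
    coset, so the conditional expectation is the mean along the coset. *)
Lemma expect_pt f x : ap f -> expect phi f x = Mean (fun h => f (x + phi h)).
Proof.
move=> af; have [mi hm] := expectP phiD af; apply/esym/Mean_isexp; split=> // e e0.
have [p p0 hp] := hm e e0; exists p => // h; rewrite -(mi x h).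
apply: le_trans (hp (x + phi h)); rewrite /avg.
under eq_bigr do rewrite phiD addrA; exact: lexx.
Qed.

Lemma ap_expect f : ap f -> ap (expect phi f).
Proof. by move=> af; exact: isexp_ap af (expectP phiD af). Qed.

End lines.

(** * Characters, orthogonality, Bessel's inequality *)

Section orthogonality.
Variables (R : realType) (G : zmodType).
Local Notation C := (CC R).
Implicit Types (f g : G -> C) (x y t : G) (e : R).

Lemma phaseP (z : C) : exists2 w : C, nrm w <= 1 & w * z = rc (nrm z).
Proof.
have [->|z0] := eqVneq z 0; first by exists 0; rewrite ?mulr0 ?nrm0.
have n0 : nrm z != 0 by rewrite nrm_eq0.
have rn0 : rc (nrm z) != 0 :> C by rewrite -[0]/(rc 0 : C) (inj_eq (@complexI _)).
exists (cj z / rc (nrm z)).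
  by rewrite nrmM nrmV nrm_conj nrm_real (ger0_norm (nrm_ge0 _)) divff.
by rewrite mulrAC [_ * z]mulrC mulcJ rmorphXn expr2 mulfK.
Qed.

(** A function is almost periodic as soon as its translates fall, up to any
    precision, into finitely many classes. *)
Lemma ap_classes f : (forall e, 0 < e -> exists (T : finType) (k : G -> T),
    forall t t', k t = k t' -> forall x, nrm (f (x + t) - f (x + t')) <= e) ->
  ap f.
Proof.
move=> h e e0; have [T [k hk]] := h e e0.
exists [seq xget 0 [set t | k t = i] | i <- enum T] => t.
exists (xget 0 [set t' | k t' = k t]).
  by apply: (map_f (fun i => xget 0 [set t | k t = i])); rewrite mem_enum.
apply: hk; apply/esym; apply: (@xgetPex _ 0 [set t' | k t' = k t]); by exists t.
Qed.

Definition fracp (u : R) : R := u - (Num.floor u)%:~R.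

Lemma fracp_itv u : 0 <= fracp u < 1.
Proof.
have /andP[] := floor_itv u; rewrite intrD /fracp => h1 h2.
apply/andP; split; lra.
Qed.

(** The number of the interval of length [1 / (n + 1)] that contains [u] modulo [1]. *)
Definition fraccell (n : nat) (u : R) : 'I_n.+1 :=
  inord (Num.truncn (n.+1%:R * fracp u)).

Lemma fraccell_close n u v : fraccell n u = fraccell n v ->
  `|fracp u - fracp v| <= n.+1%:R^-1.
Proof.
have n0 : 0 < n.+1%:R :> R by rewrite ltr0n.
have hb w : (Num.truncn (n.+1%:R * fracp w) < n.+1)%N.
  have /andP[w0 w1] := fracp_itv w.
  by rewrite truncn_lt_nat ?mulr_ge0 ?(ltW n0)// gtr_pMr.
move=> /(congr1 val); rewrite /fraccell /= !inordK// => E.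
have tr w : (Num.truncn (n.+1%:R * fracp w))%:R <= n.+1%:R * fracp w <
   (Num.truncn (n.+1%:R * fracp w))%:R + 1.
  have /andP[w0 _] := fracp_itv w.
  by rewrite natr1 truncn_itv// mulr_ge0 ?(ltW n0).
have := tr u; have := tr v; rewrite E => /andP[h1 h2] /andP[h3 h4].
rewrite ler_norml; apply/andP; split; rewrite -(ler_pM2l n0) ?mulrN divff ?gt_eqF// mulrBr; lra.
Qed.

Lemma inv_le_small e : 0 < e -> exists n : nat, n.+1%:R^-1 <= e.
Proof.
move=> e0; exists (Num.truncn e^-1).
rewrite -[leRHS]invrK lef_pV2 ?posrE ?invr_gt0 ?ltr0n//.
exact/ltW/truncnS_gt.
Qed.

Lemma ee_fracp u : ee (fracp u) = ee u.
Proof. by rewrite /fracp eeD -mulrNz ee_int mulr1. Qed.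

Lemma ap_ee (L : G -> R) : {morph L : a b / a + b >-> a + b} -> ap (fun x => ee (L x)).
Proof.
move=> LD; apply: ap_classes => e e0; have p0 := pi_gt0 R.
have [|n hn] := @inv_le_small (e / (2 * pi)); first by rewrite divr_gt0// mulr_gt0.
exists 'I_n.+1, (fun t => fraccell n (L t)) => t t' /fraccell_close h x.
rewrite !LD !eeD -mulrBr nrmM nrm_ee mul1r -(ee_fracp (L t)) -(ee_fracp (L t')).
apply: le_trans (ee_dist _ _) _.
rewrite mulrC -ler_pdivlMr ?mulr_gt0//; exact: le_trans h hn.
Qed.

(** This gives the orthogonality of distinct characters. *)
Lemma Mean_eigen f t (c : C) : ap f -> (forall x, f (x + t) = c * f x) -> c != 1 ->
  Mean f = 0.
Proof.
move=> af h c1; have := Mean_shift t af; rewrite (_ : (fun x => _) = (fun x => c * f x)); last exact/funext.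
rewrite MeanZ// => /eqP; rewrite -subr_eq0 -{2}[Mean f]mul1r -mulrBl mulf_eq0.
by rewrite subr_eq0 (negbTE c1) /= => /eqP.
Qed.

Variables (T : eqType) (X : T -> G -> C).
Hypothesis apX : forall i, ap (X i).

Section orthonormal.
Variables (s : seq T).
Hypothesis us : uniq s.
Hypothesis orthX : forall i j, i \in s -> j \in s ->
  Mean (fun x => X i x * cj (X j x)) = (i == j)%:R.

Lemma Mean_norm2 (a : T -> C) :
  Mean (fun x => (\sum_(i <- s) a i * X i x) * cj (\sum_(i <- s) a i * X i x)) =
  \sum_(i <- s) rc (nrm (a i) ^+ 2).
Proof.
have -> : (fun x => (\sum_(i <- s) a i * X i x) * cj (\sum_(i <- s) a i * X i x)) =
  (fun x => \sum_(i <- s) \sum_(j <- s) (a i * cj (a j)) * (X i x * cj (X j x))).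
  apply/funext => x; rewrite cj_sum big_distrlr /=; apply: eq_bigr => i _.
  by apply: eq_bigr => j _; rewrite cjM mulrACA.
have aXX i j : ap (fun x => X i x * cj (X j x)) by apply: ap_mul => //; exact: ap_conj.
have aaXX i j : ap (fun x => a i * cj (a j) * (X i x * cj (X j x))).
  by apply: ap_mul => //; exact: ap_cst.
rewrite Mean_sum => [|i]; last exact: ap_sum.
apply: eq_big_seq => i si; rewrite Mean_sum// (bigD1_seq i)//=.
rewrite big_seq_cond big1 => [|j /andP[sj ji]]; last first.
  by rewrite MeanZ// orthX// eq_sym (negbTE ji) mulr0.
by rewrite MeanZ// orthX// eqxx mulr1 addr0 mulcJ.
Qed.

Lemma Mean_bessel f M : ap f -> (forall x, nrm (f x) <= M) ->
  \sum_(i <- s) nrm (Mean (fun x => f x * cj (X i x))) ^+ 2 <= M ^+ 2.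
Proof.
move=> af fM; pose c i := Mean (fun x => f x * cj (X i x)).
pose P x := \sum_(i <- s) c i * X i x.
have aP : ap P by apply: ap_sum => i; apply: ap_mul => //; exact: ap_cst.
have afX i : ap (fun x => f x * cj (X i x)) by apply: ap_mul => //; exact: ap_conj.
have aFP : ap (fun x => f x * cj (P x)) by apply: ap_mul => //; exact: ap_conj.
have aPF : ap (fun x => P x * cj (f x)) by apply: ap_mul => //; exact: ap_conj.
have aPP : ap (fun x => P x * cj (P x)) by apply: ap_mul => //; exact: ap_conj.
have aFF : ap (fun x => f x * cj (f x)) by apply: ap_mul => //; exact: ap_conj.
have h : 0 <= complex.Re (Mean (fun x => (f x - P x) * cj (f x - P x))).
  apply: Mean_Re => [|x]; last by rewrite mulcJ /= sqr_ge0.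
  by apply: ap_mul; [|apply: ap_conj]; exact: ap_sub.
have E1 : Mean (fun x => f x * cj (P x)) = \sum_(i <- s) rc (nrm (c i) ^+ 2).
  rewrite (_ : (fun x => _) = (fun x => \sum_(i <- s) cj (c i) * (f x * cj (X i x)))).
    rewrite Mean_sum => [|i]; last by apply: ap_mul => //; exact: ap_cst.
    by apply: eq_bigr => i _; rewrite MeanZ// mulrC mulcJ.
  apply/funext => x; rewrite /P cj_sum mulr_sumr; apply: eq_bigr => i _.
  by rewrite cjM mulrCA.
have E2 : Mean (fun x => P x * cj (f x)) = \sum_(i <- s) rc (nrm (c i) ^+ 2).
  rewrite (_ : (fun x => _) = (fun x => cj (f x * cj (P x)))).
    rewrite Mean_conj// E1 cj_sum; apply: eq_bigr => i _.
    by rewrite /= oppr0.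
  by apply/funext => x; rewrite cjM cjK mulrC.
have E3 : Mean (fun x => P x * cj (P x)) = \sum_(i <- s) rc (nrm (c i) ^+ 2).
  exact: Mean_norm2.
have E4 : Mean (fun x => (f x - P x) * cj (f x - P x)) =
    Mean (fun x => f x * cj (f x)) - \sum_(i <- s) rc (nrm (c i) ^+ 2).
  rewrite (_ : (fun x => _) = (fun x => (f x * cj (f x) - f x * cj (P x)) -
     (P x * cj (f x) - P x * cj (P x)))).
    by rewrite !MeanB ?E1 ?E2 ?E3 ?subrr ?subr0//; exact: ap_sub.
  by apply/funext => x; rewrite cjB; ring.
move: h; rewrite E4 ReD ReN Re_sum /= subr_ge0 => /le_trans; apply.
apply: le_trans (Re_lenrm _) _; apply: Mean_le => // x.
by rewrite nrmM nrm_conj expr2 ler_pM ?nrm_ge0.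
Qed.

End orthonormal.
End orthogonality.

(** * Uniqueness of Fourier-Bohr coefficients *)

Section integers.
Variable R : realType.
Local Notation C := (CC R).
Implicit Types (f g : int -> C) (e th M : R) (p : seq int) (N : nat).

Definition ch th (n : int) : C := ee (th * n%:~R).

Lemma chD th m n : ch th (m + n) = ch th m * ch th n.
Proof. by rewrite /ch intrD mulrDr eeD. Qed.

Lemma ap_ch th : ap (ch th).
Proof. by apply: ap_ee => a b; rewrite intrD mulrDr. Qed.

Lemma nrm_ch th n : nrm (ch th n) = 1. Proof. exact: nrm_ee. Qed.

Lemma box_shift f M (t : int) N a : (forall n, nrm (f n) <= M) ->
  nrm (\sum_(j < N) f (a + j%:Z + t) - \sum_(j < N) f (a + j%:Z)) <= 2 * M * `|t|%N%:R.
Proof.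
move=> fM.
have nat_case (n : nat) b : nrm (\sum_(j < N) f (b + j%:Z + n%:Z) - \sum_(j < N) f (b + j%:Z))
    <= 2 * M * n%:R.
  elim: n => [|n IH].
    rewrite mulr0; under eq_bigr do rewrite addr0; by rewrite subrr nrm0.
  apply: le_trans (nrm_tri _ (\sum_(j < N) f (b + j%:Z + n%:Z)) _) _.
  rewrite -[n.+1%:R]natr1 mulrDr mulr1 addrC lerD// -sumrB.
  have -> : \sum_(j < N) (f (b + j%:Z + n.+1%:Z) - f (b + j%:Z + n%:Z)) =
     \sum_(0 <= j < N) (f (b + n%:Z + j.+1%:Z) - f (b + n%:Z + j%:Z)).
    rewrite big_mkord; apply: eq_bigr => j _; congr (f _ - f _); last by rewrite addrAC.
    by rewrite !intS; ring.
  rewrite (@telescope_sumr _ 0 N (fun j => f (b + n%:Z + j%:Z)))//.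
  by apply: le_trans (nrmB _ _) _; have := fM (b + n%:Z + N%:Z); have := fM (b + n%:Z + 0%:Z); lra.
case: t => n; first exact: nat_case.
rewrite NegzE abszN absz_nat nrmC.
have := nat_case n.+1 (a - n.+1%:Z); congr (nrm (_ - _) <= _).
  by apply: eq_bigr => j _; congr f; ring.
by apply: eq_bigr => j _; congr f; ring.
Qed.

(** Sums over long intervals inherit the uniform smallness of averages of
    translates; the loss only depends on the translations. *)
Lemma box_avg p : p != [::] -> exists2 K : R, 0 <= K & forall f M e (m : C),
  0 <= M -> (forall n, nrm (f n) <= M) ->
  (forall n, nrm (avg id p f n - m) <= e) ->
  forall N a, nrm (\sum_(j < N) f (a + j%:Z) - N%:R * m) <= N%:R * e + K * M.
Proof.
move=> p0; exists (2 * \sum_(t <- p) `|t|%N%:R).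
  by rewrite mulr_ge0// sumr_ge0.
move=> f M e m M0 fM hp N a.
have h1 : nrm (\sum_(j < N) avg id p f (a + j%:Z) - N%:R * m) <= N%:R * e.
  have -> : N%:R * m = \sum_(j < N) m by rewrite sumr_const card_ord -[RHS]mulr_natl.
  have -> : N%:R * e = \sum_(j < N) e by rewrite sumr_const card_ord -[RHS]mulr_natl.
  by rewrite -sumrB; apply: le_trans (nrm_sum _ _ _) _; apply: ler_sum.
suff h2 : nrm (\sum_(j < N) f (a + j%:Z) - \sum_(j < N) avg id p f (a + j%:Z)) <=
    2 * (\sum_(t <- p) `|t|%N%:R) * M.
  by apply: le_trans (nrm_tri _ _ _) _; rewrite [leRHS]addrC; exact: lerD h2 h1.
have n1 : 1 <= (size p)%:R :> R by rewrite ler1n lt0n size_eq0.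
have n0 : 0 < (size p)%:R :> R by lra.
have -> : \sum_(j < N) avg id p f (a + j%:Z) =
   (size p)%:R^-1 * \sum_(t <- p) \sum_(j < N) f (a + j%:Z + t).
  by rewrite /avg -mulr_sumr exchange_big.
have -> : \sum_(j < N) f (a + j%:Z) = (size p)%:R^-1 * \sum_(t <- p) \sum_(j < N) f (a + j%:Z).
  rewrite big_const_seq count_predT iter_addr_0 -[X in _ = _ * X]mulr_natl mulKf//.
  exact: size_neq0.
rewrite -mulrBr nrmM nrmV nrm_nat nrmC -sumrB ler_pdivrMl//.
apply: le_trans (nrm_sum _ _ _) _.
apply: (@le_trans _ _ (\sum_(t <- p) 2 * M * `|t|%N%:R)).
  by apply: ler_sum => t _; exact: box_shift.
rewrite -mulr_sumr -mulrA (mulrC M) mulrA ler_peMl//.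
by rewrite !mulr_ge0// sumr_ge0.
Qed.

(** The average of [f * conj(chi)] without its unimodular factor, which makes its
    dependence on the frequency equicontinuous in [x]. *)
Definition tavg p f th (x : int) : C :=
  (size p)%:R^-1 * \sum_(t <- p) f (x + t) * ch (- th) t.

Lemma tavgE p f th x : nrm (avg id p (fun n => f n * ch (- th) n) x) = nrm (tavg p f th x).
Proof.
have -> : avg id p (fun n => f n * ch (- th) n) x = ch (- th) x * tavg p f th x.
  rewrite /avg /tavg [RHS]mulrCA; congr (_ * _); rewrite mulr_sumr.
  by apply: eq_bigr => t _; rewrite chD mulrCA.
by rewrite nrmM nrm_ch mul1r.
Qed.

Lemma tavg_dist p f M th th' x : p != [::] -> 0 <= M -> (forall n, nrm (f n) <= M) ->
  nrm (tavg p f th' x) <= nrm (tavg p f th x) +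
     M * (2 * pi * `|th' - th| * \sum_(t <- p) `|t|%N%:R).
Proof.
move=> p0 M0 fM.
have n1 : 1 <= (size p)%:R :> R by rewrite ler1n lt0n size_eq0.
have p00 := pi_gt0 R.
rewrite addrC -lerBlDr; have := nrm_dist (tavg p f th' x) (tavg p f th x).
move=> /ler_normlP[_ h]; apply: le_trans h _.
rewrite /tavg -mulrBr -sumrB nrmM nrmV nrm_nat ler_pdivrMl; last by lra.
apply: le_trans (nrm_sum _ _ _) _.
apply: (@le_trans _ _ (\sum_(t <- p) M * (2 * pi * `|th' - th| * `|t|%N%:R))).
  apply: ler_sum => t _; rewrite -mulrBr nrmM ler_pM ?nrm_ge0//.
  apply: le_trans (ee_dist _ _) _; rewrite -mulrBl normrM -[2 * pi * _ * _]mulrA.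
  rewrite ler_pM2l ?mulr_gt0//.
  have -> : `|t%:~R : R| = `|t|%N%:R by rewrite -[in LHS]intr_norm -abszE.
  by rewrite opprK [- th' + th]addrC distrC lexx.
rewrite -!mulr_sumr ler_peMl// !mulr_ge0//; last exact: sumr_ge0.
exact: ltW.
Qed.

(** If all Fourier-Bohr coefficients vanish, one averaging set makes all twisted
    averages small: by compactness of the circle of frequencies. *)
Lemma uniform_small f e : ap f -> (forall th, Mean (fun n => f n * ch (- th) n) = 0) ->
  0 < e -> exists2 p, p != [::] & forall th x,
    nrm (avg id p (fun n => f n * ch (- th) n) x) <= e.
Proof.
move=> af f0 e0; have [M M0 fM] := ap_bounded af.
have afc th : ap (fun n => f n * ch (- th) n) by apply: ap_mul => //; exact: ap_ch.
pose Q p th := forall x, nrm (avg id p (fun n => f n * ch (- th) n) x) <= e.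
have loc th : exists pd : seq int * R, [/\ pd.1 != [::], 0 < pd.2 &
    forall th', `|th' - th| < pd.2 -> Q pd.1 th'].
  have [|p p0 hp] := (MeanP (afc th)).2 (e / 2); first by lra.
  pose K := M * (2 * pi * \sum_(t <- p) `|t|%N%:R) : R.
  have K0 : 0 <= K by rewrite !mulr_ge0// ?pi_ge0// sumr_ge0.
  exists (p, (e / 2) / (K + 1)); split=> //=; first by apply: divr_gt0; lra.
  move=> th' hth x; rewrite tavgE; apply: le_trans (tavg_dist th _ _ p0 M0 fM) _.
  have := hp x; rewrite f0 subr0 tavgE => h1.
  have -> : M * (2 * pi * `|th' - th| * \sum_(t <- p) `|t|%N%:R) = K * `|th' - th|.
    by rewrite /K; ring.
  have : K * `|th' - th| <= K * (e / 2 / (K + 1)) by rewrite ler_wpM2l// ltW.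
  have : (e / 2 / (K + 1)) * (K + 1) = e / 2 by rewrite divfK//; lra.
  have : 0 < e / 2 / (K + 1) by apply: divr_gt0; lra.
  lra.
have [pd hpd] := choice loc.
have : cover_compact `[0 : R, 1]%classic.
  by rewrite -compact_cover; exact: segment_compact.
move=> /(_ R setT (fun th => ball th (pd th).2)) [|th _|D _ cov].
- by move=> th _; have [_ h _] := hpd th; exact: ball_open.
- by exists th => //; have [_ h _] := hpd th; exact: ballxx.
pose P := foldr (fun th q => padd (pd th).1 q) [:: (0 : int)] (finmap.enum_fset D).
have P0 : P != [::].
  by rewrite /P; elim: (finmap.enum_fset D) => // th r IH; apply: padd_neq0 => //; have [] := hpd th.
have QP th p q : q != [::] -> Q p th -> Q (padd p q) th /\ Q (padd q p) th.
  move=> q0 hQ; have idD : {morph (id : int -> int) : a b / a + b >-> a + b} by [].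
  suff hh x : nrm (avg id q (avg id p (fun n => f n * ch (- th) n)) x) <= e.
    by split=> x; rewrite -(avg_avg idD)// avg_avgC.
  rewrite -[avg id q _ _]subr0; apply: avg_near => // h; rewrite subr0; exact: hQ.
have QP01 th : 0 <= th <= 1 -> Q P th.
  move=> th01; have [|th1 th1D hth] := cov th; first by rewrite /= in_itv.
  have [q0 _ /(_ th) hq] := hpd th1.
  have {}hq : Q (pd th1).1 th by apply: hq; move: hth; rewrite /ball /= distrC.
  have : th1 \in finmap.enum_fset D by exact: th1D.
  rewrite /P; elim: (finmap.enum_fset D) => [|a r IH]; first by rewrite in_nil.
  rewrite inE => /orP[/eqP<-|h] /=.
    suff r0 : foldr (fun th q => padd (pd th).1 q) [:: 0] r != [::] by have [] := QP _ _ _ r0 hq.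
    by elim: r {IH} => // b r IH; apply: padd_neq0 => //; have [] := hpd b.
  by have [] := QP _ _ (pd a).1 (let: And3 h _ _ := hpd a in h) (IH h).
exists P => // th x.
suff -> : (fun n => f n * ch (- th) n) = (fun n => f n * ch (- fracp th) n).
  by apply: QP01; have /andP[h1 h2] := fracp_itv th; rewrite h1 ltW.
apply/funext => n; congr (_ * _); rewrite /ch /fracp opprB mulrBl eeD mulNr.
by rewrite -intrM ee_int mul1r.
Qed.

Lemma Mean_ee_lin (a : R) : Mean (fun th : R => ee (a * th)) = (a == 0)%:R :> C.
Proof.
have [->|a0] := eqVneq a 0.
  by under eq_fun do rewrite mul0r ee0; exact: Mean_cst.
apply: (@Mean_eigen _ _ _ (1 / 2 / a) (-1)).
- by apply: ap_ee => x y; rewrite mulrDr.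
- by move=> x; rewrite mulrDr eeD mulrC (mulrC a) divfK// ee_half.
- by rewrite eq_sym -subr_eq0 opprK -mulr2n pnatr_eq0.
Qed.

Lemma ap_eelin (a : R) : ap (fun th : R => ee (a * th)).
Proof. by apply: ap_ee => x y; rewrite mulrDr. Qed.

(** A bilinear form with Hankel kernel [u (t + x)] is controlled by the sup norm
    of the trigonometric polynomial with coefficients [u], by Parseval. *)
Lemma hankel_bound (u w S : nat -> C) N (B : R) :
  (forall th, nrm (\sum_(n < N + N) u n * ee (- n%:R * th)) <= B) ->
  (forall t, nrm (w t) <= 1) -> (forall x, nrm (S x) <= 1) ->
  nrm (\sum_(t < N) \sum_(x < N) w t * S x * u (t + x)%N) <= B * N%:R.
Proof.
move=> uB w1 S1.
have B0 : 0 <= B := le_trans (nrm_ge0 _) (uB 0).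
pose U th := \sum_(n < N + N) u n * ee (- n%:R * th).
pose tr (v : nat -> C) th := \sum_(t <- index_iota 0 N) v t * ee (t%:R * th).
have aU : ap U by apply: ap_sum => i; apply: ap_mul; [exact: ap_cst|exact: ap_eelin].
have atr v : ap (tr v) by apply: ap_sum => i; apply: ap_mul; [exact: ap_cst|exact: ap_eelin].
have trN v : (forall t, nrm (v t) <= 1) ->
    complex.Re (Mean (fun th => tr v th * cj (tr v th))) <= N%:R.
  move=> v1; rewrite (@Mean_norm2 R R nat (fun t th => ee (t%:R * th)) _ (index_iota 0 N)).
  - rewrite Re_sum; apply: (@le_trans _ _ (\sum_(i <- index_iota 0 N) 1)).
      apply: ler_sum => i _ /=; rewrite exprn_ile1 ?nrm_ge0//.
    by rewrite big_const_seq count_predT iter_addr_0 size_iota subn0.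
  - by move=> i; exact: ap_eelin.
  - exact: iota_uniq.
  - move=> i j _ _; rewrite (_ : (fun x => _) = (fun x => ee ((i%:R - j%:R) * x))).
      by rewrite Mean_ee_lin subr_eq0 eqr_nat.
    by apply/funext => x; rewrite cj_ee -eeD mulrBl.
have E : Mean (fun th => U th * (tr w th * tr S th)) =
   \sum_(t < N) \sum_(x < N) w t * S x * u (t + x)%N.
  rewrite (_ : (fun th => _) = (fun th => \sum_(t < N) \sum_(x < N) \sum_(n < N + N)
     (w t * S x * u n) * ee ((t%:R + x%:R - n%:R) * th))).
    rewrite Mean_sum => [|t]; last first.
      by do 2 (apply: ap_sum => ?); apply: ap_mul; [exact: ap_cst|exact: ap_eelin].
    apply: eq_bigr => t _; rewrite Mean_sum => [|x]; last first.
      by apply: ap_sum => ?; apply: ap_mul; [exact: ap_cst|exact: ap_eelin].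
    apply: eq_bigr => x _; rewrite Mean_sum => [|n]; last first.
      by apply: ap_mul; [exact: ap_cst|exact: ap_eelin].
    have txN : (t + x < N + N)%N by rewrite -addnS leq_add// ltnW.
    rewrite (bigD1 (Ordinal txN))//= big1 ?addr0.
      by rewrite MeanZ ?Mean_ee_lin ?natrD ?subrr ?eqxx ?mulr1//; exact: ap_eelin.
    move=> n nt; rewrite MeanZ ?Mean_ee_lin; last exact: ap_eelin.
    rewrite subr_eq0 -natrD eqr_nat; case: eqP => [h|]; last by rewrite mulr0.
    by case/eqP: nt; apply: val_inj; rewrite /= h.
  apply/funext => th; rewrite /U /tr !big_mkord mulrC big_distrlr /= mulr_suml.
  apply: eq_bigr => t _; rewrite mulr_suml; apply: eq_bigr => x _.
  rewrite mulr_sumr; apply: eq_bigr => n _; rewrite !mulrDl !eeD mulNr; ring.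
rewrite -E; have aP : ap (fun th => tr w th * tr S th) by exact: ap_mul.
have aww : ap (fun th => tr w th * cj (tr w th)) by apply: ap_mul => //; exact: ap_conj.
have aSS : ap (fun th => tr S th * cj (tr S th)) by apply: ap_mul => //; exact: ap_conj.
apply: le_trans (Mean_nrm _) _; first exact: ap_mul.
(* the arithmetic-geometric inequality replaces the product of the two
   polynomials by the mean of their squares *)
pose h : C := rc (B / 2).
apply: (@le_trans _ _ (complex.Re (Mean (fun th => h * (tr w th * cj (tr w th) + tr S th * cj (tr S th)))))).
  apply: Mean_Re_mono.
  - by apply: ap_nrm; exact: ap_mul.
  - by apply: ap_mul; [exact: ap_cst|exact: ap_add].
  - move=> th; rewrite !mulcJ -rmorphD -rmorphM /= !nrmM.
    have n1 := nrm_ge0 (tr w th); have n2 := nrm_ge0 (tr S th).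
    have n3 : nrm (U th) * (nrm (tr w th) * nrm (tr S th)) <= B * (nrm (tr w th) * nrm (tr S th)).
      by rewrite ler_wpM2r ?mulr_ge0//; exact: uB.
    have n4 : 0 <= B / 2 * (nrm (tr w th) - nrm (tr S th)) ^+ 2.
      by rewrite mulr_ge0 ?sqr_ge0// divr_ge0.
    apply: le_trans n3 _; move: n4; rewrite sqrrB -[_ *+ 2]mulr_natl.
    move: (nrm (tr w th)) (nrm (tr S th)) => a b; nra.
rewrite MeanZ; last exact: ap_add.
rewrite MeanD// /h; have := trN w w1; have := trN S S1.
move: (Mean _) (Mean _) => [a a'] [b b'] /=; rewrite mul0r subr0.
have : 0 <= B / 2 by rewrite divr_ge0.
nra.
Qed.

(** A nonzero almost periodic sequence has few translates up to small error, so
    it correlates with the indicator of a class of translations; this is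
    incompatible with uniformly small twisted averages. *)
Theorem int_uniqueness f n0 : ap f -> f n0 != 0 ->
  exists th : R, Mean (fun n => f n * ch (- th) n) != 0.
Proof.
move=> af fn0; apply: contrapT => nex.
have f0 th : Mean (fun n => f n * ch (- th) n) = 0.
  by apply/eqP; apply: contrapT => /negP h; apply: nex; exists th.
have [M M0 fM] := ap_bounded af.
have an := ap_nrm af.
set m := complex.Re (Mean (fun n => rc (nrm (f n)) : C)).
have m0 : 0 < m.
  apply: (Mean_gt0 (x0 := n0)) => //= [x|]; first exact: nrm_ge0.
  by rewrite lt_neqAle nrm_ge0 andbT eq_sym nrm_eq0.
have [|p1 p10 hp1] := (MeanP an).2 (m / 4); first by lra.
have [K1 K10 hK1] := box_avg p10.
(* the mean of [|f|] is felt on every long interval *)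
have low a N : N%:R * (3 * m / 4) - K1 * M <= \sum_(j < N) nrm (f (a + j%:Z)).
  have h : nrm (\sum_(j < N) (rc (nrm (f (a + j%:Z))) : C) -
     N%:R * Mean (fun n => rc (nrm (f n)) : C)) <= N%:R * (m / 4) + K1 * M.
    apply: (hK1 (fun n => rc (nrm (f n)) : C) M (m / 4) _ M0) => // n.
    by rewrite nrm_real ger0_norm ?nrm_ge0.
  have := le_trans (Re_nrm _) h; rewrite ReD ReN Re_sum /=.
  have -> (z : C) : complex.Re (N%:R * z) = N%:R * complex.Re z.
    by rewrite -(rmorph_nat (real_complex R)); case: z => b c /=; rewrite mul0r subr0.
  by rewrite -/m => /ler_normlP[]; lra.
have [|s hs] := af (m / 4); first by lra.
pose r := size s.
have r0 : 0 < r%:R :> R by rewrite ltr0n lt0n size_eq0; have [t'] := hs 0; case: s {r hs}.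
have [|p2 p20 hp2] := uniform_small af f0 (e := m / (16 * r%:R)).
  by rewrite divr_gt0// mulr_gt0.
have [K2 K20 hK2] := box_avg p20.
(* whereas all trigonometric sums with coefficients [f n] are small *)
have up N th : nrm (\sum_(n < N + N) f n%:Z * ee (- n%:R * th)) <=
    N%:R * (m / (8 * r%:R)) + K2 * M.
  have F1 n : nrm (f n * ch (- th) n) <= M by rewrite nrmM nrm_ch mulr1.
  have F2 n : nrm (avg id p2 (fun n => f n * ch (- th) n) n - 0) <= m / (16 * r%:R).
    by rewrite subr0; exact: hp2.
  have := hK2 _ _ _ _ M0 F1 F2 (N + N)%N 0; rewrite mulr0 subr0.
  have -> : (N + N)%:R * (m / (16 * r%:R)) = N%:R * (m / (8 * r%:R)) :> R.
    by rewrite natrD; field; rewrite gt_eqF.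
  congr (nrm _ <= _); apply: eq_bigr => n _; rewrite add0r /ch; congr (_ * ee _).
  by rewrite -pmulrn; ring.
(* each translation [x] is close to one, [k x], in the finite net [s] *)
have hex (x : nat) : exists k : int, k \in s /\
    forall y, nrm (f (y + x%:Z) - f (y + k)) <= m / 4.
  by have [t' t's h] := hs x%:Z; exists t'.
have [k hk] := choice hex.
have main N : N%:R * (N%:R * (m / 2) - K1 * M) <=
    r%:R * ((N%:R * (m / (8 * r%:R)) + K2 * M) * N%:R).
  (* On the class of [i] the sequence [f (t + x)] is nearly independent of
     [x], so that the Hankel form of the indicator of the class is nearly the
     size of the class times the sum of [|f (t + i)|]. *)
  have cls i : i \in s -> (\sum_(x < N | k x == i) 1) * (N%:R * (m / 2) - K1 * M) <=
      (N%:R * (m / (8 * r%:R)) + K2 * M) * N%:R.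
    move=> si; pose S (x : nat) : C := (k x == i)%:R.
    have [w w1 hw] : exists2 w : nat -> C, (forall t, nrm (w t) <= 1) &
        forall t, w t * \sum_(x < N) S x * f (t + x)%N%:Z =
          rc (nrm (\sum_(x < N) S x * f (t + x)%N%:Z)).
      have wex (t : nat) : exists w : C, nrm w <= 1 /\
          w * \sum_(x < N) S x * f (t + x)%N%:Z = rc (nrm (\sum_(x < N) S x * f (t + x)%N%:Z)).
        by have [w ? ?] := phaseP (\sum_(x < N) S x * f (t + x)%N%:Z); exists w.
      have [w hw] := choice wex.
      by exists w => t; have [] := hw t.
    have S1 x : nrm (S x) <= 1 by rewrite /S; case: (k x == i); rewrite ?nrm0 ?nrm1.
    have := @hankel_bound (fun n : nat => f n%:Z) w S N _ (up N) w1 S1.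
    have -> : \sum_(t < N) \sum_(x < N) w t * S x * f (t + x)%N%:Z =
       rc (\sum_(t < N) nrm (\sum_(x < N) S x * f (t + x)%N%:Z)).
      rewrite rmorph_sum; apply: eq_bigr => t _; apply: etrans (hw t); rewrite mulr_sumr.
      by apply: eq_bigr => x _; rewrite mulrA.
    rewrite nrm_real ger0_norm; last by apply: sumr_ge0 => t _; exact: nrm_ge0.
    apply: le_trans; set c := \sum_(x < N | _) 1.
    have c0 : 0 <= c by exact: sumr_ge0.
    have each (t : nat) : c * (nrm (f (t%:Z + i)) - m / 4) <= nrm (\sum_(x < N) S x * f (t + x)%N%:Z).
      have -> : \sum_(x < N) S x * f (t + x)%N%:Z = \sum_(x < N | k x == i) f (t + x)%N%:Z.
        rewrite [RHS]big_mkcond; apply: eq_bigr => x _; rewrite /S.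
        by case: eqP; rewrite ?mul1r ?mul0r.
      have -> : c * (nrm (f (t%:Z + i)) - m / 4) =
         nrm (rc c * f (t%:Z + i)) - \sum_(x < N | k x == i) (m / 4).
        rewrite nrmM nrm_real (ger0_norm c0) mulrBr /c; congr (_ - _).
        by rewrite mulr_suml; under eq_bigr do rewrite mul1r.
      rewrite lerBlDr [leRHS]addrC -lerBlDr.
      apply: le_trans (ler_norm _) _; apply: le_trans (nrm_dist _ _) _.
      rewrite /c rmorph_sum mulr_suml -sumrB; apply: le_trans (nrm_sum _ _ _) _.
      apply: ler_sum => x /eqP <-; rewrite rmorph1 mul1r nrmC PoszD.
      by have [_] := hk x.
    have h2 : \sum_(t < N) c * (nrm (f (t%:Z + i)) - m / 4) <=
        \sum_(t < N) nrm (\sum_(x < N) S x * f (t + x)%N%:Z).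
      by apply: ler_sum => t _; exact: each.
    apply: le_trans h2; rewrite -mulr_sumr ler_wpM2l// sumrB.
    rewrite sumr_const card_ord.
    have := low i N; under eq_bigr do rewrite addrC.
    by rewrite -[_ *+ N]mulr_natl; lra.
  have -> : N%:R * (N%:R * (m / 2) - K1 * M) =
     \sum_(i <- undup s) (\sum_(x < N | k x == i) 1) * (N%:R * (m / 2) - K1 * M).
    rewrite -mulr_suml; congr (_ * _).
    rewrite (exchange_big_dep xpredT)//=.
    under eq_bigr => x _.
      rewrite -big_filter (_ : [seq i <- undup s | k x == i] = [:: k x]).
        by rewrite big_seq1; over.
      have := filter_pred1_uniq (undup_uniq s) (x := k x); rewrite mem_undup => <-.
        by apply: eq_filter => y; rewrite eq_sym.
      by have [] := hk x.
    by rewrite sumr_const card_ord.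
  have -> : r%:R * ((N%:R * (m / (8 * r%:R)) + K2 * M) * N%:R) =
     \sum_(i <- s) ((N%:R * (m / (8 * r%:R)) + K2 * M) * N%:R).
    by rewrite big_const_seq count_predT iter_addr_0 -[RHS]mulr_natl.
  have pos : 0 <= (N%:R * (m / (8 * r%:R)) + K2 * M) * N%:R.
    by rewrite mulr_ge0// addr_ge0// !mulr_ge0// ?invr_ge0 ?mulr_ge0// ltW.
  apply: (@le_trans _ _ (\sum_(i <- undup s) ((N%:R * (m / (8 * r%:R)) + K2 * M) * N%:R))).
    by rewrite big_seq [leRHS]big_seq; apply: ler_sum => i; rewrite mem_undup; exact: cls.
  rewrite !big_const_seq !count_predT !iter_addr_0 ler_wpMn2l//.
  exact: size_undup.
(* divided by [N^2], the bound [main] tends to [m / 2 <= m / 8] *)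
pose A := 8 * ((K1 + r%:R * K2) * M) / (3 * m).
have := main (Num.truncn A).+1; set N := (Num.truncn A).+1.
have AN : A < N%:R by exact: truncnS_gt.
have N0 : 0 < N%:R :> R by rewrite ltr0n.
have -> : r%:R * ((N%:R * (m / (8 * r%:R)) + K2 * M) * N%:R) =
   N%:R * (N%:R * m / 8 + r%:R * K2 * M) by field; rewrite gt_eqF.
rewrite ler_pM2l//; move: AN; rewrite /A ltr_pdivrMr; last by lra.
lra.
Qed.

End integers.

Section real_line.
Variable R : realType.
Local Notation C := (CC R).
Implicit Types (f g m : R -> C) (x : R).

Definition ucR f := forall e : R, 0 < e -> exists2 d : R, 0 < d &
  forall x h, `|h| < d -> nrm (f (x + h) - f x) <= e.

Lemma ReMr (r : R) (z : C) : complex.Re (rc r * z) = r * complex.Re z.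
Proof. by case: z => a b /=; rewrite mul0r subr0. Qed.

Lemma rcos (u : R) : rc (cos (2 * pi * u)) = rc (1 / 2) * (ee u + ee (- u)) :> C.
Proof.
rewrite -cj_ee /ee; apply/eqP; rewrite eq_complex /=.
by apply/andP; split; apply/eqP; field.
Qed.

(** Lebesgue's argument: if all coefficients vanish, [m] is orthogonal to the
    powers of the trigonometric polynomial [1 + cos (2 pi (x - x0)) - g], which
    concentrate at [x0] modulo [1]. *)
Lemma periodic_uniqueness m x0 : ap m -> (forall x, m (x + 1) = m x) -> ucR m ->
  m x0 != 0 -> exists k : int, Mean (fun x => m x * ee (k%:~R * x)) != 0.
Proof.
move=> am mper ucm mx0; apply: contrapT => nex.
have m0 (k : int) : Mean (fun x => m x * ee (k%:~R * x)) = 0.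
  by apply/eqP; apply: contrapT => /negP h; apply: nex; exists k.
have mperz (n : int) x : m (x - n%:~R) = m x.
  have nat_case (j : nat) y : m (y + j%:R) = m y.
    by elim: j y => [|j IH] y; rewrite ?addr0// -natr1 addrA mper.
  case: n => n; first by rewrite -[in RHS](subrK n%:~R x) nat_case.
  by rewrite NegzE mulrNz opprK nat_case.
pose q x := (m x0)^-1 * m x.
have aq : ap q by exact: ap_scale.
have [M M0 qM] := ap_bounded aq.
have n0 : 0 < nrm (m x0) by rewrite lt_neqAle nrm_ge0 andbT eq_sym nrm_eq0.
have [|d d0 hd] := ucm (nrm (m x0) / 2); first by rewrite divr_gt0.
have [g /andP[g0 g1] hg] := ee_cos_close d0.
have qRe x : g < cos (2 * pi * (x - x0)) -> 1 / 2 <= complex.Re (q x).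
  move=> /hg[n hn].
  have h : nrm (q x - 1) <= 1 / 2.
    rewrite /q -[X in _ - X](mulVf mx0) -mulrBr nrmM nrmV mulrC ler_pdivrMr//.
    rewrite -(mperz n) (_ : x - n%:~R = x0 + (x - x0 - n%:~R)); last by ring.
    by apply: le_trans (hd _ _ hn) _; lra.
  by have := le_trans (Re_nrm _) h; rewrite ReD ReN /= => /ler_normlP[]; lra.
pose T x := 1 + cos (2 * pi * (x - x0)) - g.
have TE x : rc (T x) = rc (1 - g) + rc (1 / 2) * ee (- x0) * ee (1%:~R * x)
    + rc (1 / 2) * ee x0 * ee ((-1)%:~R * x) :> C.
  rewrite /T addrAC (rmorphD (real_complex R)) [X in _ + X]rcos mulrDr addrA mulrN1z mulNr !mul1r.
  by rewrite -!mulrA -!eeD (addrC (- x0)) opprB.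
have aee (k : int) : ap (fun x => ee (k%:~R * x)) by exact: ap_eelin.
have aT : ap (fun x => rc (T x) : C).
  rewrite (funext TE).
  by apply: ap_add; [apply: ap_add; [exact: ap_cst|]|]; exact: ap_scale.
have aTn n : ap (fun x => rc (T x) ^+ n : C).
  elim: n => [|n IH]; first exact: ap_cst.
  by rewrite (funext (fun x => exprS _ n)); exact: ap_mul.
have vanish n (k : int) : Mean (fun x => q x * rc (T x) ^+ n * ee (k%:~R * x)) = 0.
  elim: n k => [|n IH] k.
    rewrite (_ : (fun x => _) = (fun x => (m x0)^-1 * (m x * ee (k%:~R * x)))).
      by rewrite MeanZ ?m0 ?mulr0//; exact: ap_mul.
    by apply/funext => x; rewrite expr0 mulr1 /q mulrA.
  have ap3 (j : int) : ap (fun x => q x * rc (T x) ^+ n * ee (j%:~R * x)).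
    by apply: ap_mul => //; exact: ap_mul.
  rewrite (_ : (fun x => _) = (fun x =>
     rc (1 - g) * (q x * rc (T x) ^+ n * ee (k%:~R * x))
     + (rc (1 / 2) * ee (- x0)) * (q x * rc (T x) ^+ n * ee ((1 + k)%:~R * x))
     + (rc (1 / 2) * ee x0) * (q x * rc (T x) ^+ n * ee ((-1 + k)%:~R * x)))).
    rewrite !MeanD ?MeanZ ?IH ?mulr0 ?addr0//; do ?apply: ap_add; exact: ap_scale.
  apply/funext => x; rewrite exprS TE !intrD !mulrDl !eeD !mul1r.
  move: (rc (T x) ^+ n) => t; ring.
pose psi x := Num.max 0 (cos (2 * pi * (x - x0)) - (1 + g) / 2).
have apsi : ap (fun x => rc (psi x) : C).
  have a1 : ap (fun x => rc (cos (2 * pi * (x - x0))) : C).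
    apply: (@ap_lim _ _ (fun x => rc (cos (2 * pi * (x - x0))))) => e e0.
    exists (fun x => rc (T x) - rc (1 - g)); first by apply: ap_sub => //; exact: (@ap_cst _ _ (rc (1 - g))).
    by move=> x; rewrite -!rmorphB nrm_real /T; set c := cos _;
       rewrite (_ : c - _ = 0) ?normr0 ?ltW//; ring.
  apply: (@ap_lip _ _ _ (fun z : C => rc (Num.max 0 (complex.Re z - (1 + g) / 2))) _ a1).
  move=> a b; rewrite -rmorphB nrm_real; apply: le_trans (Re_nrm _); rewrite ReD ReN.
  move: (complex.Re a) (complex.Re b) => u v.
  rewrite /Num.max; case: ltP => h1; case: ltP => h2; rewrite ler_norml;
    have := ler_norm (u - v); have := ler_norm (v - u); rewrite (distrC v u); move=> *;
    apply/andP; split; lra.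
have psi0 : 0 < complex.Re (Mean (fun x => rc (psi x) : C)).
  apply: (Mean_gt0 (x0 := x0)) => //= [x|]; first by rewrite /psi le_max lexx.
  by rewrite /psi lt_max subrr mulr0 cos0; apply/orP; right; lra.
set P := complex.Re _ in psi0.
(* With [c] the cosine, [|T| <= 1] where [c <= g]; where [c > g] the real part
   of [q] is at least [1/2] and [T >= 1]; and [T >= 1 + (1 - g) / 2] where
   [c >= (1 + g) / 2], which is the support of [psi]. *)
have lower n : 1 / 2 * (1 + (1 - g) / 2) ^+ n * P <= M.
  pose h x : C := rc (1 / 2 * (1 + (1 - g) / 2) ^+ n) * rc (psi x) - rc M.
  have ah : ap h by apply: ap_sub; [exact: ap_scale|exact: ap_cst].
  have : complex.Re (Mean h) <= complex.Re (Mean (fun x => q x * rc (T x) ^+ n * ee (0%:~R * x))).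
    apply: Mean_Re_mono => //; first by apply: ap_mul => //; exact: ap_mul.
    move=> x; rewrite /h mul0r ee0 mulr1 -rmorphXn -rmorphM -rmorphB [q x * _]mulrC ReMr /=.
    set c := cos (2 * pi * (x - x0)); have c1 : -1 <= c by exact: cos_geN1.
    have c2 : c <= 1 by exact: cos_le1.
    have Rq := le_trans (Re_nrm (q x)) (qM x); move: Rq => /ler_normlP[Rq1 Rq2].
    have K0 : 0 <= (1 + (1 - g) / 2) ^+ n by apply: exprn_ge0; lra.
    rewrite /psi /T -/c; have [cg|cg] := leP c g.
      rewrite max_l; last by lra.
      rewrite mulr0 sub0r.
      have : `|(1 + c - g) ^+ n| <= 1.
        by rewrite normrX exprn_ile1// ler_norml; apply/andP; split; lra.
      move=> Tn; have : `|(1 + c - g) ^+ n * complex.Re (q x)| <= M.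
        by rewrite normrM -[leRHS]mul1r ler_pM// ler_norml; apply/andP; split; lra.
      by move=> /ler_normlP[]; lra.
    have q2 := qRe x cg.
    have [cg2|cg2] := leP c ((1 + g) / 2).
      rewrite max_l; last by lra.
      rewrite mulr0; apply: (@le_trans _ _ 0); first by lra.
      by rewrite mulr_ge0 ?exprn_ge0//; lra.
    rewrite max_r; last by lra.
    have : (1 + (1 - g) / 2) ^+ n <= (1 + c - g) ^+ n by apply: lerXn2r; rewrite ?nnegrE; lra.
    move: (_ ^+ n) ((1 + c - g) ^+ n) K0 => u v u0 uv.
    have : u * (1 / 2) <= v * complex.Re (q x) by rewrite ler_pM//; lra.
    have : 1 / 2 * u * (c - (1 + g) / 2) <= 1 / 2 * u * 1 by rewrite ler_wpM2l//; lra.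
    lra.
  rewrite vanish /h MeanB; [|exact: ap_scale|exact: ap_cst].
  by rewrite MeanZ// Mean_cst ReD ReN ReMr /= -/P; lra.
pose A := M * 4 / ((1 - g) * P).
have gP : 0 < (1 - g) * P by rewrite mulr_gt0//; lra.
have AN : A < (Num.truncn A).+1%:R by exact: truncnS_gt.
have := lower (Num.truncn A).+1; set N := (Num.truncn A).+1 in AN *.
have bern : 1 + N%:R * ((1 - g) / 2) <= (1 + (1 - g) / 2) ^+ N.
  elim: (N) => [|n IH]; first by rewrite mul0r addr0 expr0.
  rewrite exprS -[n.+1%:R]natr1; set r := (1 - g) / 2 in IH *.
  have r0 : 0 < r by rewrite /r; lra.
  have : (1 + r) * (1 + n%:R * r) <= (1 + r) * (1 + r) ^+ n by rewrite ler_wpM2l//; lra.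
  have : 0 <= n%:R * r * r by rewrite !mulr_ge0//; lra.
  lra.
move: AN; rewrite /A ltr_pdivrMr// => AN h.
have h1 : 1 / 2 * (1 + N%:R * ((1 - g) / 2)) * P <= 1 / 2 * (1 + (1 - g) / 2) ^+ N * P.
  by rewrite ler_wpM2r ?(ltW psi0)// ler_wpM2l//; lra.
clear - h h1 AN psi0; lra.
Qed.

Lemma ucR_mul f g M : (forall x, nrm (f x) <= M) -> (forall x, nrm (g x) <= M) ->
  ucR f -> ucR g -> ucR (fun x => f x * g x).
Proof.
move=> fM gM uf ug e e0.
have M0 : 0 <= M := le_trans (nrm_ge0 _) (fM 0).
have e1 : 0 < e / (2 * (M + 1)) by apply: divr_gt0 => //; lra.
have [d1 d10 h1] := uf _ e1; have [d2 d20 h2] := ug _ e1.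
exists (Num.min d1 d2); first by rewrite lt_min d10.
move=> x h; rewrite lt_min => /andP[/(h1 x) a1 /(h2 x) a2].
have -> : f (x + h) * g (x + h) - f x * g x =
  (f (x + h) - f x) * g (x + h) + f x * (g (x + h) - g x) by ring.
apply: le_trans (nrmD _ _) _; rewrite !nrmM.
have b1 : nrm (f (x + h) - f x) * nrm (g (x + h)) <= e / (2 * (M + 1)) * M.
  by rewrite ler_pM ?nrm_ge0.
have b2 : nrm (f x) * nrm (g (x + h) - g x) <= M * (e / (2 * (M + 1))).
  by rewrite ler_pM ?nrm_ge0.
have : e / (2 * (M + 1)) * (2 * (M + 1)) = e by rewrite divfK//; lra.
lra.
Qed.

Lemma ucR_ee (a : R) : ucR (fun x => ee (a * x)).
Proof.
move=> e e0; have p0 := pi_gt0 R; have K0 : 0 < 2 * pi * (`|a| + 1).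
  by rewrite mulr_gt0 ?mulr_gt0// ltr_wpDl.
exists (e / (2 * pi * (`|a| + 1))); first exact: divr_gt0.
move=> x h hd; apply: le_trans (ee_dist _ _) _.
rewrite -mulrBr addrAC subrr add0r normrM mulrA.
move: hd; rewrite ltr_pdivlMr// => hd; apply: ltW; apply: le_lt_trans hd.
rewrite mulrC ler_wpM2l// ler_wpM2l ?mulr_ge0 ?(ltW p0)//; lra.
Qed.

(** The values at [x0 + n] give a frequency modulo [1]. Averaging the modulated
    function along the integers then leaves a nonzero function of period [1],
    whose nonzero coefficient determines the integer part of the frequency. *)
Theorem real_uniqueness f x0 : ap f -> ucR f -> f x0 != 0 ->
  exists th : R, Mean (fun s => f s * ee (- th * s)) != 0.
Proof.
move=> af uf fx0.
have intD : {morph (fun n : int => n%:~R : R) : a b / a + b >-> a + b}.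
  by move=> a b; rewrite intrD.
have ag : ap (fun n : int => f (x0 + n%:~R)) by exact: (ap_line intD).
have fx00 : f (x0 + 0%:~R) != 0 by rewrite addr0.
have [th hth] := int_uniqueness (n0 := 0) ag fx00.
have [M M0 fM] := ap_bounded af.
pose F s := f s * ee (- th * s).
have aF : ap F by apply: ap_mul => //; exact: ap_eelin.
have uF : ucR F.
  apply: (@ucR_mul _ _ (M + 1)) => //; last exact: ucR_ee.
    by move=> x; have := fM x; lra.
  by move=> x; rewrite nrm_ee; lra.
have [mi hm] := expectP intD aF; pose m := expect (fun n : int => n%:~R : R) F.
have mx0 : m x0 != 0.
  rewrite /m expect_pt//; move: hth.
  rewrite (_ : (fun h : int => F (x0 + h%:~R)) =
     (fun n => ee (- th * x0) * (f (x0 + n%:~R) * ch (- th) n))); last first.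
    by apply/funext => n; rewrite /F mulrDr eeD mulrCA.
  rewrite MeanZ; last by apply: ap_mul => //; exact: ap_ch.
  move=> hth; rewrite mulf_neq0// -nrm_eq0 nrm_ee; exact: oner_neq0.
have am : ap m by exact: ap_expect.
have um : ucR m.
  move=> e e0; have [d d0 hd] := uF e e0; exists d => // x h hh.
  apply: (isexp_dist intD (isexp_shift h (expectP intD aF)) (expectP intD aF)) => y.
  exact: hd.
have mper x : m (x + 1) = m x by exact: (mi x 1).
have [k hk] := periodic_uniqueness am mper um mx0.
exists (th - k%:~R); move: hk.
have <- : expect (fun n : int => n%:~R : R) (fun s => ee (k%:~R * s) * F s) =
    (fun x => m x * ee (k%:~R * x)).
  rewrite (_ : (fun x => _ * _) = (fun x => ee (k%:~R * x) * m x)); last first.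
    by apply/funext => x; rewrite mulrC.
  apply: (isexp_E intD); apply: (@isexpZ _ _ _ _ (fun s => ee (k%:~R * s)) F m 1).
  - by move=> x h; rewrite mulrDr eeD -intrM ee_int mulr1.
  - by move=> x; rewrite nrm_ee.
  - exact: expectP.
rewrite Mean_expect//; last by apply: ap_mul => //; exact: ap_eelin.
congr (_ != _); congr Mean; apply/funext => s.
by rewrite /F mulrCA -eeD; congr (_ * ee _); ring.
Qed.

End real_line.

Section vectors.
Variables (R : realType) (d : nat).
Local Notation C := (CC R).
Local Notation X := 'rV[R]_d.
Implicit Types (f g F : X -> C) (x y z t h : X).

(** Uniform continuity, for the maximum of the coordinates. *)
Definition uc f := forall e : R, 0 < e -> exists2 dl : R, 0 < dl &
  forall x h, (forall i, `|h 0 i| < dl) -> nrm (f (x + h) - f x) <= e.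

Lemma dotpDl x x' y : dotp (x + x') y = dotp x y + dotp x' y.
Proof. by rewrite /dotp -big_split; apply: eq_bigr => i _; rewrite mxE mulrDl. Qed.
Lemma dotpC x y : dotp x y = dotp y x.
Proof. by apply: eq_bigr => i _; rewrite mulrC. Qed.
Lemma dotpDr x y y' : dotp x (y + y') = dotp x y + dotp x y'.
Proof. by rewrite dotpC dotpDl !(dotpC x). Qed.
Lemma dotpNl x y : dotp (- x) y = - dotp x y.
Proof. by rewrite /dotp -sumrN; apply: eq_bigr => i _; rewrite mxE mulNr. Qed.
Lemma dotpNr x y : dotp x (- y) = - dotp x y.
Proof. by rewrite dotpC dotpNl dotpC. Qed.
Lemma dotp_delta (a : R) i y : dotp (a *: delta_mx 0 i) y = a * y 0 i.
Proof.
rewrite /dotp (bigD1 i)//= !mxE !eqxx mulr1 big1 ?addr0// => j ji.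
by rewrite !mxE eqxx (negbTE ji) mulr0 mul0r.
Qed.

Lemma chiE y x : chi y x = ee (dotp x y). Proof. by []. Qed.
Lemma chiDr y x x' : chi y (x + x') = chi y x * chi y x'.
Proof. by rewrite !chiE dotpDl eeD. Qed.
Lemma chiDl y y' x : chi (y + y') x = chi y x * chi y' x.
Proof. by rewrite !chiE dotpDr eeD. Qed.
Lemma chiNl y x : chi (- y) x = cj (chi y x).
Proof. by rewrite !chiE dotpNr cj_ee. Qed.
Lemma chiNr y x : chi y (- x) = cj (chi y x).
Proof. by rewrite !chiE dotpNl cj_ee. Qed.
Lemma chi0l x : chi 0 x = 1.
Proof. by rewrite chiE /dotp big1 ?ee0// => i _; rewrite mxE mulr0. Qed.
Lemma chi0r y : chi y 0 = 1.
Proof. by rewrite chiE /dotp big1 ?ee0// => i _; rewrite mxE mul0r. Qed.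
Lemma chiC y x : chi y x = chi x y. Proof. by rewrite !chiE dotpC. Qed.
Lemma nrm_chi y x : nrm (chi y x) = 1. Proof. exact: nrm_ee. Qed.
Lemma chi_conj y x : chi y x * cj (chi y x) = 1.
Proof. by rewrite mulcJ nrm_chi expr1n. Qed.
Lemma ap_chi y : ap (chi y).
Proof. by apply: ap_ee => a b; rewrite dotpDl. Qed.
Lemma ap_cchi y : ap (fun x => cj (chi y x)).
Proof. by apply: ap_conj; exact: ap_chi. Qed.

Lemma uc_chi y : uc (chi y).
Proof.
move=> e e0; have p0 := pi_gt0 R; pose S := \sum_i `|y 0 i|.
have S0 : 0 <= S by exact: sumr_ge0.
exists (e / (2 * pi * (S + 1))).
  by apply: divr_gt0 => //; rewrite !mulr_gt0// ltr_wpDl.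
move=> x h hd; rewrite !chiE; apply: le_trans (ee_dist _ _) _.
rewrite dotpDl [_ + dotp h y]addrC addrK.
have : `|dotp h y| <= e / (2 * pi * (S + 1)) * S.
  apply: le_trans (ler_norm_sum _ _ _) _; rewrite /S mulr_sumr.
  by apply: ler_sum => i _; rewrite normrM ler_wpM2r//; exact/ltW.
move=> /(ler_wpM2l (_ : 0 <= 2 * pi)); rewrite ?mulr_ge0 ?(ltW p0)// => /(_ isT)/le_trans; apply.
have -> : 2 * pi * (e / (2 * pi * (S + 1)) * S) = e * (S / (S + 1)).
  have S1 : S + 1 != 0 by rewrite gt_eqF// ltr_wpDl.
  have key (Q s : R) : Q != 0 -> s + 1 != 0 ->
      Q * (e / (Q * (s + 1)) * s) = e * (s / (s + 1)).
    by move=> Q0 s1; field; rewrite Q0 s1.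
  by apply: key => //; rewrite mulf_neq0// gt_eqF.
rewrite ler_piMr ?(ltW e0)// ler_pdivrMr; lra.
Qed.

Lemma uc_mul f g M : (forall x, nrm (f x) <= M) -> (forall x, nrm (g x) <= M) ->
  uc f -> uc g -> uc (fun x => f x * g x).
Proof.
move=> fM gM uf ug e e0.
have M0 : 0 <= M := le_trans (nrm_ge0 _) (fM 0).
have e1 : 0 < e / (2 * (M + 1)) by apply: divr_gt0 => //; lra.
have [d1 d10 h1] := uf _ e1; have [d2 d20 h2] := ug _ e1.
exists (Num.min d1 d2); first by rewrite lt_min d10.
move=> x h hd.
have a1 : nrm (f (x + h) - f x) <= e / (2 * (M + 1)).
  by apply: h1 => i; have := hd i; rewrite lt_min => /andP[].
have a2 : nrm (g (x + h) - g x) <= e / (2 * (M + 1)).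
  by apply: h2 => i; have := hd i; rewrite lt_min => /andP[].
have -> : f (x + h) * g (x + h) - f x * g x =
  (f (x + h) - f x) * g (x + h) + f x * (g (x + h) - g x) by ring.
apply: le_trans (nrmD _ _) _; rewrite !nrmM.
have b1 : nrm (f (x + h) - f x) * nrm (g (x + h)) <= e / (2 * (M + 1)) * M.
  by rewrite ler_pM ?nrm_ge0.
have b2 : nrm (f x) * nrm (g (x + h) - g x) <= M * (e / (2 * (M + 1))).
  by rewrite ler_pM ?nrm_ge0.
have : e / (2 * (M + 1)) * (2 * (M + 1)) = e by rewrite divfK//; lra.
lra.
Qed.

Lemma uc_conj f : uc f -> uc (fun x => cj (f x)).
Proof.
move=> uf e e0; have [dl dl0 h] := uf e e0; exists dl => // x t ht.
by rewrite -cjB nrm_conj; exact: h.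
Qed.

Lemma uc_add f g : uc f -> uc g -> uc (fun x => f x + g x).
Proof.
move=> uf ug e e0; have [|d1 d10 h1] := uf (e / 2); first by lra.
have [|d2 d20 h2] := ug (e / 2); first by lra.
exists (Num.min d1 d2); first by rewrite lt_min d10.
move=> x h hd; rewrite opprD addrACA; apply: le_trans (nrmD _ _) _.
have a1 : nrm (f (x + h) - f x) <= e / 2.
  by apply: h1 => i; have := hd i; rewrite lt_min => /andP[].
have a2 : nrm (g (x + h) - g x) <= e / 2.
  by apply: h2 => i; have := hd i; rewrite lt_min => /andP[].
lra.
Qed.

Lemma uc_cst (c : C) : uc (fun=> c).
Proof. by move=> e e0; exists 1 => // x h _; rewrite subrr nrm0 ltW. Qed.

Lemma uc_lip f (h : C -> C) : (forall a b, nrm (h a - h b) <= nrm (a - b)) ->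
  uc f -> uc (fun x => h (f x)).
Proof.
move=> hh uf e e0; have [dl dl0 hd] := uf e e0; exists dl => // x t ht.
exact: le_trans (hh _ _) (hd _ _ ht).
Qed.

Lemma uc_opp f : uc f -> uc (fun x => - f x).
Proof. by apply: (@uc_lip f -%R) => a b; rewrite -opprD nrmN. Qed.

Lemma uc_sum (I : Type) (r : seq I) (H : I -> X -> C) :
  (forall i, uc (H i)) -> uc (fun x => \sum_(i <- r) H i x).
Proof.
move=> uH; elim: r => [|i r IH].
  by rewrite (_ : (fun x => _) = fun=> 0); [exact: uc_cst|apply/funext => x; rewrite big_nil].
rewrite (_ : (fun x => _) = fun x => H i x + \sum_(j <- r) H j x); first exact: uc_add.
by apply/funext => x; rewrite big_cons.
Qed.

Lemma uc_lim f : (forall e, 0 < e -> exists2 g, uc g & forall x, nrm (f x - g x) <= e) ->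
  uc f.
Proof.
move=> hf e e0; have [|g ug hg] := hf (e / 3); first by lra.
have [|dl dl0 hd] := ug (e / 3); first by lra.
exists dl => // x t ht; have h3 := hd x t ht.
have h1 := nrm_tri (f (x + t)) (g (x + t)) (f x).
have h2 := nrm_tri (g (x + t)) (g x) (f x).
have h4 := hg (x + t); have h5 := hg x; rewrite nrmC in h5; lra.
Qed.

Lemma uc_shift f t : uc f -> uc (fun x => f (x + t)).
Proof.
move=> uf e e0; have [dl dl0 h] := uf e e0; exists dl => // x s hs.
by rewrite addrAC; exact: h.
Qed.

Lemma uc_neg f : uc f -> uc (fun x => f (- x)).
Proof.
move=> uf e e0; have [dl dl0 h] := uf e e0; exists dl => // x s hs.
by rewrite opprD; apply: h => i; rewrite mxE normrN.
Qed.

Let e_ (i : 'I_d) : X := delta_mx 0 i.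

Lemma vec_sum x : x = \sum_i x 0 i *: e_ i.
Proof.
by rewrite [LHS]matrix_sum_delta big_ord1.
Qed.

(** The frequency is found one coordinate at a time: a conditional expectation
    makes the suitably modulated function independent of the coordinate without
    making it vanish, and does not affect the other coefficients. *)
Theorem vec_uniqueness F x0 : ap F -> uc F -> F x0 != 0 ->
  exists y, Mean (fun x => F x * cj (chi y x)) != 0.
Proof.
move=> aF uF Fx0.
suff [F' [y [[x1 F'x1] inv E]]] : exists (F' : X -> C) y,
    [/\ exists x1, F' x1 != 0,
        forall (j : 'I_d) x (a : R), (j < d)%N -> F' (x + a *: e_ j) = F' x &
        forall z, (forall j : 'I_d, (j < d)%N -> z 0 j = 0) ->
          Mean (fun x => F' x * cj (chi z x)) = Mean (fun x => F x * cj (chi (y + z) x))].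
  exists y; have := E 0 (fun j _ => mxE _ _ _ _); rewrite addr0 => <-.
  rewrite (_ : (fun x => _) = fun=> F' x1); first by rewrite Mean_cst.
  apply/funext => x; rewrite chi0l -[1]/(1%:C)%C; simpc; rewrite conjc1 mulr1.
  have inv' t s : F' (s + t) = F' s.
    rewrite (vec_sum t); elim: (index_enum _) s => [|i r IH] s.
      by rewrite big_nil addr0.
    by rewrite big_cons addrA IH inv.
  by rewrite -(inv' (x - x1) x1) [x1 + _]addrC subrK.
suff gen (n : nat) : (n <= d)%N -> exists (F' : X -> C) y,
    [/\ ap F', uc F', exists x1, F' x1 != 0,
        forall (j : 'I_d) x (a : R), (j < n)%N -> F' (x + a *: e_ j) = F' x &
        forall z, (forall j : 'I_d, (j < n)%N -> z 0 j = 0) ->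
          Mean (fun x => F' x * cj (chi z x)) = Mean (fun x => F x * cj (chi (y + z) x))].
  by have [F' [y [_ _ h1 h2 h3]]] := gen d (leqnn d); exists F', y.
elim: n => [_|n IH nd].
  by exists F, 0; split=> //; [exists x0|move=> z _; rewrite add0r].
have [F' [y [aF' uF' [x1 F'x1] inv E]]] := IH (ltnW nd).
pose i : 'I_d := Ordinal nd; pose phi (s : R) : X := s *: e_ i.
have phiD : {morph phi : a b / a + b >-> a + b} by move=> a b; rewrite /phi scalerDl.
have [|||th hth] := @real_uniqueness R (fun s => F' (x1 + phi s)) 0.
- exact: (ap_line phiD).
- move=> e e0; have [dl dl0 hd] := uF' e e0; exists dl => // s h hh.
  rewrite phiD addrA; apply: hd => j; rewrite !mxE eqxx /=.
  by case: (j == i); rewrite ?mulr1// mulr0 normr0.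
- by rewrite /phi scale0r addr0.
pose zi : X := th *: e_ i; pose G x := F' x * cj (chi zi x).
have aG : ap G by apply: ap_mul => //; exact: ap_cchi.
have [M M0 F'M] := ap_bounded aF'.
have uG : uc G.
  apply: (@uc_mul _ _ (M + 1)) => //; last exact/uc_conj/uc_chi.
    by move=> x; have := F'M x; lra.
  by move=> x; rewrite nrm_conj nrm_chi; lra.
have [mi hm] := expectP phiD aG.
have chiphi z s x : chi z (x + phi s) = chi z x * ee (s * z 0 i).
  by rewrite chiDr [chi z (phi s)]chiE dotp_delta.
exists (expect phi G), (y + zi); split.
- exact: ap_expect.
- move=> e e0; have [dl dl0 hd] := uG e e0; exists dl => // x h hh.
  apply: (isexp_dist phiD (isexp_shift h (expectP phiD aG)) (expectP phiD aG)) => t.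
  exact: hd.
- exists x1; rewrite expect_pt//.
  rewrite (_ : (fun h : R => _) = (fun s : R => cj (chi zi x1) * (F' (x1 + phi s) * ee (- th * s)))).
    rewrite MeanZ; last by apply: ap_mul; [exact: (ap_line phiD)|exact: ap_eelin].
    by rewrite mulf_neq0// -nrm_eq0 nrm_conj nrm_chi oner_eq0.
  apply/funext => s; rewrite /G chiphi cjM cj_ee !mxE !eqxx mulr1 mulrCA.
  by congr (_ * (_ * ee _)); ring.
- move=> j x a; rewrite ltnS leq_eqVlt => /orP[/eqP jn|jn].
    have -> : j = i by exact: val_inj.
    exact: (mi x a).
  have := isexp_shift (a *: e_ j) (expectP phiD aG).
  rewrite (_ : (fun x => G (x + _)) = G) => [h|].
    by have := isexp_uniq phiD h (expectP phiD aG) => /(congr1 (fun f => f x)).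
  apply/funext => u; rewrite /G inv// chiDr [chi zi (a *: _)]chiE dotp_delta !mxE eqxx.
  have -> : (j == i) = false by apply/eqP => ji; move: jn; rewrite ji ltnn.
  by rewrite !mulr0 ee0 mulr1.
- move=> z hz.
  rewrite -addrA -E; last first.
    move=> j jn; rewrite !mxE eqxx hz ?addr0; last exact: ltnW.
    have -> : (j == i) = false by apply/eqP => ji; move: jn; rewrite ji ltnn.
    by rewrite mulr0.
  have -> : (fun x => expect phi G x * cj (chi z x)) =
     expect phi (fun x => cj (chi z x) * G x).
    apply/esym; rewrite (_ : (fun x => expect _ _ _ * _) = (fun x => cj (chi z x) * expect phi G x)); last first.
      by apply/funext => x; rewrite mulrC.
    apply: (isexp_E phiD); apply: (@isexpZ _ _ _ _ (fun x => cj (chi z x)) G _ 1).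
    + by move=> x s; rewrite chiphi hz// mulr0 ee0 mulr1.
    + by move=> x; rewrite nrm_conj nrm_chi.
    + exact: expectP.
  rewrite Mean_expect//; last by apply: ap_mul => //; exact: ap_cchi.
  by congr Mean; apply/funext => x; rewrite /G chiDl cjM mulrCA [cj (chi z x) * _]mulrC.
Qed.

Corollary vec_uniqueness0 F : ap F -> uc F ->
  (forall y, Mean (fun x => F x * cj (chi y x)) = 0) -> forall x, F x = 0.
Proof.
move=> aF uF h x; apply/eqP; apply: contrapT => /negP Fx.
by have [y] := vec_uniqueness aF uF Fx; rewrite h eqxx.
Qed.

Lemma Mean_chi z : Mean (chi z) = (z == 0)%:R.
Proof.
have [->|z0] := eqVneq z 0.
  by rewrite (_ : chi 0 = fun=> 1); [exact: Mean_cst|apply/funext => x; exact: chi0l].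
have [i zi] : exists i, z 0 i != 0.
  apply: contrapT => h; case/eqP: z0; apply/rowP => i; rewrite mxE.
  by apply/eqP; apply: contrapT => /negP zi; apply: h; exists i.
apply: (@Mean_eigen _ _ _ ((1 / 2 / z 0 i) *: delta_mx 0 i) (-1)).
- exact: ap_chi.
- by move=> x; rewrite chiDr [chi z (_ *: _)]chiE dotp_delta divfK// ee_half mulrC.
- by rewrite eq_sym -subr_eq0 opprK -mulr2n pnatr_eq0.
Qed.

Lemma chi_orth y z : Mean (fun x => chi y x * cj (chi z x)) = (y == z)%:R.
Proof.
rewrite (_ : (fun x => _) = chi (y - z)); first by rewrite Mean_chi subr_eq0.
by apply/funext => x; rewrite chiDl chiNl.
Qed.

End vectors.

(** * Compactly supported functions and uniqueness of the Haar functional *)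

Section tents.
Variable R : realType.
Implicit Types (t u : R).

Definition ramp t : R := Num.min (Num.max t 0) 1.
(** Written as a difference of ramps, so that the sum of its integer translates
    telescopes. *)
Definition tent t : R := ramp (t + 1) - ramp t.

Lemma ramp_ge0 t : 0 <= ramp t.
Proof. by rewrite /ramp le_min le_max lexx ler01 orbT. Qed.
Lemma ramp_le1 t : ramp t <= 1.
Proof. by rewrite /ramp ge_min lexx orbT. Qed.
Lemma ramp_mono t u : t <= u -> ramp t <= ramp u.
Proof. by move=> tu; rewrite /ramp le_min2// le_max2. Qed.
Lemma ramp0 t : t <= 0 -> ramp t = 0.
Proof. by move=> t0; rewrite /ramp max_r// min_l. Qed.
Lemma ramp1 t : 1 <= t -> ramp t = 1.
Proof. by move=> t0; rewrite /ramp max_l ?min_r//; lra. Qed.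

Lemma ramp_id t : 0 <= t <= 1 -> ramp t = t.
Proof. by move=> /andP[t0 t1]; rewrite /ramp max_l// min_l. Qed.

Lemma tentE t : tent t = Num.max 0 (1 - `|t|).
Proof.
rewrite /tent; have [t0|t0] := leP 0 t.
  rewrite ger0_norm// ramp1; last by lra.
  have [t1|t1] := leP t 1; first by rewrite ramp_id ?t0// max_r; lra.
  by rewrite ramp1 ?subrr ?max_l//; lra.
rewrite ltr0_norm// (ramp0 (ltW t0)) subr0 opprK [1 + t]addrC.
have [t1|t1] := leP (-1) t; first by rewrite ramp_id ?max_r//; [|apply/andP; split]; lra.
by rewrite ramp0 ?max_l//; lra.
Qed.

Lemma tent_ge0 t : 0 <= tent t.
Proof. by rewrite tentE le_max lexx. Qed.
Lemma tent_le1 t : tent t <= 1.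
Proof. by rewrite tentE ge_max ler01/= gerBl normr_ge0. Qed.
Lemma tent_out t : 1 <= `|t| -> tent t = 0.
Proof. by move=> h; rewrite tentE max_l//; lra. Qed.
Lemma tentN t : tent (- t) = tent t. Proof. by rewrite !tentE normrN. Qed.
Lemma tent_lip t u : `|tent t - tent u| <= `|t - u|.
Proof.
rewrite !tentE; have h1 := ler_dist_dist t u; apply: le_trans h1.
move: (`|t|) (`|u|) => a b; rewrite /Num.max.
case: ltP => h1; case: ltP => h2; rewrite ler_norml;
  have := ler_norm (a - b); have := ler_norm (b - a); rewrite (distrC b a);
  move=> *; apply/andP; split; lra.
Qed.

Lemma sum_tent N t :
  \sum_(j < (N + N).+1) tent (t - (j%:Z - N%:Z)%:~R) = ramp (t + N%:R + 1) - ramp (t - N%:R).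
Proof.
pose F (j : nat) := ramp (t + N%:R + 1 - j%:R).
have -> : \sum_(j < (N + N).+1) tent (t - (j%:Z - N%:Z)%:~R) =
   \sum_(0 <= j < (N + N).+1) - (F j.+1 - F j).
  rewrite big_mkord; apply: eq_bigr => j _; rewrite /F /tent opprB -[j.+1%:R]natr1.
  by rewrite intrB -!pmulrn; congr (ramp _ - ramp _); ring.
rewrite sumrN telescope_sumr// opprB /F subr0 -natr1 natrD; congr (_ - ramp _); ring.
Qed.

End tents.

Section lattice.
Variables (R : realType) (d : nat).
Local Notation C := (CC R).
Local Notation X := 'rV[R]_d.
Local Notation K := {ffun 'I_d -> int}.
Implicit Types (f g : X -> C) (x y z t a h : X) (k : K) (N n : nat).

Definition vec k : X := \row_i (k i)%:~R.

Definition box N : seq K :=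
  [seq [ffun i => (g i : nat)%:Z - N%:Z] | g : {ffun 'I_d -> 'I_(N + N).+1}].

Lemma box_uniq N : uniq (box N).
Proof.
rewrite map_inj_uniq ?enum_uniq// => g g' /ffunP E; apply/ffunP => i; apply: val_inj.
by have := E i; rewrite !ffunE => /(congr1 (fun z : int => z + N%:Z)); rewrite !subrK => -[].
Qed.

Lemma mem_box N k : (k \in box N) = [forall i, (`|k i| <= N)%N].
Proof.
apply/idP/forallP => [/fintype.imageP[g _ ->] i|h].
  rewrite ffunE; have := ltn_ord (g i); move: (nat_of_ord (g i)) => m mN.
  lia.
pose g : {ffun 'I_d -> 'I_(N + N).+1} := [ffun i => inord `|k i + N%:Z|].
apply/fintype.imageP; exists g => //; apply/ffunP => i.
have hi : (- N%:Z <= k i <= N%:Z)%R by have := h i; lia.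
have Ea : (absz (k i + N%:Z))%:Z = k i + N%:Z by rewrite gez0_abs//; lia.
by rewrite !ffunE inordK ?Ea ?addrK// -ltz_nat Ea; lia.
Qed.

Definition tentV x : R := \prod_i tent (x 0 i).

Lemma tentV_ge0 x : 0 <= tentV x.
Proof. by apply: prodr_ge0 => i _; exact: tent_ge0. Qed.
Lemma tentV_le1 x : tentV x <= 1.
Proof. by apply: prodr_ile1 => i _; rewrite tent_ge0 tent_le1. Qed.
Lemma tentV_out x i : 1 <= `|x 0 i| -> tentV x = 0.
Proof. by move=> h; rewrite /tentV (bigD1 i)//= tent_out ?mul0r. Qed.
Lemma tentVN x : tentV (- x) = tentV x.
Proof. by apply: eq_bigr => i _; rewrite mxE tentN. Qed.

(** The partition of unity by translated tents, cut off at the box [N]. *)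
Definition cutoff N x : R := \sum_(k <- box N) tentV (x - vec k).

Lemma cutE N x : cutoff N x = \prod_i (ramp (x 0 i + N%:R + 1) - ramp (x 0 i - N%:R)).
Proof.
under eq_bigr do rewrite -sum_tent.
rewrite bigA_distr_bigA /cutoff big_image; apply: eq_bigr => g _.
by apply: eq_bigr => i _; rewrite !mxE ffunE.
Qed.

Lemma cut_ge0 N x : 0 <= cutoff N x.
Proof. by apply: sumr_ge0 => k _; exact: tentV_ge0. Qed.
Lemma cut_le1 N x : cutoff N x <= 1.
Proof.
rewrite cutE; apply: prodr_ile1 => i _; apply/andP; split.
  by rewrite subr_ge0 ramp_mono//; have := ler0n R N; lra.
by have := ramp_le1 (x 0 i + N%:R + 1); have := ramp_ge0 (x 0 i - N%:R); lra.
Qed.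
Lemma cut1 N x : (forall i, `|x 0 i| <= N%:R) -> cutoff N x = 1.
Proof.
move=> h; rewrite cutE big1// => i _; have /ler_normlP[h1 h2] := h i.
by rewrite ramp1 ?ramp0 ?subr0//; lra.
Qed.
Lemma cut0 N x i : N%:R + 1 <= `|x 0 i| -> cutoff N x = 0.
Proof.
move=> h; rewrite cutE (bigD1 i)//= [X in X * _](_ : _ = 0) ?mul0r//.
have N0 := ler0n R N.
have := ger0_norm; move: h; have [x0 h|x0 h] := leP 0 (x 0 i).
  by rewrite ger0_norm// in h; rewrite !ramp1 ?subrr//; lra.
by rewrite ltr0_norm// in h; rewrite !ramp0 ?subrr//; lra.
Qed.

Lemma uc_prod (I : Type) (r : seq I) (F : I -> X -> C) :
  (forall i, uc (F i)) -> (forall i x, nrm (F i x) <= 1) ->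
  uc (fun x => \prod_(i <- r) F i x) /\ forall x, nrm (\prod_(i <- r) F i x) <= 1.
Proof.
move=> uF F1; elim: r => [|i r [IH1 IH2]].
  split; last by move=> x; rewrite big_nil nrm1.
  by rewrite (_ : (fun x => _) = fun=> 1); [exact: uc_cst|apply/funext => x; rewrite big_nil].
split; last by move=> x; rewrite big_cons nrmM mulr_ile1 ?nrm_ge0.
rewrite (_ : (fun x => _) = fun x => F i x * \prod_(j <- r) F j x).
  exact: (uc_mul (F1 i) IH2).
by apply/funext => x; rewrite big_cons.
Qed.

Lemma uc_tentV : uc (fun x => rc (tentV x) : C).
Proof.
rewrite (_ : (fun x => _) = fun x => \prod_i rc (tent (x 0 i))); last first.
  by apply/funext => x; rewrite /tentV rmorph_prod.
apply: (uc_prod _ _ _).1 => [i e e0|i x]; last first.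
  by rewrite nrm_real ger0_norm ?tent_ge0 ?tent_le1.
exists e => // x h hd; rewrite -rmorphB nrm_real; apply: le_trans (tent_lip _ _) _.
by rewrite mxE addrAC subrr add0r; exact/ltW.
Qed.

Lemma uc_scale f (c : R) : uc f -> uc (fun x => f (c *: x)).
Proof.
move=> uf e e0; have [dl dl0 hd] := uf e e0; have c0 := normr_ge0 c.
exists (dl / (`|c| + 1)); first by apply: divr_gt0 => //; lra.
move=> x h hh; rewrite scalerDr; apply: hd => i; rewrite mxE normrM.
have := hh i; rewrite ltr_pdivlMr; last by lra.
have := normr_ge0 (h 0 i); nra.
Qed.

Lemma uc_tents n k : uc (fun x => rc (tentV (n%:R *: x - vec k)) : C).
Proof. exact: (@uc_scale (fun x => rc (tentV (x - vec k))) n%:R (uc_shift _ uc_tentV)). Qed.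

Definition supp_in a (r : R) f := forall x i, r < `|x 0 i - a 0 i| -> f x = 0.
(** Membership in the space of test functions, in coordinates. *)
Definition cc f := uc f /\ exists r, supp_in 0 r f.

Lemma supp_inW a r r' f : r <= r' -> supp_in a r f -> supp_in a r' f.
Proof. by move=> rr h x i hx; apply: (h x i); exact: le_lt_trans hx. Qed.

(** Interpolation of [f] by tents at scale [1 / n]. *)
Definition interp n N f x : C :=
  \sum_(k <- box N) f (n%:R^-1 *: vec k) * rc (tentV (n%:R *: x - vec k)).

(** The tents are a partition of unity, so the value at [x] is an average of
    values of [f] at neighbouring grid points. *)
Lemma interp_close n N f x e : (0 < n)%N ->
  (forall x h, (forall i, `|h 0 i| < (n%:R^-1 + n%:R^-1)) -> nrm (f (x + h) - f x) <= e) ->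
  nrm (f x * rc (cutoff N (n%:R *: x)) - interp n N f x) <= e.
Proof.
move=> n0 hf; have nn : 0 < n%:R :> R by rewrite ltr0n.
rewrite /interp /cutoff rmorph_sum mulr_sumr -sumrB.
apply: le_trans (nrm_sum _ _ _) _.
apply: (@le_trans _ _ (e * cutoff N (n%:R *: x))); last first.
  have e0 : 0 <= e.
    apply: le_trans (nrm_ge0 _) (hf x 0 _) => i.
    by rewrite mxE normr0 addr_gt0 ?invr_gt0.
  by rewrite ler_piMr// cut_le1.
rewrite /cutoff mulr_sumr; apply: ler_sum => k _; rewrite -mulrBl nrmM nrm_real.
rewrite ger0_norm ?tentV_ge0//.
have [h|/existsNP[i /negP]] := pselect (forall i, `|(n%:R *: x - vec k) 0 i| < 1); last first.
  by rewrite -leNgt => h; rewrite (tentV_out h) !mulr0.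
rewrite ler_wpM2r ?tentV_ge0//.
have -> : f x = f (n%:R^-1 *: vec k + (x - n%:R^-1 *: vec k)) by rewrite addrC subrK.
apply: hf => i; have := h i; rewrite !mxE => hi.
have -> : x 0 i - n%:R^-1 * (k i)%:~R = n%:R^-1 * (n%:R * x 0 i - (k i)%:~R).
  by rewrite mulrBr mulKf// gt_eqF.
rewrite normrM gtr0_norm ?invr_gt0//.
apply: (@lt_trans _ _ (n%:R^-1 * 1)); first by rewrite ltr_pM2l ?invr_gt0.
by rewrite mulr1 ltrDl invr_gt0.
Qed.

Lemma uc_inv f e : uc f -> 0 < e -> exists2 n0 : nat, (0 < n0)%N & forall n, (n0 <= n)%N ->
  forall x h, (forall i, `|h 0 i| < (n%:R^-1 + n%:R^-1)) -> nrm (f (x + h) - f x) <= e.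
Proof.
move=> uf e0; have [dl dl0 hd] := uf e e0.
have [|m hm] := @inv_le_small R (dl / 2); first by lra.
exists m.+1 => // n mn x h hh; apply: hd => i; apply: lt_le_trans (hh i) _.
have : n%:R^-1 <= dl / 2 by apply: le_trans hm; rewrite lef_pV2 ?posrE ?ltr0n ?ler_nat// (leq_trans _ mn).
lra.
Qed.

Lemma cc_bounded f : cc f -> exists2 M, 0 <= M & forall x, nrm (f x) <= M.
Proof.
move=> [uf [r sf]]; have [n n0 hn] := uc_inv uf ltr01.
have nn : 0 < n%:R :> R by rewrite ltr0n.
pose N := (Num.truncn (n%:R * r)).+1.
have S0 : 0 <= \sum_(k <- box N) nrm (f (n%:R^-1 *: vec k)).
  by apply: sumr_ge0 => k _; exact: nrm_ge0.
exists (1 + \sum_(k <- box N) nrm (f (n%:R^-1 *: vec k))); first by lra.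
move=> x; have [->|fx] := eqVneq (f x) 0; first by rewrite nrm0; lra.
have hx i : `|(n%:R *: x) 0 i| <= N%:R.
  rewrite mxE normrM gtr0_norm//; apply: (@le_trans _ _ (n%:R * r)).
    rewrite ler_pM2l// leNgt; apply: contra fx => hx; apply/eqP/(sf x i).
    by rewrite mxE subr0.
  exact/ltW/truncnS_gt.
have := interp_close N x n0 (hn n (leqnn n)).
rewrite cut1// mulr1 => h1.
have h2 : nrm (interp n N f x) <= \sum_(k <- box N) nrm (f (n%:R^-1 *: vec k)).
  apply: le_trans (nrm_sum _ _ _) _; apply: ler_sum => k _.
  rewrite nrmM nrm_real ger0_norm ?tentV_ge0// ler_piMr ?nrm_ge0//; exact: tentV_le1.
have := nrmD (f x - interp n N f x) (interp n N f x); rewrite subrK; lra.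
Qed.

Lemma cc_add f g : cc f -> cc g -> cc (fun x => f x + g x).
Proof.
move=> [uf [r sf]] [ug [s sg]]; split; first exact: uc_add.
exists (Num.max r s) => x i; rewrite gt_max => /andP[h1 h2].
by rewrite (sf x i)// (sg x i)// addr0.
Qed.

Lemma cc_mul f g M : cc f -> uc g -> (forall x, nrm (g x) <= M) -> cc (fun x => f x * g x).
Proof.
move=> cf ug gM; have [M' M'0 fM] := cc_bounded cf; have [uf [r sf]] := cf; split.
  apply: (@uc_mul _ _ f g (Num.max M' M)) => // x; rewrite le_max ?fM ?gM ?orbT//.
by exists r => x i h; rewrite (sf x i)// mul0r.
Qed.

Lemma cc_scale (c : C) f : cc f -> cc (fun x => c * f x).
Proof.
move=> cf; have := @cc_mul f (fun=> c) (nrm c) cf (@uc_cst _ _ c) (fun=> lexx _).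
by congr cc; apply/funext => x; rewrite mulrC.
Qed.

Lemma cc0 : cc (fun=> 0).
Proof. by split; [exact: uc_cst|exists 0]. Qed.

Lemma cc_sub f g : cc f -> cc g -> cc (fun x => f x - g x).
Proof.
move=> cf cg; have := cc_add cf (cc_scale (-1) cg).
by congr cc; apply/funext => x; rewrite mulN1r.
Qed.

Lemma cc_sum (I : Type) (s : seq I) (F : I -> X -> C) :
  (forall i, cc (F i)) -> cc (fun x => \sum_(i <- s) F i x).
Proof.
move=> cF; elim: s => [|i s IH].
  by rewrite (_ : (fun x => _) = fun=> 0); [exact: cc0|apply/funext => x; rewrite big_nil].
rewrite (_ : (fun x => _) = fun x => F i x + \sum_(j <- s) F j x); first exact: cc_add.
by apply/funext => x; rewrite big_cons.
Qed.

Lemma supp_shift a r f t : supp_in a r f -> supp_in (a - t) r (fun x => f (x + t)).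
Proof.
move=> sf x i h; apply: (sf (x + t) i); move: h; rewrite !mxE.
by congr (_ < `|_|); ring.
Qed.

Lemma supp_in_move a b r f : supp_in a r f -> exists s, supp_in b s f.
Proof.
move=> sf; exists (r + \sum_i `|b 0 i - a 0 i|) => x i h; apply: (sf x i).
have : `|b 0 i - a 0 i| <= \sum_i `|b 0 i - a 0 i|.
  by rewrite (bigD1 i)//= lerDl; exact: sumr_ge0.
have := ler_normD (x 0 i - a 0 i) (a 0 i - b 0 i).
by rewrite addrA subrK (distrC (a 0 i)); lra.
Qed.

Lemma cc_shift f t : cc f -> cc (fun x => f (x + t)).
Proof.
move=> [uf [r sf]]; split; first exact: uc_shift.
exact: supp_in_move (supp_shift (t := t) sf).
Qed.

Lemma cc_neg f : cc f -> cc (fun x => f (- x)).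
Proof.
move=> [uf [r sf]]; split; first exact: uc_neg.
by exists r => x i h; apply: (sf (- x) i); move: h; rewrite !mxE !subr0 normrN.
Qed.

Lemma cc_conj f : cc f -> cc (fun x => cj (f x)).
Proof.
move=> [uf [r sf]]; split; first exact: uc_conj.
by exists r => x i h; rewrite (sf x i)// conjc0.
Qed.

Lemma cc_refl f x : cc f -> cc (fun y => f (x - y)).
Proof.
move=> /cc_neg/(cc_shift (- x)); congr cc; apply/funext => y.
by rewrite opprD opprK addrC.
Qed.

Lemma supp_refl f r x : supp_in 0 r f -> supp_in x r (fun y => f (x - y)).
Proof.
by move=> sf y i h; apply: (sf _ i); move: h; rewrite !mxE subr0 distrC.
Qed.

Lemma supp_tentV : supp_in 0 1 (fun x => rc (tentV x) : C).
Proof.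
by move=> x i; rewrite mxE subr0 => /ltW h; rewrite (tentV_out h).
Qed.

Lemma cc_tentV : cc (fun x => rc (tentV x) : C).
Proof. by split; [exact: uc_tentV|exists 1; exact: supp_tentV]. Qed.

Lemma cc_tents n k : (0 < n)%N -> cc (fun x => rc (tentV (n%:R *: x - vec k)) : C).
Proof.
move=> n0; split; first exact: uc_tents.
have : supp_in (n%:R^-1 *: vec k) 1 (fun x => rc (tentV (n%:R *: x - vec k)) : C).
  move=> x i; rewrite !mxE => h; rewrite (@tentV_out _ i)// !mxE.
  have nn : 0 < n%:R :> R by rewrite ltr0n.
  have -> : n%:R * x 0 i - (k i)%:~R = n%:R * (x 0 i - n%:R^-1 * (k i)%:~R).
    by rewrite mulrBr mulVKf// gt_eqF.
  rewrite normrM (gtr0_norm nn); apply: mulr_ege1; last exact: ltW.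
  by rewrite ler1n.
exact: supp_in_move.
Qed.

Lemma uc_cut N : uc (fun x => rc (cutoff N x) : C).
Proof.
rewrite (_ : (fun x => _) = fun x => \sum_(k <- box N) rc (tentV (x - vec k))).
  by apply: uc_sum => k; apply: (uc_shift (- vec k) uc_tentV).
by apply/funext => x; rewrite /cutoff rmorph_sum.
Qed.

Lemma cut_nrm N x : nrm (rc (cutoff N x) : C) <= 1.
Proof. by rewrite nrm_real ger0_norm ?cut_ge0// cut_le1. Qed.

Lemma cc_mul_cut N f : uc f -> (exists M, forall x, nrm (f x) <= M) ->
  cc (fun x => f x * rc (cutoff N x)).
Proof.
move=> uf [M fM].
have cc_cut : cc (fun x => rc (cutoff N x)).
  split; first exact: uc_cut.
  by exists (N%:R + 1) => x i; rewrite mxE subr0 => /ltW h; rewrite (cut0 h).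
have := cc_mul cc_cut uf fM; congr cc; apply/funext => x; exact: mulrC.
Qed.

End lattice.

Section functionals.
Variables (R : realType) (d : nat).
Local Notation C := (CC R).
Local Notation X := 'rV[R]_d.
Implicit Types (f g : X -> C) (x y z t a : X) (L : (X -> C) -> C).

Definition lin L := forall (c : C) f g, cc f -> cc g ->
  L (fun x => c * f x + g x) = c * L f + L g.
Definition tinv L := forall f t, cc f -> L (fun x => f (x + t)) = L f.
Definition bdd L := forall r, exists2 K : R, 0 <= K & forall f M, cc f ->
  supp_in 0 r f -> (forall x, nrm (f x) <= M) -> nrm (L f) <= K * M.

Lemma lin0 L : lin L -> L (fun=> 0) = 0.
Proof.
move=> h; have := h (-1) (fun=> 0) (fun=> 0) (cc0 R d) (cc0 R d).
rewrite [-1 * L _]mulN1r addNr => E; apply: etrans E; congr L; apply/funext => x.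
by rewrite mulr0 addr0.
Qed.

Lemma linZ L c f : lin L -> cc f -> L (fun x => c * f x) = c * L f.
Proof.
move=> h cf; have := h c f (fun=> 0) cf (cc0 R d); rewrite lin0// addr0 => <-.
by congr L; apply/funext => x; rewrite addr0.
Qed.

Lemma linD L f g : lin L -> cc f -> cc g -> L (fun x => f x + g x) = L f + L g.
Proof.
move=> h cf cg; have := h 1 f g cf cg; rewrite mul1r => <-.
by congr L; apply/funext => x; rewrite mul1r.
Qed.

Lemma linB L f g : lin L -> cc f -> cc g -> L (fun x => f x - g x) = L f - L g.
Proof.
move=> h cf cg; have := linD h cf (cc_scale (-1) cg); rewrite linZ// mulN1r => <-.
by congr L; apply/funext => x; rewrite mulN1r.
Qed.

Lemma lin_sum L (I : Type) (s : seq I) (F : I -> X -> C) : lin L ->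
  (forall i, cc (F i)) -> L (fun x => \sum_(i <- s) F i x) = \sum_(i <- s) L (F i).
Proof.
move=> hL cF; elim: s => [|i s IH].
  by rewrite big_nil; apply: etrans (lin0 hL); congr L; apply/funext => x; rewrite big_nil.
rewrite big_cons -IH -linD//; last exact: cc_sum.
by congr L; apply/funext => x; rewrite big_cons.
Qed.

(** Both functionals of [f] are, up to small errors, the same Riemann sum of
    [f] times the value of the functional on one small tent. *)
Lemma riemann_approx L f (r e : R) (n N : nat) : lin L -> tinv L -> cc f -> supp_in 0 r f ->
  (0 < n)%N -> n%:R * r <= N%:R ->
  (forall x (h : X), (forall i, `|h 0 i| < (n%:R^-1 + n%:R^-1)) -> nrm (f (x + h) - f x) <= e) ->
  forall K : R, (forall f (M : R), cc f -> supp_in 0 (r + 1) f -> (forall x, nrm (f x) <= M) ->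
     nrm (L f) <= K * M) ->
  nrm (L f - (\sum_(k <- box d N) f (n%:R^-1 *: vec R k)) *
     L (fun x => rc (tentV (n%:R *: x)))) <= K * e.
Proof.
move=> hL tL cf sf n0 nN hf K hK; have nn : 0 < n%:R :> R by rewrite ltr0n.
have nk (k : {ffun 'I_d -> int}) x : n%:R *: x - vec R k = n%:R *: (x - n%:R^-1 *: vec R k).
  by rewrite scalerBr scalerA divff ?gt_eqF// scale1r.
have ct (k : {ffun 'I_d -> int}) := cc_tents R k n0.
have ct0 : cc (fun x : X => rc (tentV (n%:R *: x)) : C).
  have := cc_shift (n%:R^-1 *: vec R 0) (ct 0); congr cc; apply/funext => x.
  by rewrite nk addrK.
have ci : cc (interp n N f) by apply: cc_sum => k; exact: cc_scale.
have -> : (\sum_(k <- box d N) f (n%:R^-1 *: vec R k)) * L (fun x => rc (tentV (n%:R *: x)))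
    = L (interp n N f).
  rewrite /interp lin_sum//; last by move=> k; exact: cc_scale.
  rewrite mulr_suml; apply: eq_bigr => k _; rewrite linZ//; congr (_ * _).
  rewrite -(tL _ (- (n%:R^-1 *: vec R k)) ct0); congr L; apply/funext => x.
  by rewrite nk.
rewrite -linB//; apply: hK; first exact: cc_sub.
  move=> x i; rewrite mxE subr0 => hx; rewrite (sf x i); last by rewrite mxE subr0; lra.
  rewrite sub0r /interp big1 ?oppr0// => k _.
  have [h|h] := leP 1 `|(n%:R *: x - vec R k) 0 i|; first by rewrite (tentV_out h) mulr0.
  rewrite (sf _ i) ?mul0r// !mxE subr0; move: h; rewrite !mxE => h.
  have h3 : n%:R * `|x 0 i| < 1 + n%:R * `|n%:R^-1 * (k i)%:~R|.
    rewrite -(gtr0_norm nn) -!normrM (gtr0_norm nn) mulVKf ?gt_eqF//.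
    have := ler_normD (n%:R * x 0 i - (k i)%:~R) (k i)%:~R; rewrite subrK; lra.
  have n1 : 1 <= n%:R :> R by rewrite ler1n.
  have : n%:R * (r + 1) < n%:R * `|x 0 i| by rewrite ltr_pM2l.
  move=> h4; rewrite -(ltr_pM2l nn); lra.
move=> x; have := interp_close N x n0 hf.
have [->|fx] := eqVneq (f x) 0; first by rewrite mul0r.
rewrite cut1 ?mulr1// => i; rewrite mxE normrM (gtr0_norm nn).
apply: le_trans nN; rewrite ler_pM2l// leNgt; apply: contra fx => hx.
by apply/eqP/(sf x i); rewrite mxE subr0.
Qed.

(** Both functionals are Riemann sums times their value on a small tent, so that
    value cancels from the two products. *)
Theorem haar_uniqueness L1 L2 f g : lin L1 -> lin L2 -> tinv L1 -> tinv L2 ->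
  bdd L1 -> bdd L2 -> cc f -> cc g -> L1 f * L2 g = L1 g * L2 f.
Proof.
move=> l1 l2 t1 t2 b1 b2 cf cg.
have [uf [r0 sf0]] := cf; have [ug [s0 sg0]] := cg; pose r := Num.max r0 s0.
have sf : supp_in 0 r f by apply: supp_inW sf0; rewrite le_max lexx.
have sg : supp_in 0 r g by apply: supp_inW sg0; rewrite le_max lexx orbT.
have [K1 K10 hK1] := b1 (r + 1); have [K2 K20 hK2] := b2 (r + 1).
pose A := nrm (L1 f) + nrm (L1 g) + K1; pose B := nrm (L2 f) + nrm (L2 g).
have A0 : 0 <= A by rewrite !addr_ge0 ?nrm_ge0.
have B0 : 0 <= B by rewrite !addr_ge0 ?nrm_ge0.
pose D := 2 * (K1 * B + A * K2) + 1.
have D0 : 0 < D by rewrite ltr_wpDl// mulr_ge0// addr_ge0// mulr_ge0.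
apply/nrm_eq => e e0; pose e' := Num.min 1 (e / D).
have e'0 : 0 < e' by rewrite lt_min ltr01 divr_gt0.
have e'1 : e' <= 1 by rewrite ge_min lexx.
have e'D : e' * D <= e by rewrite -ler_pdivlMr// ge_min lexx orbT.
have [n1 n10 h1] := uc_inv uf e'0; have [n2 n20 h2] := uc_inv ug e'0.
pose n := maxn n1 n2; have n0 : (0 < n)%N by rewrite leq_max n10.
pose N := (Num.truncn (n%:R * r)).+1.
have nN : n%:R * r <= N%:R by exact/ltW/truncnS_gt.
have hf := h1 n (leq_maxl _ _); have hg := h2 n (leq_maxr _ _).
have a1 := riemann_approx l1 t1 cf sf n0 nN hf hK1.
have a2 := riemann_approx l2 t2 cf sf n0 nN hf hK2.
have a3 := riemann_approx l1 t1 cg sg n0 nN hg hK1.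
have a4 := riemann_approx l2 t2 cg sg n0 nN hg hK2.
move: a1 a2 a3 a4.
set Sf := \sum_(k <- _) f _; set Sg := \sum_(k <- _) g _.
set a := L1 (fun x => rc (tentV _)); set b := L2 (fun x => rc (tentV _)) => a1 a2 a3 a4.
have key (u v u' v' : C) : nrm (u - u') <= K1 * e' -> nrm (v - v') <= K2 * e' ->
    nrm u + K1 <= A -> nrm v <= B -> nrm (u * v - u' * v') <= (K1 * B + A * K2) * e'.
  move=> huu hvv uA vB.
  have -> : u * v - u' * v' = (u - u') * v + u' * (v - v') by ring.
  apply: le_trans (nrmD _ _) _; rewrite !nrmM mulrDl; apply: lerD.
    by rewrite mulrAC ler_pM ?nrm_ge0.
  rewrite -mulrA ler_pM ?nrm_ge0//.
  have := nrmD (u' - u) u; rewrite subrK nrmC.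
  have : K1 * e' <= K1 by rewrite ler_piMr.
  lra.
have k1 := key _ _ _ _ a1 a4; have k2 := key _ _ _ _ a3 a2.
have p1 := nrm_ge0 (L1 f); have p2 := nrm_ge0 (L1 g).
have p3 := nrm_ge0 (L2 f); have p4 := nrm_ge0 (L2 g).
have {}k1 := k1 ltac:(rewrite /A; lra) ltac:(rewrite /B; lra).
have {}k2 := k2 ltac:(rewrite /A; lra) ltac:(rewrite /B; lra).
have := nrm_tri (L1 f * L2 g) (Sf * a * (Sg * b)) (L1 g * L2 f).
have E : Sg * a * (Sf * b) = Sf * a * (Sg * b) by ring.
rewrite [nrm (Sf * a * (Sg * b) - _)]nrmC; rewrite E in k2.
have : e' * D = 2 * (K1 * B + A * K2) * e' + e' by rewrite /D; ring.
lra.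
Qed.

End functionals.

(** * Lebesgue measure *)

Section lebesgue_shift.
Variable R : realType.

Lemma lebesgue1_shift (a : R) (A : set (measurableTypeR R)) : measurable A ->
  lebesgue_measure ((fun x : measurableTypeR R => x + a) @^-1` A) = lebesgue_measure A.
Proof.
move=> mA.
have mT : measurable_fun setT (fun x : measurableTypeR R => (x + a : measurableTypeR R)).
  by apply: measurable_funD => //; exact: measurable_cst.
pose T : {mfun (measurableTypeR R) >-> (measurableTypeR R)} :=
  HB.pack (fun x : measurableTypeR R => (x + a : measurableTypeR R)) (isMeasurableFun.Build _ _ _ _ _ mT).
apply/esym.
apply: (@lebesgue_measure_unique R (pushforward lebesgue_measure T)) => // X.
move=> [[x y] _ <-].
transitivity (lebesgue_measure (`]x - a, y - a]%classic : set (measurableTypeR R))); last first.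
  rewrite /pushforward; congr lebesgue_measure.
  by apply/seteqP; split => z /=; rewrite !in_itv /= ltrBlDr lerBrDr.
by rewrite !lebesgue_measure_itv /= !lte_fin ltrD2r -!EFinD opprD opprK addrACA addNr addr0.
Qed.

Lemma rV_consE d (p : measurableTypeR R * 'rV[R]_d) :
  rV_cons p 0 0 = p.1 /\ forall j : 'I_d, rV_cons p 0 (lift ord0 j) = p.2 0 j.
Proof.
split.
  rewrite /rV_cons (_ : 0 = lshift d (0 : 'I_1)); last exact: val_inj.
  by rewrite (row_mxEl (const_mx p.1 : 'rV[R]_1) p.2) mxE.
move=> j; rewrite /rV_cons (_ : lift ord0 j = rshift 1 j); last exact: val_inj.
by rewrite (row_mxEr (const_mx p.1 : 'rV[R]_1) p.2).
Qed.

Lemma rV_cons_all d (P : R -> Prop) (p : measurableTypeR R * 'rV[R]_d) :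
  (forall i, P (rV_cons p 0 i)) <-> P p.1 /\ forall j, P (p.2 0 j).
Proof.
have [E0 ES] := rV_consE p; split=> [h|[h0 hS] i].
  by split=> [|j]; [rewrite -E0; exact: h|rewrite -ES; exact: h].
have [->|[j ->]] : i = 0 \/ exists j, i = lift ord0 j.
  by case: (unliftP ord0 i) => [j ->|->]; [right; exists j|left].
  by rewrite E0.
by rewrite ES.
Qed.

Lemma measurable_rV_shift d (a : 'rV[R]_d) : measurable_fun setT (fun x : 'rV[R]_d => x + a).
Proof.
apply/measurable_fun_rV_coordP => i.
rewrite (_ : _ \o _ = (fun x => rV_coord i x + a 0 i : measurableTypeR R)).
  apply: measurable_funD; last exact: measurable_cst.
  exact: measurable_rV_coord.
by apply/funext => x; rewrite /rV_coord /= mxE.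
Qed.

(** By induction on the dimension, from the uniqueness of product measures. *)
Lemma lebesgue_shift d (a : 'rV[R]_d) (A : set 'rV[R]_d) : measurable A ->
  lebesgue_rV R d ((fun x : 'rV[R]_d => x + a) @^-1` A) = lebesgue_rV R d A.
Proof.
elim: d a A => [a A mA|d IH a A mA].
  congr (lebesgue_rV R 0 _); apply/seteqP.
  by split=> x; rewrite /= (_ : x + a = x)//; apply/rowP => -[].
pose T (p : measurableTypeR R * 'rV[R]_d) : measurableTypeR R * 'rV[R]_d :=
  (p.1 + a 0 0, p.2 + (\row_j a 0 (lift ord0 j))).
have mT : measurable_fun setT T.
  apply/measurable_fun_pairP; split => /=.
    apply: measurable_funD; last exact: measurable_cst.
    exact: measurable_fst.
  have := @measurableT_comp _ _ _ _ _ _ _ _ _ (measurable_rV_shift (\row_j a 0 (lift ord0 j)))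
    (@measurable_snd _ _ (measurableTypeR R) 'rV[R]_d).
  exact.
pose TT : {mfun (measurableTypeR R * 'rV[R]_d)%type >-> (measurableTypeR R * 'rV[R]_d)%type} :=
  HB.pack T (isMeasurableFun.Build _ _ _ _ _ mT).
have consT p : rV_cons (T p) = rV_cons p + a.
  apply/rowP => i; rewrite [RHS]mxE.
  have [E0 ES] := rV_consE p; have [F0 FS] := rV_consE (T p).
  case: (unliftP ord0 i) => [j ->|->]; first by rewrite ES FS /T /= !mxE.
  by rewrite E0 F0.
rewrite /= /lebesgue_cons /pushforward -comp_preimage.
have -> : (fun x : 'rV[R]_d.+1 => x + a) \o rV_cons (d:=d) = rV_cons (d:=d) \o T.
  by apply/funext => p /=; rewrite consT.
rewrite comp_preimage; apply/esym.
apply: (@product_measure_unique _ _ _ _ _ lebesgue_measure (lebesgue_rV R d)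
  (pushforward (lebesgue_measure \x lebesgue_rV R d)%E TT)).
  move=> B D mB mD; rewrite /pushforward.
  transitivity ((lebesgue_measure \x lebesgue_rV R d)%E
    (((fun x : measurableTypeR R => x + a 0 0) @^-1` B) `*`
     ((fun x : 'rV[R]_d => x + (\row_j a 0 (lift ord0 j))) @^-1` D))); first by [].
  rewrite product_measure1E//; first by congr (_ * _)%E; [exact: lebesgue1_shift|exact: IH].
    have m1 : measurable_fun setT (fun x : measurableTypeR R => (x + a 0 0 : measurableTypeR R)).
      by apply: measurable_funD => //; exact: measurable_cst.
    by rewrite -[X in measurable X]setTI; apply: m1.
  by rewrite -[X in measurable X]setTI; apply: measurable_rV_shift.
by rewrite -[X in measurable X]setTI; apply: measurable_rV_cons.
Qed.

Definition cube d (r : R) : set 'rV[R]_d := [set x | forall i, `|x 0 i| <= r].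
Arguments cube d r : clear implicits.

Lemma measurable_cube d (r : R) : measurable (cube d r).
Proof.
have -> : cube d r = \big[setI/setT]_(i < d) (rV_coord i @^-1` `[- r, r]%classic).
  rewrite -bigcap_seq; apply/seteqP; split => x.
    by move=> h i _; rewrite /= in_itv /= -ler_norml; exact: h.
  by move=> h i; have := h i (mem_index_enum i); rewrite /= in_itv /= -ler_norml.
apply: bigsetI_measurable => i _; rewrite -[X in measurable X]setTI.
by apply: measurable_rV_coord => //; exact: measurable_itv.
Qed.

Lemma lebesgue_cube d (r : R) : 0 <= r ->
  lebesgue_rV R d (cube d r) = ((2 * r) ^+ d)%:E.
Proof.
move=> r0; elim: d => [|d IH].
  by rewrite expr0 /= /dirac indicE mem_set// => -[].
rewrite /= /lebesgue_cons /pushforward.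
have -> : rV_cons (d:=d) @^-1` cube d.+1 r = (`[- r, r]%classic : set (measurableTypeR R)) `*` cube d r.
  apply/seteqP; split => p /=.
    by move=> /(rV_cons_all (fun t => `|t| <= r)) []; rewrite in_itv /= -ler_norml.
  by rewrite in_itv /= -ler_norml => h; apply/(rV_cons_all (fun t => `|t| <= r)).
rewrite product_measure1E//; last exact: measurable_cube.
rewrite IH exprS EFinM; congr (_ * _)%E.
apply: (etrans (lebesgue_measure_itv `[- r, r])); rewrite /= lte_fin; case: ltP => h.
  by rewrite -EFinD opprK mulr_natl mulr2n.
by rewrite (_ : r = 0) ?mulr0//; lra.
Qed.

End lebesgue_shift.
Arguments cube {R} d r.

Section measurability.
Variables (R : realType) (d : nat).
Local Notation C := (CC R).
Local Notation X := 'rV[R]_d.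

Lemma measurable_tent : measurable_fun setT (@tent R).
Proof.
apply: continuous_measurable_fun => x; apply/cvgrPdist_le => e e0.
by near=> y; apply: le_trans (tent_lip _ _) _; near: y; exact: cvgr_dist_le.
Unshelve. all: by end_near. Qed.

Lemma measurable_tents n (k : {ffun 'I_d -> int}) :
  measurable_fun setT (fun x : X => tentV (n%:R *: x - vec R k)).
Proof.
rewrite /tentV; apply: measurable_prod => i _.
rewrite (_ : (fun x : X => _) = (fun x => tent (n%:R * rV_coord i x - (k i)%:~R))).
  apply: measurableT_comp; first exact: measurable_tent.
  apply: measurable_funB; last exact: measurable_cst.
  apply: measurable_funM; first exact: measurable_cst.
  exact: measurable_rV_coord.
by apply/funext => x; rewrite !mxE.
Qed.

Lemma interp_cvg (f : X -> C) x (e : R) : uc f -> 0 < e -> exists n0, forall n, (n0 <= n)%N ->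
  nrm (f x - interp n.+1 (n.+1 * n.+1) f x) <= e.
Proof.
move=> uf e0; have [n1 n10 h1] := uc_inv uf e0.
exists (maxn n1 (Num.truncn (\sum_i `|x 0 i|)).+1) => n; rewrite geq_max => /andP[n1n n2n].
have := interp_close (n.+1 * n.+1) x (ltn0Sn n) (h1 n.+1 (leqW n1n)).
rewrite cut1 ?mulr1// => i; rewrite mxE normrM (ger0_norm (ler0n R n.+1)) natrM.
rewrite ler_wpM2l//; apply: (@le_trans _ _ (\sum_i `|x 0 i|)).
  by rewrite (bigD1 i)//= lerDl sumr_ge0.
by apply: ltW; apply: lt_le_trans (truncnS_gt _) _; rewrite ler_nat ltnW.
Qed.

Lemma measurable_interp n N (f : X -> C) :
  measurable_fun setT (fun x => complex.Re (interp n N f x)) /\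
  measurable_fun setT (fun x => complex.Im (interp n N f x)).
Proof.
have E x : complex.Re (interp n N f x) =
    \sum_(k <- box d N) complex.Re (f (n%:R^-1 *: vec R k)) * tentV (n%:R *: x - vec R k)
  /\ complex.Im (interp n N f x) =
    \sum_(k <- box d N) complex.Im (f (n%:R^-1 *: vec R k)) * tentV (n%:R *: x - vec R k).
  rewrite /interp; elim: (box d N) => [|k s [IH1 IH2]]; first by rewrite !big_nil.
  by rewrite !big_cons ReD ImD IH1 IH2; case: (f _) => a b /=; rewrite !mulr0 subr0 add0r.
by split; [under eq_fun do rewrite (E _).1|under eq_fun do rewrite (E _).2];
  apply: measurable_sum => k; apply: measurable_funM;
  [exact: measurable_cst|exact: measurable_tents|exact: measurable_cst|exact: measurable_tents].
Qed.

(** A uniformly continuous function is the limit of its interpolants. *)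
Lemma uc_measurable (f : X -> C) : uc f ->
  measurable_fun setT (fun x => complex.Re (f x)) /\
  measurable_fun setT (fun x => complex.Im (f x)).
Proof.
move=> uf; have cv x (e : R) : 0 < e -> exists n0, forall n, (n0 <= n)%N ->
    nrm (f x - interp n.+1 (n.+1 * n.+1) f x) <= e by move=> e0; exact: interp_cvg.
split.
  apply: (@measurable_fun_cvg _ _ _ _ (fun n x => complex.Re (interp n.+1 (n.+1 * n.+1) f x))).
    by move=> n; have [] := measurable_interp n.+1 (n.+1 * n.+1) f.
  move=> x _; apply/cvgrPdist_le => e e0; have [n0 hn0] := cv x e e0.
  by exists n0 => // n /= /hn0; apply: le_trans; rewrite -ReN -ReD Re_nrm.
apply: (@measurable_fun_cvg _ _ _ _ (fun n x => complex.Im (interp n.+1 (n.+1 * n.+1) f x))).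
  by move=> n; have [] := measurable_interp n.+1 (n.+1 * n.+1) f.
move=> x _; apply/cvgrPdist_le => e e0; have [n0 hn0] := cv x e e0.
exists n0 => // n /= /hn0; apply: le_trans; apply: le_trans (Im_nrm _).
by rewrite ImD; case: (interp _ _ _ _).
Qed.

End measurability.

Section integrals.
Variables (R : realType) (d : nat).
Local Notation C := (CC R).
Local Notation X := 'rV[R]_d.
Local Notation lam := (lebesgue_rV R d).
Implicit Types (f g : X -> C) (A B : set X) (M r : R).

Lemma Re_natM (n : nat) (z : C) : complex.Re (n%:R * z) = n%:R * complex.Re z.
Proof. by rewrite -(rmorph_nat (real_complex R)); case: z => a b /=; rewrite mul0r subr0. Qed.

Lemma bounded_integrable (u : X -> R) A M : measurable A -> (lam A < +oo)%E ->
  measurable_fun setT u -> (forall x, `|u x| <= M) -> lam.-integrable A (EFin \o u).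
Proof.
move=> mA fA mu uM; apply: measurable_bounded_integrable => //.
  exact: measurable_funS mu.
exists M; split; first exact: num_real.
by move=> K MK x _ /=; exact: le_trans (uM x) (ltW MK).
Qed.

Lemma Re_integrable f A M : measurable A -> (lam A < +oo)%E -> uc f ->
  (forall x, nrm (f x) <= M) ->
  lam.-integrable A (EFin \o (fun x => complex.Re (f x))) /\
  lam.-integrable A (EFin \o (fun x => complex.Im (f x))).
Proof.
move=> mA fA uf fM; have [mR mI] := uc_measurable uf.
split; apply: (bounded_integrable (M := M)) => // x; apply: le_trans (fM x).
  exact: Re_nrm.
exact: Im_nrm.
Qed.

Lemma integral_rV_lin f g A M (c : C) : measurable A -> (lam A < +oo)%E -> uc f -> uc g ->
  (forall x, nrm (f x) <= M) -> (forall x, nrm (g x) <= M) ->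
  integral_rV A (fun x => c * f x + g x) = c * integral_rV A f + integral_rV A g.
Proof.
move=> mA fA uf ug fM gM.
have [fR fI] := Re_integrable mA fA uf fM; have [gR gI] := Re_integrable mA fA ug gM.
have lin (a b : R) (u v w : X -> R) : lam.-integrable A (EFin \o u) ->
    lam.-integrable A (EFin \o v) -> lam.-integrable A (EFin \o w) ->
    \int[lam]_(x in A) (a * u x + b * v x + w x) =
    a * \int[lam]_(x in A) u x + b * \int[lam]_(x in A) v x + \int[lam]_(x in A) w x.
  move=> iu iv iw.
  have iau : lam.-integrable A (EFin \o (fun x => a * u x)).
    exact: (integrableZl mA a iu).
  have ibv : lam.-integrable A (EFin \o (fun x => b * v x)).
    exact: (integrableZl mA b iv).
  have iab : lam.-integrable A (EFin \o (fun x => a * u x + b * v x)).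
    exact: (integrableD mA iau ibv).
  by rewrite RintegralD// RintegralD// !RintegralZl.
case: c => a b; rewrite /integral_rV.
have -> : \int[lam]_(x in A) complex.Re ((a +i* b)%C * f x + g x) =
   \int[lam]_(x in A) (a * complex.Re (f x) + (- b) * complex.Im (f x) + complex.Re (g x)).
  by apply: eq_Rintegral => x _; case: (f x) (g x) => u v [w z] /=; rewrite mulNr.
have -> : \int[lam]_(x in A) complex.Im ((a +i* b)%C * f x + g x) =
   \int[lam]_(x in A) (b * complex.Re (f x) + a * complex.Im (f x) + complex.Im (g x)).
  by apply: eq_Rintegral => x _; case: (f x) (g x) => u v [w z] /=; rewrite addrC [a * v + _]addrC addrC.
rewrite !lin//; apply/eqP; rewrite eq_complex /=; apply/andP; split; apply/eqP; ring.
Qed.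

Lemma Rintegral_bound (u : X -> R) A M : measurable A -> (lam A < +oo)%E ->
  measurable_fun setT u -> (forall x, A x -> `|u x| <= M) -> lam.-integrable A (EFin \o u) ->
  `|\int[lam]_(x in A) u x| <= M * fine (lam A).
Proof.
move=> mA fA mu uM iu; apply: le_trans (le_normr_Rintegral mA iu) _.
rewrite -Rintegral_cst//; apply: le_Rintegral => //.
  exact: integrable_norm.
by apply: (@bounded_integrable (fun=> M) A `|M|) => //; exact: measurable_cst.
Qed.

Lemma integral_rV_bound f A M N : measurable A -> (lam A < +oo)%E -> uc f ->
  (forall x, nrm (f x) <= N) -> (forall x, A x -> nrm (f x) <= M) ->
  nrm (integral_rV A f) <= 2 * M * fine (lam A).
Proof.
move=> mA fA uf fN fM; have [fR fI] := Re_integrable mA fA uf fN.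
have [mR mI] := uc_measurable uf.
apply: le_trans (nrm_ReIm _) _; rewrite /integral_rV /=.
have h1 := Rintegral_bound mA fA mR (fun x Ax => le_trans (Re_nrm _) (fM x Ax)) fR.
have h2 := Rintegral_bound mA fA mI (fun x Ax => le_trans (Im_nrm _) (fM x Ax)) fI.
lra.
Qed.

Lemma symdiff_bound (u : X -> R) A B M : measurable A -> measurable B ->
  (lam A < +oo)%E -> (lam B < +oo)%E ->
  measurable_fun setT u -> (forall x, `|u x| <= M) ->
  `|\int[lam]_(x in A) u x - \int[lam]_(x in B) u x| <= M * fine (lam (A `+` B)).
Proof.
move=> mA mB fA fB mu uM.
have fin_sub D E : measurable D -> measurable E -> D `<=` E -> (lam E < +oo)%E -> (lam D < +oo)%E.
  move=> mD mE DE; apply: le_lt_trans; apply: le_measure => //; exact/mem_set.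
have mAB := measurableD mA mB; have mBA := measurableD mB mA; have mI := measurableI _ _ mA mB.
have int D : measurable D -> (lam D < +oo)%E -> lam.-integrable D (EFin \o u).
  by move=> mD fD; exact: (bounded_integrable (M := M)).
have dj D E : [disjoint D `&` E & D `\` E].
  by apply/disj_setPS => x [[_ xE] [_ nxE]].
have split D E : measurable D -> measurable E -> (lam D < +oo)%E ->
    \int[lam]_(x in D) u x = \int[lam]_(x in D `&` E) u x + \int[lam]_(x in D `\` E) u x.
  move=> mD mE fD; rewrite -Rintegral_setU//.
  - by rewrite setUIDK.
  - exact: measurableI.
  - exact: measurableD.
  - by rewrite setUIDK; exact: int.
rewrite (split A B)// (split B A)// (setIC B A) opprD addrACA subrr add0r.
have fAB : (lam (A `\` B) < +oo)%E by exact: (fin_sub _ _ mAB mA (@subDsetl _ _ _)).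
have fBA : (lam (B `\` A) < +oo)%E by exact: (fin_sub _ _ mBA mB (@subDsetl _ _ _)).
apply: le_trans (ler_normB _ _) _.
have E : lam (A `+` B) = (lam (A `\` B) + lam (B `\` A))%E.
  rewrite /setY measureU//.
  by apply/seteqP; split => x // [[? ?] []].
rewrite E fineD ?ge0_fin_numE// mulrDr lerD//; apply: Rintegral_bound => //; exact: int.
Qed.

Lemma integral_rV_symdiff f A B M : measurable A -> measurable B ->
  (lam A < +oo)%E -> (lam B < +oo)%E -> uc f -> (forall x, nrm (f x) <= M) ->
  nrm (integral_rV A f - integral_rV B f) <= 2 * M * fine (lam (A `+` B)).
Proof.
move=> mA mB fA fB uf fM; have [mR mI] := uc_measurable uf.
apply: le_trans (nrm_ReIm _) _; rewrite /integral_rV /=.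
have h1 := symdiff_bound mA mB fA fB mR (fun x => le_trans (Re_nrm _) (fM x)).
have h2 := symdiff_bound mA mB fA fB mI (fun x => le_trans (Im_nrm _) (fM x)).
lra.
Qed.

Lemma translateE (t : X) A : translate t A = (fun x => x + - t) @^-1` A.
Proof.
apply/seteqP; split => x; first by move=> [a Aa <-]; rewrite /= addrAC subrr add0r.
by move=> h; exists (x - t) => //; rewrite addrC subrK.
Qed.

Lemma measurable_translate (t : X) A : measurable A -> measurable (translate t A).
Proof.
move=> mA; rewrite translateE -[X in measurable X]setTI.
exact: (measurable_rV_shift (- t)).
Qed.

Lemma lebesgue_translate (t : X) A : measurable A -> lam (translate t A) = lam A.
Proof. by move=> mA; rewrite translateE lebesgue_shift. Qed.

Lemma Rintegral_shift (u : X -> R) A M (t : X) : measurable A -> (lam A < +oo)%E ->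
  measurable_fun setT u -> (forall x, `|u x| <= M) ->
  \int[lam]_(x in A) u (x + t) = \int[lam]_(x in translate t A) u x.
Proof.
move=> mA fA mu uM; rewrite /Rintegral; congr fine.
have mt := measurable_rV_shift t.
have mD := measurable_translate t mA.
pose T : {mfun X >-> X} := HB.pack (fun x : X => x + t) (isMeasurableFun.Build _ _ _ _ _ mt).
have preT : T @^-1` translate t A = A.
  by rewrite translateE; apply/seteqP; split => x /=; rewrite addrK.
transitivity (\int[pushforward lam T]_(y in translate t A) (u y)%:E)%E; last first.
  by apply: eq_measure_integral => B mB _; apply: etrans (lebesgue_shift t mB).
rewrite integral_pushforward ?preT//; first exact/measurable_EFinP.
apply: (bounded_integrable (M := M)) => //; exact: measurableT_comp mu mt.
Qed.

Lemma integral_rV_shift f A M (t : X) : measurable A -> (lam A < +oo)%E -> uc f ->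
  (forall x, nrm (f x) <= M) ->
  integral_rV A (fun x => f (x + t)) = integral_rV (translate t A) f.
Proof.
move=> mA fA uf fM; have [mR mI] := uc_measurable uf.
rewrite /integral_rV; congr (_ +i* _)%C.
  exact: (Rintegral_shift t mA fA mR (fun x => le_trans (Re_nrm _) (fM x))).
exact: (Rintegral_shift t mA fA mI (fun x => le_trans (Im_nrm _) (fM x))).
Qed.

Lemma cube_fin r : (lam (cube d r) < +oo)%E.
Proof.
apply: (@le_lt_trans _ _ (lam (cube d (Num.max 0 r)))).
  apply: le_measure; rewrite ?inE; try exact: measurable_cube.
  by move=> x h i; apply: le_trans (h i) _; rewrite le_max lexx orbT.
by rewrite lebesgue_cube ?ltry// le_max lexx.
Qed.

Lemma integral_rV_cube f r : supp_in 0 r f -> integral_rV setT f = integral_rV (cube d r) f.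
Proof.
move=> sf; have h (u : C -> R) : u 0 = 0 ->
    \int[lam]_x u (f x) = \int[lam]_(x in cube d r) u (f x).
  move=> u0; rewrite [RHS]Rintegral_mkcond; apply: eq_Rintegral => x _.
  rewrite patchE; case: ifPn => //; rewrite notin_setE => /existsNP[i /negP].
  by rewrite -ltNge => hx; rewrite (sf x i) ?u0// mxE subr0.
by rewrite /integral_rV !h.
Qed.

Definition Int : (X -> C) -> C := integral_rV setT.

Lemma lin_Int : lin Int.
Proof.
move=> c f g cf cg; have [uf [r sf]] := cf; have [ug [s sg]] := cg.
have [M M0 fM] := cc_bounded cf; have [N N0 gN] := cc_bounded cg.
pose q := Num.max r s.
have sf' : supp_in 0 q f by apply: supp_inW sf; rewrite le_max lexx.
have sg' : supp_in 0 q g by apply: supp_inW sg; rewrite le_max lexx orbT.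
have sfg : supp_in 0 q (fun x => c * f x + g x).
  by move=> x i h; rewrite (sf' x i)// (sg' x i)// mulr0 addr0.
rewrite /Int !(@integral_rV_cube _ q)//.
apply: (integral_rV_lin (M := Num.max M N)) => //; first exact: measurable_cube.
- exact: cube_fin.
- by move=> x; rewrite le_max fM.
- by move=> x; rewrite le_max gN orbT.
Qed.

Lemma bdd_Int : bdd Int.
Proof.
move=> r; exists (2 * fine (lam (cube d r))); first by rewrite mulr_ge0// fine_ge0.
move=> f M cf sf fM; rewrite /Int (integral_rV_cube sf) mulrAC.
have [N N0 fN] := cc_bounded cf; case: cf => uf _.
apply: (@integral_rV_bound f _ M M) => //; try exact: measurable_cube.
exact: cube_fin.
Qed.

Lemma tinv_Int : tinv Int.
Proof.
move=> f t cf; have [uf [r sf]] := cf; have [M M0 fM] := cc_bounded cf.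
have [_ [s ss]] := cc_shift t cf.
pose q := Num.max (Num.max r s) 0 + \sum_i `|t 0 i|.
have t0 : 0 <= \sum_i `|t 0 i| by exact: sumr_ge0.
have rq : r <= q by rewrite /q -[leLHS]addr0 lerD// !le_max lexx.
have sq : s <= q by rewrite /q -[leLHS]addr0 lerD// !le_max lexx orbT.
rewrite /Int (integral_rV_cube (supp_inW sq ss)) (integral_rV_shift (M := M))//; last 2 first.
- exact: measurable_cube.
- exact: cube_fin.
have h (u : C -> R) : u 0 = 0 ->
    \int[lam]_(x in translate t (cube d q)) u (f x) = \int[lam]_x u (f x).
  move=> u0; rewrite [LHS]Rintegral_mkcond; apply: eq_Rintegral => x _.
  rewrite patchE; case: ifPn => //; rewrite notin_setE translateE => /existsNP[i /negP].
  rewrite -ltNge !mxE => hx; rewrite (sf x i) ?u0//.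
  have := ler_normD (x 0 i) (- t 0 i); rewrite normrN mxE subr0.
  have : `|t 0 i| <= \sum_i `|t 0 i| by rewrite (bigD1 i)//= lerDl sumr_ge0.
  have : r <= Num.max (Num.max r s) 0 by rewrite !le_max lexx.
  by move: hx; rewrite /q; lra.
by rewrite /integral_rV !h.
Qed.

Lemma Int_real (u : X -> R) : Int (fun x => rc (u x)) = rc (\int[lam]_x u x).
Proof.
by rewrite /Int /integral_rV /=; congr (_ +i* _)%C; rewrite Rintegral_cst// mul0r.
Qed.

Lemma Int_ge0 f : (forall x, 0 <= complex.Re (f x)) -> 0 <= complex.Re (Int f).
Proof. by move=> h; exact: Rintegral_ge0. Qed.

Lemma box_size N : size (box d N) = ((N + N).+1 ^ d)%N.
Proof. by rewrite size_map -cardE card_ffun !card_ord. Qed.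

Lemma supp_cut N : supp_in 0 (N%:R + 1) (fun x : X => rc (cutoff N x) : C).
Proof. by move=> x i; rewrite mxE subr0 => /ltW h; rewrite (cut0 h). Qed.

Lemma cc_cut N : cc (fun x : X => rc (cutoff N x) : C).
Proof. by split; [exact: uc_cut|exists (N%:R + 1); exact: supp_cut]. Qed.

Lemma Int_cut N : Int (fun x => rc (cutoff N x)) = ((N + N).+1 ^ d)%:R * Int (fun x => rc (tentV x)).
Proof.
have -> : (fun x : X => rc (cutoff N x) : C) = (fun x => \sum_(k <- box d N) rc (tentV (x - vec R k))).
  by apply/funext => x; rewrite /cutoff rmorph_sum.
have ct := cc_tentV R d.
rewrite (lin_sum _ lin_Int); last by move=> k; exact: (cc_shift (- vec R k) ct).
rewrite (eq_bigr (fun=> Int (fun x => rc (tentV x)))); last first.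
  by move=> k _; exact: (tinv_Int (- vec R k) ct).
by rewrite big_const_seq count_predT iter_addr_0 box_size -[LHS]mulr_natl.
Qed.

(** The cutoff at [N] is the sum of [(2 N + 1)^d] translated tents, and its
    integral lies between the volumes of the cubes of half-sides [N] and [N + 1];
    so the integral of a tent is the limit of a ratio that tends to [1]. *)
Lemma Int_tentV : Int (fun x => rc (tentV x)) = 1.
Proof.
rewrite Int_real; set t := \int[lam]_x _.
have bounds N : (2 * N%:R) ^+ d <= (2 * N%:R + 1) ^+ d * t <= (2 * (N%:R + 1)) ^+ d.
  have : rc (\int[lam]_x cutoff N x) = ((N + N).+1 ^ d)%:R * rc t :> C.
    by rewrite -Int_real Int_cut Int_real.
  move=> /(congr1 (@complex.Re R)); rewrite Re_natM /=.
  have -> : ((N + N).+1 ^ d)%:R = (2 * N%:R + 1) ^+ d :> R.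
    by rewrite natrX -addn1 natrD natrD; congr (_ ^+ d); lra.
  move=> <-.
  have [mR _] := uc_measurable (@uc_cut R d N).
  have E : \int[lam]_x cutoff N x = \int[lam]_(x in cube d (N%:R + 1)) cutoff N x.
    have := integral_rV_cube (@supp_cut N).
    by move=> /(congr1 (@complex.Re R)).
  have int A : measurable A -> (lam A < +oo)%E -> lam.-integrable A (EFin \o cutoff N).
    move=> mA fA; apply: (@bounded_integrable (cutoff N) A 1) => // x.
    by rewrite ger0_norm ?cut_ge0// cut_le1.
  have m1 : measurable (cube d (N%:R + 1 : R)) by exact: measurable_cube.
  have mN : measurable (cube d (N%:R : R)) by exact: measurable_cube.
  have N0 : 0 <= N%:R :> R := ler0n _ _.
  have fc (r : R) : 0 <= r -> fine (lam (cube d r)) = (2 * r) ^+ d.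
    by move=> r0; rewrite lebesgue_cube.
  rewrite E; apply/andP; split; last first.
    rewrite -[leRHS]fc; last by lra.
    rewrite -[leRHS]mul1r -Rintegral_cst//; apply: le_Rintegral => //.
    - by apply: int => //; exact: cube_fin.
    - by apply: (@bounded_integrable (fun=> 1) _ 1) => //; [exact: cube_fin|move=> x; rewrite normr1].
    - by move=> x _; exact: cut_le1.
  rewrite -fc// -[leLHS]mul1r -Rintegral_cst//.
  have -> : \int[lam]_(x in cube d N%:R) (1 : R) = \int[lam]_(x in cube d N%:R) cutoff N x.
    by apply: eq_Rintegral => x /set_mem h; rewrite cut1.
  have sub : cube d (N%:R : R) `<=` cube d (N%:R + 1).
    by move=> x h i; apply: le_trans (h i) _; lra.
  rewrite -(setDUK sub) Rintegral_setU//.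
  - by rewrite lerDl; apply: Rintegral_ge0 => x _; exact: cut_ge0.
  - exact: measurableD.
  - by rewrite setDUK//; apply: int => //; exact: cube_fin.
  - by apply/disj_setPS => x [? []].
have bern (a : R) (n : nat) : 0 <= a -> a <= 1 -> 1 - n%:R * a <= (1 - a) ^+ n.
  move=> a0 a1; elim: n => [|n IH]; first by rewrite mul0r subr0 expr0.
  rewrite exprS -[n.+1%:R]natr1.
  have : (1 - a) * (1 - n%:R * a) <= (1 - a) * (1 - a) ^+ n by rewrite ler_wpM2l//; lra.
  have : 0 <= n%:R * a * a by rewrite !mulr_ge0.
  lra.
have small (e : R) : 0 < e -> exists N : nat, d%:R / (2 * N%:R + 1) <= e.
  move=> e0; exists (Num.truncn (d%:R / e)).+1.
  have h : d%:R / e < (Num.truncn (d%:R / e)).+1%:R by exact: truncnS_gt.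
  rewrite ler_pdivrMr; last by rewrite ltr_wpDl// mulr_ge0.
  move: h; rewrite ltr_pdivrMr// => h.
  have n0 : 0 <= (Num.truncn (d%:R / e)).+1%:R :> R := ler0n _ _.
  rewrite mulrC in h; nra.
have t1 : 1 <= t.
  apply/ler_addgt0Pr => e e0; have [N hN] := small e e0; have /andP[h _] := bounds N.
  have p0 : 0 < 2 * N%:R + 1 :> R by rewrite ltr_wpDl// mulr_ge0.
  have : (2 * N%:R / (2 * N%:R + 1)) ^+ d <= t.
    by rewrite expr_div_n ler_pdivrMr ?exprn_gt0// [t * _]mulrC.
  have -> : 2 * N%:R / (2 * N%:R + 1) = 1 - (2 * N%:R + 1)^-1 :> R.
    by field; rewrite gt_eqF.
  have := bern (2 * N%:R + 1)^-1 d; rewrite invr_ge0 (ltW p0) => /(_ isT).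
  rewrite invf_le1// => /(_ _).
  have n0 : 0 <= N%:R :> R := ler0n _ _.
  by move=> /(_ ltac:(lra)); lra.
have t2 : t <= 1.
  apply/ler_addgt0Pr => e e0.
  pose e' := e / (1 + e).
  have e'0 : 0 < e' by apply: divr_gt0 => //; lra.
  have [N hN] := small e' e'0; have /andP[_ h] := bounds N.
  have n0 : 0 <= N%:R :> R := ler0n _ _.
  have p0 : 0 < 2 * N%:R + 1 :> R by lra.
  have q0 : 0 < 2 * (N%:R + 1) :> R by lra.
  have : ((2 * N%:R + 1) / (2 * (N%:R + 1))) ^+ d * t <= 1.
    by rewrite expr_div_n mulrAC ler_pdivrMr ?exprn_gt0// mul1r.
  have -> : (2 * N%:R + 1) / (2 * (N%:R + 1)) = 1 - (2 * (N%:R + 1))^-1 :> R.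
    by field; rewrite gt_eqF//; lra.
  have := bern (2 * (N%:R + 1))^-1 d; rewrite invr_ge0 (ltW q0) => /(_ isT).
  rewrite invf_le1// => /(_ ltac:(lra)) b1 b2.
  have b3 : d%:R / (2 * (N%:R + 1)) <= e'.
    apply: le_trans hN; rewrite ler_wpM2l// lef_pV2 ?posrE//; lra.
  have b4 : (1 - e') * t <= 1.
    by apply: le_trans b2; rewrite ler_wpM2r//; lra.
  have b5 : e' * (1 + e) = e by rewrite divfK//; lra.
  have b6 : (1 - e') * (1 + e) = 1 by lra.
  have b7 : 0 < 1 - e' by rewrite /e' subr_gt0 ltr_pdivrMr; lra.
  by rewrite -(ler_pM2l b7) b6.
by congr (rc _); apply/eqP; rewrite eq_le t2.
Qed.

End integrals.

(** * The topology of row vectors, in coordinates *)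

Section topology.
Variables (R : realType) (d : nat).
Local Notation C := (CC R).
Local Notation X := 'rV[R]_d.
Implicit Types (f : X -> C) (x y h : X) (r : R).

Lemma coord_norm x i : `|x 0 i| <= `|x|.
Proof.
rewrite {2}/Num.norm /= mx_normrE.
exact: (le_trans _ (le_bigmax _ (fun ij => `|x ij.1 ij.2|) (0, i))).
Qed.

Lemma norm_coord x r : 0 < r -> (forall i, `|x 0 i| < r) -> `|x| < r.
Proof.
move=> r0 h; rewrite /Num.norm /= mx_normrE; apply/bigmax_ltP; split=> // -[i j] _ /=.
by rewrite ord1.
Qed.

Lemma cube_compact r : compact (cube d r).
Proof.
have := @rV_compact R d (fun=> `[- r, r]%classic) (fun=> @segment_compact R (- r) r).
rewrite (_ : [set v | _] = cube d r)//.
by apply/seteqP; split => x h i; have := h i; rewrite /= in_itv /= -ler_norml.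
Qed.

Lemma compact_in_cube (K : set X) : compact K -> exists2 r, 0 <= r & K `<=` cube d r.
Proof.
move=> /compact_bounded [M [_ hM]]; exists (`|M| + 1); first by rewrite addr_ge0.
move=> x Kx i; have := hM (`|M| + 1).
rewrite (le_lt_trans (ler_norm M)) ?ltrDl// => /(_ isT x Kx) /=.
exact: le_trans (coord_norm x i).
Qed.

Lemma rc_le (a b : R) : (rc a <= rc b :> C) = (a <= b). Proof. exact: lecR. Qed.
Lemma rc_lt (a b : R) : (rc a < rc b :> C) = (a < b). Proof. exact: ltcR. Qed.
Lemma rc_lt0 (a : R) : (0 < rc a :> C) = (0 < a). Proof. exact: ltcR. Qed.
Lemma pos_rc (e : C) : 0 < e -> exists2 a : R, 0 < a & e = rc a.
Proof.
case: e => a b; rewrite /Order.lt /= => /andP[/eqP -> a0]; exists a => //.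
Qed.

Lemma uc_continuous f : uc f -> continuous f.
Proof.
move=> uf x; have FF := nbhs_filter x.
apply/(@cvgrPdist_le _ _ _ _ FF) => e /pos_rc[a a0 ->].
have [dl dl0 hd] := uf a a0.
near=> y; rewrite nrmE rc_le nrmC (_ : f y = f (x + (y - x))); last by rewrite [x + _]addrC subrK.
apply: hd => i.
apply: le_lt_trans (coord_norm _ i) _; rewrite distrC; near: y.
exact: cvgr_dist_lt.
Unshelve. all: by end_near. Qed.

(** Heine's theorem on the cube that contains the support. *)
Lemma continuous_uc f r : continuous f -> supp_in 0 r f -> uc f.
Proof.
move=> cf sf e e0.
pose P (dl : R) x := forall h, (forall i, `|h 0 i| < dl) -> nrm (f (x + h) - f x) <= e.
have /compact_near_coveringP/(_ R (0^'+) P) hK := @cube_compact (r + 1).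
have loc x : cube d (r + 1) x -> \forall x' \near x & dl \near 0^'+, P dl x'.
  move=> _; have /cvgrPdist_le/(_ (rc (e / 2))) := cf x.
  rewrite rc_lt0 => /(_ (divr_gt0 e0 (ltr0Sn _ _)))/nbhs_ballP[rho rho0 hrho].
  have hr y : `|x - y| < rho -> nrm (f y - f x) <= e / 2.
    by move=> xy; have := hrho y; rewrite -ball_normE /= => /(_ xy); rewrite nrmE rc_le nrmC.
  exists (ball x (rho / 2), [set dl | dl < rho / 2]); first split => /=.
  - by apply: nbhsx_ballx; rewrite divr_gt0.
  - by apply: nbhs_right_lt; rewrite divr_gt0.
  move=> [y dl] /= [xy dlr] h hh; move: xy; rewrite -ball_normE /= => xy.
  have h1 : nrm (f y - f x) <= e / 2 by apply: hr; apply: lt_le_trans xy _; move: rho0 => /=; lra.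
  have h2 : nrm (f (y + h) - f x) <= e / 2.
    apply: hr; rewrite opprD addrA; apply: le_lt_trans (ler_normB _ _) _.
    have : `|h| < rho / 2.
      by apply: norm_coord => [|i]; [rewrite divr_gt0|exact: lt_trans (hh i) dlr].
    lra.
  by have := nrm_tri (f (y + h)) (f x) (f y); rewrite (nrmC (f x)); lra.
have {hK loc}hK := hK _ loc.
have : \forall dl \near 0^'+, 0 < dl /\ dl <= 1 /\ cube d (r + 1) `<=` P dl.
  near=> dl; split; first by near: dl; exact: nbhs_right_gt.
  split; first by near: dl; apply: nbhs_right_le.
  by near: dl; exact: hK.
move=> /filter_ex[dl [dl0 [dl1 hdl]]]; exists dl => // x h hh.
have [xc|/existsNP[i /negP]] := pselect (cube d (r + 1) x); first exact: hdl.
rewrite -ltNge => xi; rewrite (sf x i) ?(sf (x + h) i) ?subrr ?nrm0 ?ltW//; rewrite !mxE subr0.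
  by have := ler_normD (x 0 i + h 0 i) (- h 0 i); rewrite addrK normrN; have := hh i; lra.
by lra.
Unshelve. all: by end_near. Qed.

Lemma supp_sub f r : supp_in 0 r f -> supp f `<=` cube d r.
Proof.
move=> sf; rewrite /supp.
have -> : cube d r = closure (cube d r).
  apply/closure_id; apply: (compact_closed (@norm_hausdorff R 'rV[R]_d)).
  exact: cube_compact.
apply: closure_subset => x /= fx i; rewrite leNgt; apply: contra fx => hx.
by apply/eqP/(sf x i); rewrite mxE subr0.
Qed.

Lemma sub_supp f r : supp f `<=` cube d r -> supp_in 0 r f.
Proof.
move=> sf x i; rewrite mxE subr0 => hx; apply/eqP; apply: contraT => fx.
have sx : supp f x by exact: subset_closure.
by have := sf x sx i; rewrite leNgt hx.
Qed.

Lemma Cc_cc f : Cc f -> cc f.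
Proof.
move=> [cf /compact_in_cube[r r0 sr]]; have sf := sub_supp sr.
by split; [exact: continuous_uc cf sf|exists r].
Qed.

Lemma cc_Cc f : cc f -> Cc f.
Proof.
move=> [uf [r sf]]; split; first exact: uc_continuous.
apply: (@subclosed_compact _ _ (cube d r)); [exact: closed_closure|exact: cube_compact|exact: supp_sub].
Qed.

Lemma sup_norm_ub f M x : (forall x, nrm (f x) <= M) -> nrm (f x) <= sup_norm f.
Proof.
move=> fM; apply: ub_le_sup; last by exists x.
by exists M => _ [y _ <-].
Qed.

Lemma sup_norm_le f M : (forall x, nrm (f x) <= M) -> sup_norm f <= M.
Proof.
move=> fM; apply: ge_sup; first by exists (nrm (f 0)), 0.
by move=> _ [y _ <-].
Qed.

Lemma cc_sup_norm f : cc f -> forall x, nrm (f x) <= sup_norm f.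
Proof. by move=> /cc_bounded[M _ fM] x; exact: sup_norm_ub fM. Qed.

Lemma sup_norm_ge0 f : cc f -> 0 <= sup_norm f.
Proof. by move=> cf; apply: le_trans (nrm_ge0 (f 0)) _; exact: cc_sup_norm. Qed.

Lemma uniform_ball (g : {uniform X -> C}) (e : R) : 0 < e ->
  nbhs g [set h : {uniform X -> C} | forall x, nrm (g x - h x) < e].
Proof.
move=> e0; apply/uniform_nbhs.
exists [set xy : C * C | ball xy.1 (rc e : C) xy.2]; split.
  by rewrite -entourage_ballE; exists (rc e : C); rewrite /= ?rc_lt0.
by move=> h hh x; have := hh x I; rewrite /= -ball_normE /= nrmE rc_lt.
Qed.

(** Compactness of the closed orbit extracts a finite net of translates. *)
Lemma strongly_ap_fun_ap f : strongly_ap_fun f -> ap f.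
Proof.
move=> [_ K] e e0.
pose S : set {uniform X -> C} := [set (fun x => f (x - t)) | t in setT].
pose E (t : X) : set {uniform X -> C} := [set g | forall x, nrm (f (x - t) - g x) < e / 2].
have E40 : 0 < e / 4 by rewrite divr_gt0.
(* the finite sequences of translations, directed by inclusion *)
pose F := filter_from [set: seq X] (fun s0 => [set s : seq X | {subset s0 <= s}]).
have FF : Filter F.
  apply: filter_from_filter; first by exists [::].
  move=> s1 s2 _ _; exists (s1 ++ s2) => // s hs.
  by split=> x xs; apply: hs; rewrite mem_cat xs ?orbT.
pose P (s : seq X) (g : {uniform X -> C}) := exists2 t, t \in s & E t g.
have /compact_near_coveringP/(_ (seq X) F P FF) : compact (closure S) := K.
have loc g : closure S g -> \forall g' \near g & s \near F, P s g'.
  move=> Sg; have [h [[t _ <-] ht]] := Sg _ (uniform_ball g E40).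
  exists ([set h : {uniform X -> C} | forall x, nrm (g x - h x) < e / 4],
          [set s : seq X | {subset [:: t] <= s}]).
    by split => /=; [exact: uniform_ball|exists [:: t]].
  move=> [h' s] /= [hh hs]; exists t; first by apply: hs; rewrite inE.
  move=> x.
  by have := nrm_tri (f (x - t)) (g x) (h' x); have := ht x; have := hh x; rewrite (nrmC (g x) (f _)); lra.
move=> /(_ loc)[D _ hD].
exists [seq - t | t <- D] => t.
have [t' Dt' ht'] : P D (fun x => f (x - - t)).
  by apply: (hD D) => //; apply: subset_closure; exists (- t).
exists (- t'); first exact: map_f.
move=> x; rewrite nrmC; apply: ltW; have := ht' x; rewrite opprK; lra.
Qed.

End topology.

(** * Means along Folner sequences *)

Section folner_means.
Variables (R : realType) (d : nat).
Local Notation C := (CC R).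
Local Notation X := 'rV[R]_d.
Local Notation lam := (lebesgue_rV R d).
Implicit Types (f : X -> C) (x y t : X) (A : set X) (M : R).

Lemma integral_rV_cst A (c : C) : measurable A ->
  integral_rV A (fun=> c) = c * rc (fine (lam A)).
Proof.
move=> mA; rewrite /integral_rV !Rintegral_cst//.
by case: c => a b /=; apply/eqP; rewrite eq_complex /= !mulr0 subr0 add0r !eqxx.
Qed.

(** Translating [f] amounts to translating the domain of integration. *)
Lemma integral_rV_avg f A M p : measurable A -> (lam A < +oo)%E -> uc f ->
  (forall x, nrm (f x) <= M) -> p != [::] ->
  nrm (integral_rV A (avg id p f) - integral_rV A f) <=
  2 * M * \sum_(t <- p) fine (lam (A `+` translate t A)).
Proof.
move=> mA fA uf fM p0.
have M0 : 0 <= M := le_trans (nrm_ge0 _) (fM 0).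
have D t : nrm (integral_rV A (fun x => f (x + t)) - integral_rV A f) <=
    2 * M * fine (lam (A `+` translate t A)).
  rewrite (integral_rV_shift t mA fA uf fM) nrmC.
  apply: integral_rV_symdiff => //; first exact: measurable_translate.
  by rewrite lebesgue_translate.
have lin0 c g h : uc g -> uc h -> (exists N, forall x, nrm (g x) <= N) ->
   (exists N, forall x, nrm (h x) <= N) ->
   integral_rV A (fun x => c * g x + h x) = c * integral_rV A g + integral_rV A h.
  move=> ug uh [N1 h1] [N2 h2]; apply: (@integral_rV_lin _ _ _ _ _ (Num.max N1 N2)) => // x.
    by apply: le_trans (h1 x) _; rewrite le_max lexx.
  by apply: le_trans (h2 x) _; rewrite le_max lexx orbT.
have I0 : integral_rV A (fun=> 0 : C) = 0 by rewrite integral_rV_cst// mul0r.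
have bs (s : seq X) : exists N, forall x, nrm (\sum_(t <- s) f (x + t)) <= N.
  exists (\sum_(t <- s) M) => x; apply: le_trans (nrm_sum _ _ _) _.
  by apply: ler_sum => t _.
have us (s : seq X) : uc (fun x => \sum_(t <- s) f (x + t)).
  by apply: uc_sum => t; exact: uc_shift.
have S (s : seq X) : integral_rV A (fun x => \sum_(t <- s) f (x + t)) =
    \sum_(t <- s) integral_rV A (fun x => f (x + t)).
  elim: s => [|t s IH]; first by under eq_fun do rewrite big_nil; rewrite big_nil.
  under eq_fun do rewrite big_cons -[f _]mul1r.
  rewrite big_cons lin0 ?mul1r ?IH//; first exact: uc_shift.
  by exists M.
have -> : integral_rV A (avg id p f) = (size p)%:R^-1 * \sum_(t <- p) integral_rV A (fun x => f (x + t)).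
  have b0 : exists N, forall x : X, nrm (0 : C) <= N by exists 0 => x; rewrite nrm0.
  have := lin0 (size p)%:R^-1 _ (fun=> 0) (us p) (uc_cst d 0) (bs p) b0.
  by rewrite I0 addr0 S => <-; congr integral_rV; apply/funext => x; rewrite addr0.
have -> : integral_rV A f = (size p)%:R^-1 * \sum_(t <- p) integral_rV A f.
  by rewrite big_const_seq count_predT iter_addr_0 -[integral_rV A f *+ _]mulr_natl mulKf// size_neq0.
rewrite -mulrBr -sumrB nrmM nrmV nrm_nat; apply: le_trans (_ : 1 * _ <= _).
  apply: ler_wpM2r; first exact: nrm_ge0.
  by rewrite invf_le1 ?ler1n ?ltr0n ?lt0n ?size_eq0.
rewrite mul1r mulr_sumr; apply: le_trans (nrm_sum _ _ _) _.
by apply: ler_sum => t _; exact: D.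
Qed.

(** On a Folner set averaging [f] over finitely many translates hardly changes
    the integral, but makes [f] uniformly close to its mean. *)
Theorem has_mean_ap f : ap f -> uc f -> has_mean f (Mean f).
Proof.
move=> af uf A [hA hF]; have [M M0 fM] := ap_bounded af.
have mA n : measurable (A n) by have [] := hA n.
have fA n : (lam (A n) < +oo)%E.
  have [_ /compact_in_cube[r _ h] _] := hA n.
  apply: le_lt_trans (cube_fin d r); apply: le_measure; rewrite ?inE//.
    exact: measurable_cube.
  exact: subset_trans (@subset_closure _ _) h.
pose l n := fine (lam (A n)).
have l0 n : 0 < l n by rewrite fine_gt0// fA andbT; have [] := hA n.
apply/(@cvgrPdist_le _ _ _ _ eventually_filter) => e /pos_rc[a a0 ->].
have [p p0 hp] := (MeanP af).2 (a / 4) (divr_gt0 a0 (ltr0Sn _ _)).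
pose D n := \sum_(t <- p) (fine (lam (A n `+` translate t (A n))) / l n).
have D0 : D @ \oo --> (0 : R).
  rewrite /D; elim: p {p0 hp D} => [|t p IH].
    by under eq_fun do rewrite big_nil; exact: cvg_cst.
  under eq_fun do rewrite big_cons.
  by have := cvgD (hF t) IH; rewrite addr0; apply.
have e0 : 0 < a / (4 * (M + 1)) by rewrite divr_gt0// mulr_gt0// ltr_wpDl.
move/cvgrPdist_le : D0 => /(_ _ e0) hD.
near=> n.
have Dn : D n <= a / (4 * (M + 1)).
  have : `|0 - D n| <= a / (4 * (M + 1)) by near: n; exact: hD.
  by rewrite sub0r normrN; apply: le_trans; exact: ler_norm.
rewrite nrmE rc_le nrmC.
have E : integral_rV (A n) f / rc (l n) - Mean f =
    (integral_rV (A n) f - Mean f * rc (l n)) / rc (l n).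
  have l1 : rc (l n) != 0 :> C by rewrite gt_eqF// rc_lt0.
  by rewrite mulrBl mulfK.
rewrite E nrmM nrmV nrm_real (gtr0_norm (l0 n)) ler_pdivrMr//.
have h1 := integral_rV_avg (mA n) (fA n) uf fM p0.
have h2 : nrm (integral_rV (A n) (avg id p f) - Mean f * rc (l n)) <= a / 2 * l n.
  rewrite -integral_rV_cst//.
  have ua : uc (avg id p f).
    apply: (@uc_mul _ _ (fun=> (size p)%:R^-1) _ (Num.max (nrm ((size p)%:R^-1 : C)) (\sum_(t <- p) M))).
    - by move=> x; rewrite le_max lexx.
    - move=> x; rewrite le_max; apply/orP; right; apply: le_trans (nrm_sum _ _ _) _.
      by apply: ler_sum => t _.
    - exact: uc_cst.
    by apply: uc_sum => t; exact: uc_shift.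
  have ab : forall x, nrm (avg id p f x) <= a / 4 + nrm (Mean f).
    by move=> x; have := nrm_tri (avg id p f x) (Mean f) 0; rewrite !subr0; have := hp x; lra.
  have -> : integral_rV (A n) (avg id p f) - integral_rV (A n) (fun=> Mean f) =
      integral_rV (A n) (fun x => (-1) * Mean f + avg id p f x).
    rewrite (@integral_rV_lin _ _ (fun=> Mean f) _ _ (a / 4 + nrm (Mean f)))//.
    - by rewrite mulN1r addrC.
    - exact: uc_cst.
    by move=> x; rewrite lerDr; lra.
  have -> : a / 2 * l n = 2 * (a / 4) * l n by field.
  apply: (@integral_rV_bound _ _ _ _ _ (a / 4)) => //.
  - by apply: uc_add => //; exact: uc_cst.
  - by move=> x; rewrite mulN1r addrC; exact: hp.
  by move=> x _; rewrite mulN1r addrC; exact: hp.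
have h3 : \sum_(t <- p) fine (lam (A n `+` translate t (A n))) = D n * l n.
  by rewrite /D mulr_suml; apply: eq_bigr => t _; rewrite divfK// gt_eqF.
rewrite h3 in h1.
have h4 : 2 * M * (D n * l n) <= a / 2 * l n.
  rewrite mulrA ler_pM2r//; apply: le_trans (_ : 2 * M * (a / (4 * (M + 1))) <= _).
    by rewrite ler_wpM2l// mulr_ge0.
  have -> : 2 * M * (a / (4 * (M + 1))) = a / 2 * (M / (M + 1)).
    by field; rewrite gt_eqF// ltr_wpDl.
  rewrite ler_piMr//; first by rewrite divr_ge0// ltW.
  by rewrite ler_pdivrMr ?ltr_wpDl// mul1r lerDl.
by have := nrm_tri (integral_rV (A n) f) (integral_rV (A n) (avg id p f)) (Mean f * rc (l n));
  rewrite (nrmC _ (integral_rV (A n) (avg id p f))); lra.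
Unshelve. all: by end_near. Qed.

End folner_means.

Section folner_cubes.
Variables (R : realType) (d : nat).
Local Notation C := (CC R).
Local Notation X := 'rV[R]_d.
Local Notation lam := (lebesgue_rV R d).

(** The difference lies in a shell of width [2 m]. *)
Lemma cube_symdiff (r m : R) (x : X) : 0 <= m -> m <= r -> cube d m x ->
  fine (lam (cube d r `+` translate x (cube d r))) <= (2 * (r + m)) ^+ d - (2 * (r - m)) ^+ d.
Proof.
move=> m0 mr hx.
have S : cube d r `+` translate x (cube d r) `<=` cube d (r + m) `\` cube d (r - m).
  rewrite setY_def => y [[yr hy]|[[a ar <-] hy]]; split.
  - by move=> i; have := yr i; lra.
  - move=> yc; apply: hy; exists (y - x); last by rewrite addrC subrK.
    by move=> i; have := yc i; have := hx i; rewrite !mxE; have := ler_normB (y 0 i) (x 0 i); lra.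
  - by move=> i; rewrite !mxE; have := ar i; have := hx i; have := ler_normD (x 0 i) (a 0 i); lra.
  - by move=> xa; case: hy => i; have := xa i; lra.
have r0 : 0 <= r := le_trans m0 mr.
have mc s : measurable (cube d s) by exact: measurable_cube.
have -> : (2 * (r + m)) ^+ d - (2 * (r - m)) ^+ d = fine (lam (cube d (r + m) `\` cube d (r - m))).
  have -> : (lam (cube d (r + m) `\` cube d (r - m)) =
      lam (cube d (r + m)) - lam (cube d (r + m) `&` cube d (r - m)))%E.
    by apply: measureD; first [exact: mc|exact: cube_fin].
  rewrite (_ : cube d (r + m) `&` cube d (r - m) = cube d (r - m)); last first.
    by apply: setIidr => y h i; have := h i; lra.
  by rewrite !lebesgue_cube ?subr_ge0// ?addr_ge0.
have mY : measurable (cube d r `+` translate x (cube d r)).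
  have mt : measurable (translate x (cube d r)) by apply: measurable_translate; exact: mc.
  by rewrite setY_def; apply: measurableU; apply: measurableD => //; exact: mc.
have mD : measurable (cube d (r + m) `\` cube d (r - m)) by apply: measurableD; exact: mc.
have fD : (lam (cube d (r + m) `\` cube d (r - m)) < +oo)%E.
  by apply: le_lt_trans (cube_fin d (r + m)); apply: le_measure; rewrite ?inE; [exact: mD|exact: mc|exact: subDsetl].
have le : (lam (cube d r `+` translate x (cube d r)) <= lam (cube d (r + m) `\` cube d (r - m)))%E.
  by apply: le_measure; rewrite ?inE; [exact: mY|exact: mD|exact: S].
apply: fine_le; last exact: le.
  by rewrite ge0_fin_numE ?measure_ge0//; exact: le_lt_trans fD.
by rewrite ge0_fin_numE ?measure_ge0.
Qed.

Lemma folner_cubes : folner (fun n => cube d (n.+1%:R : R)).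
Proof.
have l (r : R) : 0 <= r -> fine (lam (cube d r)) = (2 * r) ^+ d by move=> r0; rewrite lebesgue_cube.
split=> [n|x].
  split; first exact: measurable_cube.
    apply: (@subclosed_compact _ _ (cube d n.+1%:R)); [exact: closed_closure|exact: cube_compact|].
    rewrite -(closure_id _).1//; apply: (compact_closed (@norm_hausdorff R 'rV[R]_d)).
    exact: cube_compact.
  by rewrite lebesgue_cube// lte_fin exprn_gt0// mulr_gt0.
pose m : R := \sum_i `|x 0 i|.
have m0 : 0 <= m by apply: sumr_ge0.
have xm : cube d m x by move=> i; rewrite /m (bigD1 i)//= lerDl sumr_ge0.
pose q (n : nat) : R := m * n.+1%:R^-1.
have q0 : q @ \oo --> (0 : R).
  by have := cvgM (cvg_cst m) (@cvg_harmonic R); rewrite mulr0; apply.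
have pq (k : nat) (c : R) : (fun n => (1 + c * q n) ^+ k) @ \oo --> (1 : R).
  have h : (fun n => 1 + c * q n) @ \oo --> (1 : R).
    by have := cvgD (cvg_cst (1 : R)) (cvgM (cvg_cst c) q0); rewrite mulr0 addr0; apply.
  elim: k => [|k IH]; first by under eq_fun do rewrite expr0; exact: cvg_cst.
  by under eq_fun do rewrite exprS; have := cvgM h IH; rewrite mulr1; apply.
have lim0 : (fun n => (1 + 1 * q n) ^+ d - (1 + - 1 * q n) ^+ d) @ \oo --> (0 : R).
  by have := cvgB (pq d 1) (pq d (- 1)); rewrite subrr; apply.
apply: (squeeze_cvgr _ (cvg_cst (0 : R)) lim0).
near=> n.
have n0 : 0 < n.+1%:R :> R by [].
rewrite divr_ge0 ?fine_ge0//= l// ler_pdivrMr ?exprn_gt0 ?mulr_gt0//.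
have mn : m <= n.+1%:R.
  near: n; exists (Num.truncn m).+1 => // k /= hk.
  apply: (le_trans (ltW (truncnS_gt m))); rewrite ler_nat; exact: leq_trans hk _.
apply: le_trans (cube_symdiff m0 mn xm) _.
rewrite mulrBl -!exprMn.
have -> : (1 + 1 * q n) * (2 * n.+1%:R) = 2 * (n.+1%:R + m) by rewrite /q; field; rewrite gt_eqF.
by have -> : (1 + - 1 * q n) * (2 * n.+1%:R) = 2 * (n.+1%:R - m) by rewrite /q; field; rewrite gt_eqF.
Unshelve. all: by end_near. Qed.

Lemma has_mean_uniq (f : X -> C) m m' : has_mean f m -> has_mean f m' -> m = m'.
Proof.
move=> /(_ _ folner_cubes) h /(_ _ folner_cubes) h'.
exact: (cvg_unique (@norm_hausdorff _ _) h h').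
Qed.

End folner_cubes.

(** * Translation bounded functionals *)

Section translation_bounded.
Variables (R : realType) (d : nat).
Local Notation C := (CC R).
Local Notation X := 'rV[R]_d.
Local Notation K := {ffun 'I_d -> int}.
Local Notation vec := (vec R).
Implicit Types (f g h G : X -> C) (x y a t : X) (L : (X -> C) -> C) (k : K) (N : nat) (M B r e : R).

(** Translation boundedness, tested on functions of small support: the form in
    which a measure is used throughout. *)
Definition tbf L B := lin L /\
  forall a g M, cc g -> supp_in a 1 g -> (forall x, nrm (g x) <= M) -> nrm (L g) <= B * M.

Lemma tbf_lin L B : tbf L B -> lin L. Proof. by case. Qed.

Lemma uc_tentVs (b : X) : uc (fun x => rc (tentV (x - b)) : C).
Proof. exact: (@uc_shift R d _ (- b) (@uc_tentV R d)). Qed.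

Lemma tentV_nrm x : nrm (rc (tentV x) : C) <= 1.
Proof. by rewrite nrm_real ger0_norm ?tentV_ge0 ?tentV_le1. Qed.

Lemma cc_cell g (b : X) : cc g -> cc (fun x => g x * rc (tentV (x - b))).
Proof.
move=> cg; apply: (@cc_mul _ _ _ _ 1) => //; first exact: uc_tentVs.
by move=> x; exact: tentV_nrm.
Qed.

Lemma supp_cell g (b : X) : supp_in b 1 (fun x => g x * rc (tentV (x - b))).
Proof. by move=> x i h; rewrite (@tentV_out _ _ _ i) ?mulr0// !mxE ltW. Qed.

Lemma partition_cells g a N r x : supp_in a r g -> r <= N%:R ->
  g x = \sum_(k <- box d N) g x * rc (tentV (x - (a + vec k))).
Proof.
move=> sg rN; rewrite -mulr_sumr -rmorph_sum.
under eq_bigr do rewrite opprD addrA.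
rewrite -/(cutoff N (x - a)).
have [h|/existsNP[i /negP]] := pselect (forall i, `|(x - a) 0 i| <= N%:R).
  by rewrite cut1// mulr1.
by rewrite -ltNge !mxE => h; rewrite (sg x i) ?mul0r// (le_lt_trans rN).
Qed.

(** The partition of unity cuts [g] into pieces supported in the cells, each
    controlled by a bound [w k] for [g] there. *)
Lemma tbf_cells L B g a N r (w : K -> R) : tbf L B -> cc g -> supp_in a r g -> r <= N%:R ->
  (forall k x, k \in box d N -> (forall i, `|x 0 i - (k i)%:~R| <= 1) -> nrm (g (a + x)) <= w k) ->
  nrm (L g) <= B * \sum_(k <- box d N) w k.
Proof.
move=> [lL hL] cg sg rN gw.
have -> : L g = \sum_(k <- box d N) L (fun x => g x * rc (tentV (x - (a + vec k)))).
  rewrite -(lin_sum _ lL) ; last by move=> k; exact: cc_cell.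
  by congr L; apply/funext => x; exact: partition_cells sg rN.
apply: le_trans (nrm_sum _ _ _) _; rewrite mulr_sumr big_seq [leRHS]big_seq.
apply: ler_sum => k kN; apply: (hL (a + vec k)); [exact: cc_cell|exact: supp_cell|].
move=> x; have [h|/existsNP[i /negP]] := pselect (forall i, `|x 0 i - (a + vec k) 0 i| <= 1).
  rewrite nrmM -[leRHS]mulr1; apply: ler_pM; [exact: nrm_ge0|exact: nrm_ge0| |exact: tentV_nrm].
  have -> : x = a + (x - a) by rewrite addrC subrK.
  by apply: gw => // i; have := h i; rewrite !mxE opprD addrA.
rewrite -ltNge => h; rewrite (@tentV_out _ _ _ i) ?mulr0 ?nrm0; last by move: h; rewrite !mxE => /ltW.
apply: le_trans (nrm_ge0 _) (gw k (vec k) kN _) => j.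
by rewrite mxE subrr normr0.
Qed.

Lemma tbf_box L B r : tbf L B -> exists2 B', 0 <= B' & forall a g M, cc g -> supp_in a r g ->
  (forall x, nrm (g x) <= M) -> nrm (L g) <= B' * M.
Proof.
move=> tL; pose N := (Num.truncn r).+1.
have rN : r <= N%:R by exact: ltW (truncnS_gt r).
have B0 : 0 <= B.
  have := tL.2 0 _ 1 (cc_tentV R d) (@supp_tentV R d) (fun x => tentV_nrm x).
  by rewrite mulr1; exact: le_trans (nrm_ge0 _).
exists (B * (size (box d N))%:R) => [|a g M cg sg gM]; first by rewrite mulr_ge0.
have := @tbf_cells L B g a N r (fun=> M) tL cg sg rN (fun k x _ _ => gM _).
by rewrite big_const_seq count_predT iter_addr_0 -[M *+ _]mulr_natl mulrA.
Qed.

Definition convL g L x : C := L (fun y => g (x - y)).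

(** A small translation changes [g] uniformly little on a fixed compact set. *)
Lemma convL_uc L B g : tbf L B -> cc g -> uc (convL g L).
Proof.
move=> tL cg; have [ug [r sg]] := cg.
have [B' B0 hB] := tbf_box (r + 1) tL.
move=> e e0; have e1 : 0 < e / (B' + 1) by rewrite divr_gt0// ltr_wpDl.
have [dl dl0 hd] := ug _ e1; exists (Num.min dl 1); first by rewrite lt_min dl0 ltr01.
move=> x h hh; rewrite /convL -(linB (tbf_lin tL)); try exact: cc_refl.
apply: le_trans (_ : B' * (e / (B' + 1)) <= _).
  apply: (hB x).
  - by apply: cc_sub; exact: cc_refl.
  - move=> y i hy; have hi : `|h 0 i| < 1 by have := hh i; rewrite lt_min => /andP[].
    have h1 : r < `|(x + h - y) 0 i - (0 : X) 0 i|.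
      rewrite !mxE subr0; have := ler_normB (x 0 i + h 0 i - y 0 i) (h 0 i).
      rewrite distrC in hy; have -> : x 0 i + h 0 i - y 0 i - h 0 i = x 0 i - y 0 i by ring.
      by lra.
    have h2 : r < `|(x - y) 0 i - (0 : X) 0 i| by rewrite !mxE subr0 distrC; lra.
    by rewrite (sg _ _ h1) (sg _ _ h2) subrr.
  move=> y; rewrite (_ : x + h - y = x - y + h); last by rewrite addrAC.
  by apply: hd => i; have := hh i; rewrite lt_min => /andP[].
rewrite mulrCA -[leRHS]mulr1 ler_pM2l// ler_pdivrMr ?ltr_wpDl//.
by rewrite mul1r lerDl.
Qed.

Lemma convL_shift g L t x : convL (fun y => g (y + t)) L x = convL g L (x + t).
Proof. by rewrite /convL; congr L; apply/funext => y; rewrite addrAC. Qed.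

Lemma convLP c f g L x : lin L -> cc f -> cc g ->
  convL (fun y => c * f y + g y) L x = c * convL f L x + convL g L x.
Proof. by move=> lL cf cg; rewrite /convL lL//; exact: cc_refl. Qed.

Lemma convL_bound L B r : tbf L B -> exists2 B', 0 <= B' & forall g M, cc g -> supp_in 0 r g ->
  (forall x, nrm (g x) <= M) -> forall x, nrm (convL g L x) <= B' * M.
Proof.
move=> tL; have [B' B0 hB] := tbf_box r tL; exists B' => // g M cg sg gM x.
by apply: (hB x) => //; [exact: cc_refl|exact: supp_refl].
Qed.

Lemma tbf_Int : exists B, tbf (@Int R d) B.
Proof.
have [B B0 hB] := @bdd_Int R d 1; exists B; split; first exact: lin_Int.
move=> a g M cg sg gM; rewrite -(tinv_Int a cg); apply: hB => //; first exact: cc_shift.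
by have := supp_shift (t := a) sg; rewrite subrr.
Qed.

Lemma Int_haar L g : lin L -> tinv L -> bdd L -> cc g ->
  L g = L (fun x => rc (tentV x)) * Int g.
Proof.
move=> lL tL bL cg.
have := haar_uniqueness lL (@lin_Int R d) tL (@tinv_Int R d) bL (@bdd_Int R d) cg (cc_tentV R d).
by rewrite Int_tentV mulr1.
Qed.

Lemma Int_neg g : cc g -> Int (fun x => g (- x)) = Int g.
Proof.
move=> cg; rewrite (@Int_haar (fun g => Int (fun x => g (- x))) g) //.
- by under eq_fun do rewrite tentVN; rewrite Int_tentV mul1r.
- by move=> c f1 f2 c1 c2; rewrite lin_Int//; exact: cc_neg.
- move=> f t cf; rewrite -[RHS](tinv_Int (- t)); last exact: cc_neg.
  by congr Int; apply/funext => x; rewrite opprD opprK.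
move=> r; have [B B0 hB] := @bdd_Int R d r; exists B => // f M cf sf fM.
apply: hB => //; first exact: cc_neg.
by move=> x i hi; apply: (sf _ i); move: hi; rewrite !mxE !subr0 normrN.
Qed.

(** The coefficient of a functional at a frequency exists because the twisted
    mean of the convolutions is a translation invariant functional, hence a
    multiple of the integral. *)
Lemma bohr_coefficient L B y : tbf L B -> (forall g, cc g -> ap (convL g L)) ->
  exists c : C, forall g, cc g ->
    Mean (fun x => convL g L x * cj (chi y x)) = c * Int (fun x => g x * cj (chi y x)).
Proof.
move=> tL aL; pose La g := Mean (fun x => convL g L x * cj (chi y x)).
have apL g : cc g -> ap (fun x => convL g L x * cj (chi y x)).
  by move=> cg; apply: ap_mul; [exact: aL|exact: ap_cchi].
have cchi g : cc g -> cc (fun x => g x * chi y x).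
  move=> cg; apply: (@cc_mul _ _ _ _ 1) => //; first exact: uc_chi.
  by move=> x; rewrite nrm_chi.
have ccchi g : cc g -> cc (fun x => g x * cj (chi y x)).
  move=> cg; apply: (@cc_mul _ _ _ _ 1) => //; first exact/uc_conj/uc_chi.
  by move=> x; rewrite nrm_conj nrm_chi.
have linLa : lin La.
  move=> c f g cf cg; have af := apL _ cf; rewrite /La -(MeanZ c af) -(MeanD (ap_scale c af) (apL _ cg)).
  congr Mean; apply/funext => x; rewrite convLP//; [ring|exact: tbf_lin tL].
pose La' g := La (fun x => g x * chi y x).
exists (La' (fun x => rc (tentV x))) => g cg.
have -> : Mean (fun x => convL g L x * cj (chi y x)) = La' (fun x => g x * cj (chi y x)).
  rewrite /La' /La; congr Mean; apply/funext => x; congr (convL _ L x * _).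
  by apply/funext => z; rewrite -mulrA [cj _ * _]mulrC chi_conj mulr1.
apply: Int_haar; last exact: ccchi.
- move=> c f1 f2 c1 c2; rewrite /La' -linLa; try exact: cchi.
  by congr La; apply/funext => x; ring.
- move=> f t cf; rewrite /La'.
  have -> : (fun x => f (x + t) * chi y x) =
      (fun x => cj (chi y t) * (f (x + t) * chi y (x + t)) + 0).
    apply/funext => x; rewrite chiDr addr0; transitivity (f (x + t) * chi y x * (chi y t * cj (chi y t))).
      by rewrite chi_conj mulr1.
    by ring.
  have cf' := cc_shift t (cchi f cf).
  rewrite linLa //; last exact: cc0.
  rewrite (lin0 linLa) addr0 /La.
  have -> : (fun x => convL (fun x => f (x + t) * chi y (x + t)) L x * cj (chi y x)) =
     (fun x => chi y t * (convL (fun x => f x * chi y x) L (x + t) * cj (chi y (x + t)))).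
    apply/funext => x; rewrite (convL_shift (fun x => f x * chi y x)) chiDr cjM.
    transitivity (convL (fun x => f x * chi y x) L (x + t) * cj (chi y x) * (chi y t * cj (chi y t))).
      by rewrite chi_conj mulr1.
    by ring.
  have af := apL _ (cchi _ cf).
  rewrite (MeanZ _ (ap_shift t af)) (Mean_shift t af).
  by rewrite mulrA [cj _ * _]mulrC chi_conj mul1r.
move=> r; have [B' B0 hB] := convL_bound r tL; exists B' => // f M cf sf fM.
apply: Mean_le; first by apply: apL; exact: cchi.
move=> x; rewrite nrmM nrm_conj nrm_chi mulr1; apply: hB; first exact: cchi.
  by move=> z i hi; rewrite (sf _ _ hi) mul0r.
by move=> z; rewrite nrmM nrm_chi mulr1.
Qed.

End translation_bounded.

(** * Extension to functions of summable local suprema *)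

Lemma sum_tail (R : realType) (T : eqType) (w : T -> R) (B e : R) : (forall k, 0 <= w k) ->
  (forall s, uniq s -> \sum_(k <- s) w k <= B) -> 0 < e ->
  exists2 s0, uniq s0 & forall s, uniq s -> (forall k, k \in s -> k \notin s0) ->
    \sum_(k <- s) w k <= e.
Proof.
move=> w0 wB e0; pose S := [set \sum_(k <- s) w k | s in [set s | uniq s]].
have hS : has_sup S.
  split; first by exists (\sum_(k <- [::]) w k), [::].
  by exists B => _ [s us <-]; exact: wB.
have [_ [s0 us0 <-] h0] := sup_adherent e0 hS.
exists s0 => // s us hs; have : \sum_(k <- s0 ++ s) w k <= sup S.
  apply: ub_le_sup; first exact: hS.2.
  exists (s0 ++ s) => //=; rewrite cat_uniq us0 us andbT /=.
  by apply/hasPn => k ks; exact: hs.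
by rewrite big_cat /=; lra.
Qed.

Section amalgam.
Variables (R : realType) (d : nat).
Local Notation C := (CC R).
Local Notation X := 'rV[R]_d.
Local Notation K := {ffun 'I_d -> int}.
Local Notation vec := (vec R).
Implicit Types (f g h G F : X -> C) (x y a t : X) (L : (X -> C) -> C) (k : K) (N : nat) (B D e : R).
Implicit Types w : K -> R.

(** The Wiener amalgam condition: the suprema over lattice cells are dominated
    by a summable family. *)
Definition amal h w D :=
  (forall k x, (forall i, `|x 0 i - (k i)%:~R| <= 1) -> nrm (h x) <= w k) /\
  (forall s, uniq s -> \sum_(k <- s) w k <= D).

Lemma amal_ge0 h w D k : amal h w D -> 0 <= w k.
Proof.
move=> [hw _]; apply: le_trans (nrm_ge0 _) (hw k (vec k) _) => i.
by rewrite mxE subrr normr0.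
Qed.

Lemma seq_in_box (s : seq K) : exists N, forall k, k \in s -> k \in box d N.
Proof.
exists (\sum_(k <- s) \sum_i `|k i|)%N => k ks; rewrite mem_box; apply/forallP => i.
rewrite (big_rem k)//= (bigD1 i)//= -addnA; exact: leq_addr.
Qed.

Lemma mem_box_le N k : k \in box d N -> forall i, `|(k i)%:~R : R| <= N%:R.
Proof.
by rewrite mem_box => /forallP h i; rewrite -intr_norm -[N%:R]/((N%:Z)%:~R) ler_int lez_nat h.
Qed.

(** Truncation errors are uniform in the translation [a] since, after moving it
    to the origin, they only involve the tail of the family [w]. *)
Lemma amal_tail L B h w D e : tbf L B -> amal h w D -> 0 < e ->
  exists N, forall a G, cc G -> (forall x, nrm (G x) <= nrm (h (x - a))) ->
    (forall x, (forall i, `|x 0 i - a 0 i| <= N%:R) -> G x = 0) -> nrm (L G) <= e.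
Proof.
move=> tL am e0.
have B0 : 0 <= B.
  have := tL.2 0 _ 1 (cc_tentV R d) (@supp_tentV R d) (fun x => tentV_nrm x).
  by rewrite mulr1; exact: le_trans (nrm_ge0 _).
have e1 : 0 < e / (B + 1) by rewrite divr_gt0// ltr_wpDl.
have [s0 us0 hs0] := sum_tail (fun k => amal_ge0 k am) am.2 e1.
have [N0 hN0] := seq_in_box s0.
exists N0.+1 => a G cG Gh G0.
have [_ [r0 sr0]] := cG; have [r sr] := @supp_in_move _ _ 0 a _ _ sr0.
pose N := (Num.truncn r).+1.
have rN : r <= N%:R by exact: ltW (truncnS_gt r).
apply: le_trans (@tbf_cells _ _ _ _ _ _ _ _ (fun k => if k \in s0 then 0 else w k) tL cG sr rN _) _.
  move=> k x _ hx; case: ifP => [/hN0 /mem_box_le ks|ks].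
    rewrite G0 ?nrm0// => i; rewrite !mxE [a 0 i + _]addrC addrK -natr1.
    by have := hx i; have := ks i; have := ler_normD (x 0 i - (k i)%:~R) (k i)%:~R; rewrite subrK; lra.
  apply: le_trans (Gh _) _; rewrite [a + x]addrC addrK; exact: am.1.
apply: le_trans (_ : B * (e / (B + 1)) <= _); last first.
  rewrite mulrCA -[leRHS]mulr1 ler_pM2l// ler_pdivrMr ?ltr_wpDl//.
  by rewrite mul1r lerDl.
apply: ler_wpM2l => //; rewrite big_if /= big1 // add0r -big_filter.
apply: hs0; first by rewrite filter_uniq// box_uniq.
by move=> k; rewrite mem_filter => /andP[].
Qed.

Definition trunc h N a x : C := h (x - a) * rc (cutoff N (x - a)).

Lemma cc_trunc h w D N a : uc h -> amal h w D -> cc (trunc h N a).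
Proof.
move=> uh am.
have hb : exists M, forall x, nrm (h x) <= M.
  exists D => x.
  have := am.2 [:: [ffun i => Num.floor (x 0 i)]] isT; rewrite big_seq1; apply: le_trans.
  apply: am.1 => i; rewrite ffunE; have /andP[] := floor_itv (x 0 i).
  by rewrite intrD mulr1z => h1 h2; rewrite ger0_norm; lra.
exact: (@cc_shift _ _ (fun x => h x * rc (cutoff N x)) (- a) (cc_mul_cut N uh hb)).
Qed.

Lemma trunc_sub_le h N N' a x : nrm (trunc h N a x - trunc h N' a x) <= nrm (h (x - a)).
Proof.
rewrite /trunc -mulrBr nrmM -[leRHS]mulr1 ler_wpM2l ?nrm_ge0// -rmorphB nrm_real.
have := cut_ge0 N (x - a); have := cut_le1 N (x - a).
have := cut_ge0 N' (x - a); have := cut_le1 N' (x - a).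
by move=> *; rewrite ler_norml; apply/andP; split; lra.
Qed.

Lemma trunc_in h N a x : (forall i, `|x 0 i - a 0 i| <= N%:R) -> trunc h N a x = h (x - a).
Proof. by move=> hx; rewrite /trunc cut1 ?mulr1// => i; rewrite !mxE. Qed.

(** [F a] is the integral of the translate of [h] by [a] with respect to [L];
    uniform convergence in [a] is what transports almost periodicity and
    coefficients from the truncations. *)
Definition ext_lim L h F := forall e, 0 < e -> exists N0, forall N, (N0 <= N)%N -> forall a,
  nrm (F a - L (trunc h N a)) <= e.

Lemma ext_exists L B h w D : tbf L B -> uc h -> amal h w D -> exists F, ext_lim L h F.
Proof.
move=> tL uh am; have ct N a := cc_trunc N a uh am.
have cauchy e : 0 < e -> exists N0, forall N N' a, (N0 <= N)%N -> (N0 <= N')%N ->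
    nrm (L (trunc h N a) - L (trunc h N' a)) <= e.
  move=> e0; have [N0 h0] := amal_tail tL am e0; exists N0 => N N' a hN hN'.
  rewrite -(linB (tbf_lin tL))//; apply: (h0 a); first exact: cc_sub.
    by move=> x; exact: trunc_sub_le.
  move=> x hx; rewrite !trunc_in ?subrr// => i; apply: le_trans (hx i) _; rewrite ler_nat//.
have lim a : exists l, forall e, 0 < e -> exists N, forall n, (N <= n)%N -> nrm (L (trunc h n a) - l) <= e.
  apply: complex_seq_complete => e e0; have [N0 h0] := cauchy e e0.
  by exists N0 => n m hn hm; exact: h0.
have [F hF] := choice lim.
exists F => e e0; have e2 : 0 < e / 2 by rewrite divr_gt0.
have [N0 h0] := cauchy _ e2; exists N0 => N hN a.
have [N1 h1] := hF a _ e2.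
have := h1 (maxn N0 N1) (leq_maxr _ _); have := h0 N (maxn N0 N1) a hN (leq_maxl _ _).
have := nrm_tri (F a) (L (trunc h (maxn N0 N1) a)) (L (trunc h N a)).
by rewrite (nrmC (F a) (L (trunc h (maxn N0 N1) a)))
  (nrmC (L (trunc h (maxn N0 N1) a)) (L (trunc h N a))); lra.
Qed.

Lemma trunc_convL h N a L : L (trunc h N a) = convL (fun z => trunc h N 0 (- z)) L a.
Proof.
rewrite /convL; congr L; apply/funext => x; rewrite /trunc.
by rewrite subr0 opprB.
Qed.

Lemma cc_trunc_neg h w D N : uc h -> amal h w D -> cc (fun z => trunc h N 0 (- z)).
Proof. by move=> uh am; exact: cc_neg (cc_trunc N 0 uh am). Qed.

Lemma ext_uc L B h w D F : tbf L B -> uc h -> amal h w D -> ext_lim L h F -> uc F.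
Proof.
move=> tL uh am hF; apply: uc_lim => e e0; have [N h0] := hF e e0.
exists (fun a => L (trunc h N a)); last exact: h0.
rewrite (_ : (fun a => _) = convL (fun z => trunc h N 0 (- z)) L); last first.
  by apply/funext => a; exact: trunc_convL.
by apply: (convL_uc tL); exact: cc_trunc_neg uh am.
Qed.

Lemma ext_ap L h w D F : (forall g, cc g -> ap (convL g L)) -> uc h -> amal h w D ->
  ext_lim L h F -> ap F.
Proof.
move=> aL uh am hF; apply: ap_lim => e e0; have [N h0] := hF e e0.
exists (fun a => L (trunc h N a)); last exact: h0.
rewrite (_ : (fun a => _) = convL (fun z => trunc h N 0 (- z)) L); last first.
  by apply/funext => a; exact: trunc_convL.
by apply: aL; exact: cc_trunc_neg uh am.
Qed.

(** The coefficients pass to the uniform limit. The number [I] stands for the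
    integral of [h] times the character; keeping it as a parameter allows the
    use of this lemma for the comb before Fourier inversion is known. *)
Lemma ext_coefficient L B h w D F y (c I : C) : tbf L B -> (forall g, cc g -> ap (convL g L)) ->
  uc h -> amal h w D -> ext_lim L h F ->
  (forall g, cc g ->
    Mean (fun x => convL g L x * cj (chi y x)) = c * Int (fun x => g x * cj (chi y x))) ->
  (forall e, 0 < e -> exists N0, forall N, (N0 <= N)%N ->
    nrm (I - Int (fun x => trunc h N 0 x * chi y x)) <= e) ->
  Mean (fun x => F x * cj (chi y x)) = c * I.
Proof.
move=> tL aL uh am hF hc hI.
have aF := ext_ap aL uh am hF; have acy := @ap_cchi R d y.
apply: nrm_eq => e e0.
have e1 : 0 < e / 2 by rewrite divr_gt0.
have e2 : 0 < e / (2 * (nrm c + 1)).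
  by rewrite divr_gt0// mulr_gt0// ltr_wpDl// nrm_ge0.
have [N1 h1] := hF _ e1; have [N2 h2] := hI _ e2; pose N := maxn N1 N2.
have cg := cc_trunc_neg N uh am; have ag := aL _ cg.
have := nrm_tri (Mean (fun x => F x * cj (chi y x)))
  (Mean (fun x => convL (fun z => trunc h N 0 (- z)) L x * cj (chi y x))) (c * I).
have b1 : nrm (Mean (fun x => F x * cj (chi y x)) -
   Mean (fun x => convL (fun z => trunc h N 0 (- z)) L x * cj (chi y x))) <= e / 2.
  apply: Mean_dist; [exact: ap_mul|exact: ap_mul|] => x.
  by rewrite -mulrBl nrmM nrm_conj nrm_chi mulr1 -trunc_convL; apply: h1; exact: leq_maxl.
have b2 : nrm (Mean (fun x => convL (fun z => trunc h N 0 (- z)) L x * cj (chi y x)) - c * I) <= e / 2.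
  have E : Int (fun x => trunc h N 0 (- x) * cj (chi y x)) = Int (fun x => trunc h N 0 x * chi y x).
    rewrite -[RHS]Int_neg.
      by congr Int; apply/funext => x; rewrite chiNr.
    apply: (@cc_mul _ _ _ _ 1); [exact: cc_trunc uh am|exact: uc_chi|].
    by move=> x; rewrite nrm_chi.
  rewrite hc// E -mulrBr nrmM nrmC.
  apply: le_trans (_ : nrm c * (e / (2 * (nrm c + 1))) <= _).
    by apply: ler_wpM2l; [exact: nrm_ge0|apply: h2; exact: leq_maxr].
  have c1 : 0 < nrm c + 1 by rewrite ltr_wpDl// nrm_ge0.
  have -> : nrm c * (e / (2 * (nrm c + 1))) = e / 2 * (nrm c / (nrm c + 1)).
    by field; rewrite gt_eqF.
  rewrite ler_piMr//; first exact: ltW.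
  by rewrite ler_pdivrMr// mul1r lerDl.
by lra.
Qed.

End amalgam.

(** * Absolutely convergent Bohr series and the Parseval identity *)

Section sums.
Variables (R : realType) (T : eqType).
Local Notation C := (CC R).
Implicit Types (z : T -> C) (s : seq T) (B e : R).

Lemma sum_diff z s s' : uniq s -> uniq s' ->
  nrm (\sum_(k <- s) z k - \sum_(k <- s') z k) <=
  \sum_(k <- s | k \notin s') nrm (z k) + \sum_(k <- s' | k \notin s) nrm (z k).
Proof.
move=> us us'; rewrite (bigID (mem s') _ z) /= [X in _ - X](bigID (mem s) _ z) /=.
have -> : \sum_(k <- s | k \in s') z k = \sum_(k <- s' | k \in s) z k.
  have pe : perm_eq [seq k <- s | k \in s'] [seq k <- s' | k \in s].
    by apply: uniq_perm => [||k]; rewrite ?filter_uniq// !mem_filter andbC.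
  by rewrite -[LHS]big_filter -[RHS]big_filter (perm_big _ pe).
rewrite opprD addrACA subrr add0r; apply: le_trans (nrmB _ _) _.
by apply: lerD; exact: nrm_sum.
Qed.

(** Nets of partial sums along finite subsets, for the convergence without
    order. *)
Definition ssum z (S : C) := forall e, 0 < e -> exists s0 : seq T,
  forall s, uniq s -> {subset s0 <= s} -> nrm (S - \sum_(k <- s) z k) <= e.

Lemma ssum_uniq z S S' : ssum z S -> ssum z S' -> S = S'.
Proof.
move=> h h'; apply: nrm_eq => e e0; have e2 : 0 < e / 2 by rewrite divr_gt0.
have [s0 h0] := h _ e2; have [s1 h1] := h' _ e2.
pose s := undup (s0 ++ s1).
have /h0 : uniq s by exact: undup_uniq.
have /h1 : uniq s by exact: undup_uniq.
have i0 : {subset s0 <= s} by move=> k ks; rewrite mem_undup mem_cat ks.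
have i1 : {subset s1 <= s} by move=> k ks; rewrite mem_undup mem_cat ks orbT.
move=> /(_ i1) b1 /(_ i0) b0; have := nrm_tri S (\sum_(k <- s) z k) S'.
by rewrite (nrmC (\sum_(k <- s) z k) S'); lra.
Qed.

End sums.

Section mean_product.
Variables (R : realType).
Local Notation C := (CC R).

Lemma ap_comp (H G : zmodType) (phi : H -> G) (f : G -> C) :
  {morph phi : a b / a + b >-> a + b} -> ap f -> ap (fun h => f (phi h)).
Proof. by move=> pD af; have := ap_line pD 0 af; under eq_fun do rewrite add0r. Qed.

Lemma Mean_comp (H G : zmodType) (phi : H -> G) (sg : G -> H) (f : G -> C) :
  {morph phi : a b / a + b >-> a + b} -> cancel sg phi -> ap f ->
  Mean (fun h => f (phi h)) = Mean f.
Proof.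
move=> pD sK af; apply: Mean_isexp; split=> // e e0.
have [p p0 hp] := (MeanP af).2 e e0; exists [seq sg x | x <- p].
  by rewrite -size_eq0 size_map size_eq0.
move=> h; have := hp (phi h); rewrite /avg size_map big_map.
by under [in X in _ -> X]eq_bigr do rewrite pD sK.
Qed.

Variables G1 G2 : zmodType.
Implicit Types A : G1 * G2 -> C.

(** Each iterated mean is the mean of a conditional expectation along one of the
    factors. *)
Lemma Mean_fubini A : ap A ->
  Mean (fun x => Mean (fun t => A (x, t))) = Mean A /\
  Mean (fun t => Mean (fun x => A (x, t))) = Mean A.
Proof.
move=> aA; split.
  pose phi (t : G2) : G1 * G2 := (0, t).
  have pD : {morph phi : a b / a + b >-> a + b} by move=> a b; rewrite /phi -[0 in LHS](addr0 0).
  have E : expect phi A = (fun z => Mean (fun t => A (z.1, t))).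
    apply/funext => -[x t]; rewrite expect_pt//=.
    have := Mean_shift t (@ap_line _ _ _ phi pD A (x, 0) aA).
    rewrite /phi /= => E.
    transitivity (Mean (fun h => A ((x, 0) + (0, h + t)))).
      by congr Mean; apply/funext => h; congr A; congr pair; rewrite /= ?addr0 ?add0r// addrC.
    by rewrite E; congr Mean; apply/funext => h; congr A; congr pair; rewrite /= ?addr0 ?add0r.
  rewrite -(Mean_expect pD aA) E.
  have aE : ap (fun x => Mean (fun t => A (x, t))).
    have := ap_expect pD aA; rewrite E => /(@ap_comp _ _ (fun x : G1 => (x, 0 : G2))); apply.
    by move=> a b; congr pair; rewrite addr0.
  by rewrite (@Mean_comp _ _ fst (fun x => (x, 0)) _ _ _ aE).
pose phi (t : G1) : G1 * G2 := (t, 0).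
have pD : {morph phi : a b / a + b >-> a + b} by move=> a b; rewrite /phi -[0 in LHS](addr0 0).
have E : expect phi A = (fun z => Mean (fun t => A (t, z.2))).
  apply/funext => -[t x]; rewrite expect_pt//=.
  have := Mean_shift t (@ap_line _ _ _ phi pD A (0, x) aA).
  rewrite /phi /= => E.
  transitivity (Mean (fun h => A ((0, x) + (h + t, 0)))).
    by congr Mean; apply/funext => h; congr A; congr pair; rewrite /= ?addr0 ?add0r// addrC.
  by rewrite E; congr Mean; apply/funext => h; congr A; congr pair; rewrite /= ?addr0 ?add0r.
rewrite -(Mean_expect pD aA) E.
have aE : ap (fun x => Mean (fun t => A (t, x))).
  have := ap_expect pD aA; rewrite E => /(@ap_comp _ _ (fun x : G2 => (0 : G1, x))); apply.
  by move=> a b; congr pair; rewrite addr0.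
by rewrite (@Mean_comp _ _ snd (fun x => (0, x)) _ _ _ aE).
Qed.

End mean_product.

Section bohr_series.
Variables (R : realType) (d : nat).
Local Notation C := (CC R).
Local Notation X := 'rV[R]_d.
Implicit Types (f p F : X -> C) (x y t : X) (s Y : seq X) (B M e : R).

Definition bohr F y : C := Mean (fun x => F x * cj (chi y x)).

Lemma ap_bohr F y : ap F -> ap (fun x => F x * cj (chi y x)).
Proof. by move=> aF; apply: ap_mul => //; exact: ap_cchi. Qed.

Definition trig (c : X -> C) Y x : C := \sum_(y <- Y) c y * chi y x.

Lemma ap_trig c Y : ap (trig c Y).
Proof. by apply: ap_sum => y; apply: ap_scale; exact: ap_chi. Qed.

Lemma uc_trig c Y : uc (trig c Y).
Proof.
apply: uc_sum => y; apply: (@uc_mul _ _ _ _ (Num.max (nrm (c y)) 1)).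
- by move=> x; rewrite le_max lexx.
- by move=> x; rewrite nrm_chi le_max lexx orbT.
- exact: uc_cst.
exact: uc_chi.
Qed.

Lemma bohr_trig c Y y : uniq Y -> bohr (trig c Y) y = (y \in Y)%:R * c y.
Proof.
move=> uY; rewrite /bohr /trig.
have -> : (fun x => (\sum_(y <- Y) c y * chi y x) * cj (chi y x)) =
   (fun x => \sum_(z <- Y) c z * (chi z x * cj (chi y x))).
  by apply/funext => x; rewrite mulr_suml; apply: eq_bigr => z _; rewrite mulrA.
have az z : ap (fun x : X => chi z x * cj (chi y x)) by apply: ap_bohr; exact: ap_chi.
rewrite Mean_sum; last by move=> z; apply: ap_scale.
under eq_bigr => z _ do rewrite MeanZ// chi_orth.
have [yY|yY] := boolP (y \in Y).
  rewrite (bigD1_seq y)//= eqxx mulr1 mul1r big1 ?addr0// => z /negPf ->.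
  by rewrite mulr0.
rewrite mul0r big_seq big1// => z zY; case: eqP => [E|]; last by rewrite mulr0.
by rewrite -E zY in yY.
Qed.

(** Partial sums converge uniformly, so the coefficients can be read off the
    trigonometric polynomials. *)
Lemma bohr_series (c : X -> C) B : (forall Y, uniq Y -> \sum_(y <- Y) nrm (c y) <= B) ->
  exists F, [/\ ap F, uc F, forall y, bohr F y = c y & forall x, ssum (fun y => c y * chi y x) (F x)].
Proof.
move=> hB; have c0 y : 0 <= nrm (c y) by exact: nrm_ge0.
pose tail Y e := uniq Y /\ forall s, uniq s -> (forall k, k \in s -> k \notin Y) ->
    \sum_(k <- s) nrm (c k) <= e.
have [q q0 small] : exists2 q : nat -> R, forall n, 0 < q n &
    forall e, 0 < e -> exists n0, forall n, (n0 <= n)%N -> q n <= e.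
  exists (fun n => n.+1%:R^-1) => [n|e e0]; first by rewrite invr_gt0.
  have [n0 h0] := inv_le_small e0; exists n0 => n hn.
  by apply: le_trans h0; rewrite lef_pV2 ?posrE// ler_nat.
have ex n : exists Y, tail Y (q n).
  by have [|Y uY hY] := sum_tail (e := q n) c0 hB; [exact: q0|exists Y].
have [Y hY] := choice ex.
have dist Y0 e s x : tail Y0 e -> uniq s -> nrm (trig c s x - trig c Y0 x) <=
   e + \sum_(y <- Y0 | y \notin s) nrm (c y).
  move=> [u0 h0] us; apply: le_trans (sum_diff _ us u0) _; apply: lerD.
    under eq_bigr do rewrite nrmM nrm_chi mulr1.
    rewrite -big_filter; apply: h0; first exact: filter_uniq.
    by move=> k; rewrite mem_filter => /andP[].
  by rewrite ler_sum// => y _; rewrite nrmM nrm_chi mulr1.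
have dist2 Y0 Y1 e e1 x : tail Y0 e -> tail Y1 e1 -> nrm (trig c Y1 x - trig c Y0 x) <= e + e1.
  move=> t0 t1; apply: le_trans (dist _ _ _ x t0 t1.1) _; rewrite lerD2l -big_filter.
  apply: t1.2; first by rewrite filter_uniq// t0.1.
  by move=> k; rewrite mem_filter => /andP[].
have cau x e : 0 < e -> exists N, forall n m, (N <= n)%N -> (N <= m)%N ->
   nrm (trig c (Y n) x - trig c (Y m) x) <= e.
  move=> e0; have [|N hN] := small (e / 2); first by rewrite divr_gt0.
  exists N => n m hn hm; apply: le_trans (dist2 _ _ _ _ x (hY m) (hY n)) _.
  by rewrite [leRHS]splitr; apply: lerD; exact: hN.
have [F hF] := choice (fun x => complex_seq_complete (cau x)).
have F_n n x : nrm (F x - trig c (Y n) x) <= 2 * q n.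
  have n0 := q0 n.
  apply/ler_addgt0Pr => e e0; have e2 : 0 < e / 2 by rewrite divr_gt0.
  have [N hN] := hF x _ e2; have [N1 h1] := small _ e2.
  pose m := maxn N N1; have a1 := hN m (leq_maxl _ _); have a2 := h1 m (leq_maxr _ _).
  have a3 := dist2 _ _ _ _ x (hY n) (hY m).
  have := nrm_tri (F x) (trig c (Y m) x) (trig c (Y n) x).
  by rewrite (nrmC (F x) (trig c (Y m) x)); lra.
have approx e : 0 < e -> exists n, forall x, nrm (F x - trig c (Y n) x) <= e.
  move=> e0; have [|n hn] := small (e / 2); first by rewrite divr_gt0.
  by exists n => x; have := F_n n x; have := hn n (leqnn n); lra.
have aF : ap F.
  by apply: ap_lim => e /approx[n hn]; exists (trig c (Y n)); [exact: ap_trig|].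
exists F; split=> //.
- by apply: uc_lim => e /approx[n hn]; exists (trig c (Y n)); [exact: uc_trig|].
- move=> y; apply: nrm_eq => e e0; have [|n hn] := small (e / 3); first by rewrite divr_gt0.
  have an := hn n (leqnn n).
  have b1 : nrm (bohr F y - bohr (trig c (Y n)) y) <= 2 * q n.
    apply: Mean_dist; [exact: ap_bohr|by apply: ap_bohr; exact: ap_trig|] => x.
    by rewrite -mulrBl nrmM nrm_conj nrm_chi mulr1.
  have [uY tY] := hY n; rewrite bohr_trig// in b1.
  have b2 : nrm ((y \in Y n)%:R * c y - c y) <= q n.
    have [yY|yY] := boolP (y \in Y n); first by rewrite mul1r subrr nrm0 ltW.
    rewrite mul0r sub0r nrmN; have := tY [:: y] isT; rewrite big_seq1; apply.
    by move=> k; rewrite inE => /eqP ->.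
  have := nrm_tri (bohr F y) ((y \in Y n)%:R * c y) (c y); lra.
move=> x e e0; have [|n hn] := small (e / 3); first by rewrite divr_gt0.
have an := hn n (leqnn n).
exists (Y n) => s us Ys.
have := dist _ _ _ x (hY n) us; rewrite big_seq_cond big1 ?addr0; last first.
  by move=> y /andP[/Ys ->].
have := F_n n x; have := nrm_tri (F x) (trig c (Y n) x) (trig c s x).
by rewrite (nrmC (trig c (Y n) x)) /trig; lra.
Qed.

(** An almost periodic function with summable coefficients is the sum of its
    Bohr series, by uniqueness. *)
Lemma bohr_expansion F B x : ap F -> uc F ->
  (forall Y, uniq Y -> \sum_(y <- Y) nrm (bohr F y) <= B) ->
  ssum (fun y => bohr F y * chi y x) (F x).
Proof.
move=> aF uF /bohr_series[S [aS uS bS hS]].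
suff E : F x - S x = 0 by rewrite (_ : F x = S x)//; apply/eqP; rewrite -subr_eq0 E.
have := @vec_uniqueness0 R d (fun z => F z - S z); apply.
- exact: ap_sub.
- by apply: uc_add => //; exact: uc_opp.
move=> y; under eq_fun do rewrite mulrBl.
rewrite MeanB; [|exact: ap_bohr|exact: ap_bohr].
by rewrite -/(bohr F y) -/(bohr S y) bS subrr.
Qed.

(** The Bohr series of the autocorrelation of [p] has the nonnegative
    coefficients [|bohr p y|^2], which are summable by Bessel; its value at the
    origin is the mean of [|p|^2]. *)
Lemma parseval p : ap p -> uc p ->
  ssum (fun y => rc (nrm (bohr p y) ^+ 2) : C) (Mean (fun x => p x * cj (p x))).
Proof.
move=> apP upP; have [M M0 pM] := ap_bounded apP.
pose P x := Mean (fun t => p (x + t) * cj (p t)).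
have apx x : ap (fun t => p (x + t) * cj (p t)).
  apply: ap_mul; last exact: ap_conj.
  by rewrite (_ : (fun t => _) = (fun t => p (t + x))); [exact: ap_shift|apply/funext => t; rewrite addrC].
have distP x x' e : (forall t, nrm (p (x + t) - p (x' + t)) <= e) -> nrm (P x - P x') <= e * M.
  move=> h; apply: Mean_dist => // t.
  by rewrite -mulrBl nrmM nrm_conj ler_pM ?nrm_ge0.
have M1 : 0 < M + 1 by rewrite ltr_wpDl.
have eM e : 0 < e -> 0 < e / (M + 1) by move=> e0; rewrite divr_gt0.
have eM1 e : 0 < e -> e / (M + 1) * M <= e.
  by move=> e0; rewrite mulrAC ler_pdivrMr// ler_pM2l// lerDl.
have aP : ap P.
  move=> e e0; have [s hs] := apP _ (eM _ e0); exists s => t.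
  have [t' t's ht] := hs t; exists t' => // x.
  apply: le_trans (distP _ _ (e / (M + 1)) _) (eM1 _ e0) => u.
  by have := ht (x + u); rewrite addrAC [x + u + t']addrAC.
have uP : uc P.
  move=> e e0; have [dl dl0 hd] := upP _ (eM _ e0); exists dl => // x h hh.
  apply: le_trans (distP _ _ (e / (M + 1)) _) (eM1 _ e0) => u.
  by have := hd (x + u) h hh; rewrite addrAC.
have bP y : bohr P y = rc (nrm (bohr p y) ^+ 2).
  pose A (z : X * X) := p (z.1 + z.2) * cj (p z.2) * cj (chi y z.1).
  have aA : ap A.
    apply: ap_mul; first apply: ap_mul.
    - by apply: (ap_comp (phi := fun z : X * X => z.1 + z.2) (f := p)) => // a b; rewrite /= addrACA.
    - by apply: (ap_comp (phi := @snd X X) (f := fun t => cj (p t))) => //; exact: ap_conj.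
    by apply: (ap_comp (phi := @fst X X) (f := fun x => cj (chi y x))) => //; exact: ap_cchi.
  have [E1 E2] := Mean_fubini aA.
  transitivity (Mean A).
    rewrite -E1 /bohr; congr Mean; apply/funext => x; rewrite /P /A /= mulrC -MeanZ//.
    by congr Mean; apply/funext => t; rewrite mulrC.
  rewrite -E2 -mulcJ mulrC; rewrite [cj (bohr p y)](_ : _ = Mean (fun t => cj (p t) * chi y t)); last first.
    by rewrite /bohr -Mean_conj ?ap_bohr//; [congr Mean; apply/funext => t; rewrite cjM cjK|exact: ap_bohr].
  have aq : ap (fun t => cj (p t) * chi y t) by apply: ap_mul; [exact: ap_conj|exact: ap_chi].
  transitivity (bohr p y * Mean (fun t => cj (p t) * chi y t)); last exact: mulrC.
  apply: etrans _ (MeanZ (bohr p y) aq).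
  congr Mean; apply/funext => t.
  have as_ := ap_bohr y apP.
  transitivity ((cj (p t) * chi y t) * bohr p y); last exact: mulrC.
  rewrite /bohr -(Mean_shift t as_); apply: etrans _ (MeanZ _ (ap_shift t as_)).
  congr Mean; apply/funext => x; rewrite chiDr cjM -[A _]/(p (x + t) * cj (p t) * cj (chi y x)).
  transitivity (cj (p t) * (p (x + t) * cj (chi y x)) * (chi y t * cj (chi y t))); last by ring.
  by rewrite chi_conj mulr1; ring.
have := @bohr_expansion P (M ^+ 2) 0 aP uP _.
rewrite (_ : P 0 = Mean (fun x => p x * cj (p x))); last first.
  by congr Mean; apply/funext => t; rewrite add0r.
rewrite (_ : (fun y => bohr P y * chi y 0) = (fun y => rc (nrm (bohr p y) ^+ 2))); last first.
  by apply/funext => y; rewrite chi0r mulr1.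
apply=> Y uY; under eq_bigr do rewrite bP nrm_real ger0_norm ?sqr_ge0//.
apply: (@Mean_bessel _ _ _ (fun y => chi y)) => //; first exact: ap_chi.
by move=> i j _ _; exact: chi_orth.
Qed.

End bohr_series.

(** * The Dirac comb of the integer lattice *)

Section comb.
Variables (R : realType) (d : nat).
Local Notation C := (CC R).
Local Notation X := 'rV[R]_d.
Local Notation K := {ffun 'I_d -> int}.
Local Notation vec := (vec R).
Implicit Types (f g q : X -> C) (x y a t : X) (k l : K) (N : nat) (B M r e : R).

Lemma vecD k l : vec (k + l) = vec k + vec l.
Proof. by apply/rowP => i; rewrite !mxE ffunE intrD. Qed.

Lemma vecN k : vec (- k) = - vec k.
Proof. by apply/rowP => i; rewrite !mxE ffunE intrN. Qed.

Lemma vec0 : vec (0 : K) = 0.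
Proof. by apply/rowP => i; rewrite !mxE ffunE. Qed.

Lemma vec_inj : injective (fun k => vec k).
Proof.
by move=> k l /rowP h; apply/ffunP => i; have := h i; rewrite !mxE => /intr_inj.
Qed.

(** Only finitely many terms are nonzero when [g] is a test function. *)
Definition comb g : C := \sum_(k \in [set: K]) g (vec k).

Lemma combE g r N : supp_in 0 r g -> r <= N%:R -> comb g = \sum_(k <- box d N) g (vec k).
Proof.
move=> sg rN; rewrite /comb (fsbigE (box d N)) ?box_uniq//.
  by apply: eq_bigl => k; rewrite mem_set.
move=> k _; rewrite mem_box negb_forall => /existsP[i hi].
apply: (sg _ i); rewrite !mxE subr0; apply: le_lt_trans rN _.
by rewrite -intr_norm -[N%:R]/((N%:Z)%:~R) ltr_int ltz_nat ltnNge.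
Qed.

Lemma supp_nat g : cc g -> exists N, supp_in 0 N%:R g.
Proof.
move=> [_ [r sr]]; exists (Num.truncn r).+1; apply: supp_inW sr.
exact: ltW (truncnS_gt r).
Qed.

Lemma lin_comb : lin comb.
Proof.
move=> c f g cf cg; have [N sf] := supp_nat cf; have [N' sg] := supp_nat cg.
have [h1 h2] : N%:R <= (maxn N N')%:R :> R /\ N'%:R <= (maxn N N')%:R :> R.
  by rewrite !ler_nat leq_maxl leq_maxr.
rewrite (combE sf h1) (combE sg h2) mulr_sumr -big_split; apply: combE (lexx _).
move=> x i hi; rewrite (sf x i) ?(sg x i) ?mulr0 ?addr0//; exact: le_lt_trans hi.
Qed.

Lemma comb_shift g l : comb (fun x => g (x + vec l)) = comb g.
Proof.
rewrite /comb [RHS](@reindex_fsbigT _ _ _ _ _ (fun k => k + l) (fun k => g (vec k))); last first.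
  by exists (fun k => k - l) => k; rewrite ?addrK ?subrK.
by apply: eq_fsbigr => k _; rewrite vecD.
Qed.

Lemma sum_tentV_le N b : \sum_(k <- box d N) tentV (vec k - b) <= 1.
Proof.
apply: le_trans (cut_le1 N b); rewrite /cutoff; apply: ler_sum => k _.
by rewrite -tentVN opprB.
Qed.

Lemma tbf_comb : exists B, tbf comb B.
Proof.
exists (size (box d 1))%:R; split; first exact: lin_comb.
move=> a g M cg sg gM; have [N sN] := supp_nat cg.
have M0 : 0 <= M := le_trans (nrm_ge0 _) (gM 0).
have gle x : nrm (g x) <= M * \sum_(j <- box d 1) tentV (x - (a + vec j)).
  rewrite {1}(@partition_cells _ _ _ _ 1 _ x sg (lexx _)) -mulr_sumr nrmM -rmorph_sum nrm_real.
  rewrite ger0_norm; last by apply: sumr_ge0 => k _; exact: tentV_ge0.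
  by apply: ler_wpM2r => //; apply: sumr_ge0 => k _; exact: tentV_ge0.
rewrite (combE sN (lexx _)); apply: le_trans (nrm_sum _ _ _) _.
apply: le_trans (ler_sum _ (fun k _ => gle (vec k))) _.
rewrite -mulr_sumr [leRHS]mulrC ler_wpM2l// exchange_big /=.
apply: le_trans (ler_sum _ (fun j _ => sum_tentV_le N (a + vec j))) _.
by rewrite big_const_seq count_predT iter_addr_0.
Qed.

Lemma convL_comb_period g x l : convL g comb (x + vec l) = convL g comb x.
Proof.
rewrite /convL -(comb_shift (fun y => g (x - y)) (- l)); congr comb.
by apply/funext => y; rewrite vecN opprD opprK addrA addrAC.
Qed.

(** Translations only matter modulo the lattice, and the fundamental cell is cut
    into finitely many small cubes. *)
Lemma periodic_ap q : uc q -> (forall x l, q (x + vec l) = q x) -> ap q.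
Proof.
move=> uq pq; apply: ap_classes => e e0.
have [dl dl0 hd] := uq _ e0.
have [n hn] := inv_le_small (divr_gt0 dl0 (ltr0Sn R 1)).
exists {ffun 'I_d -> 'I_n.+1}, (fun t => [ffun i => fraccell n (t 0 i)]) => t t' E x.
pose fr (t : X) : X := \row_i fracp (t 0 i).
have D (u : X) : u = fr u + vec [ffun i => Num.floor (u 0 i)].
  by apply/rowP => i; rewrite !mxE ffunE /fracp subrK.
have -> : q (x + t) = q (x + fr t) by rewrite {1}(D t) addrA pq.
have -> : q (x + t') = q (x + fr t') by rewrite {1}(D t') addrA pq.
have -> : x + fr t = x + fr t' + (fr t - fr t') by rewrite -addrA [fr t' + _]addrC subrK.
apply: hd => i; rewrite !mxE.
have /ffunP/(_ i) := E; rewrite !ffunE => /fraccell_close h.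
by apply: le_lt_trans h _; apply: le_lt_trans hn _; rewrite ltr_pdivrMr// ltr_pMr// ltr1n.
Qed.

Lemma convL_comb_uc g : cc g -> uc (convL g comb).
Proof. by have [B tB] := tbf_comb; move=> cg; exact: (convL_uc tB cg). Qed.

Lemma convL_comb_ap g : cc g -> ap (convL g comb).
Proof.
by move=> cg; apply: periodic_ap (convL_comb_uc cg) _ => x l; exact: convL_comb_period.
Qed.

Lemma convL_comb_tentV x : convL (fun z => rc (tentV z)) comb x = 1.
Proof.
pose r := \sum_i `|x 0 i| + 1; pose N := (Num.truncn r).+1.
have rN : r <= N%:R by exact: ltW (truncnS_gt r).
have xr i : `|x 0 i| + 1 <= r by rewrite lerD2r (bigD1 i)//= lerDl sumr_ge0.
rewrite /convL (@combE _ r N) => [||//].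
  rewrite -rmorph_sum -/(cutoff N x) cut1// => i.
  by have := xr i; lra.
move=> z i; rewrite !mxE subr0 => hz; rewrite (@tentV_out _ _ _ i)// !mxE.
have := ler_normD (z 0 i - x 0 i) (x 0 i); rewrite subrK (distrC (z 0 i)).
by have := xr i; lra.
Qed.

Lemma ee_eq1 (u : R) : ee u = 1 -> exists n : int, u = n%:~R.
Proof.
move=> E; have [n hn] := floor_half u; exists n; apply/eqP; rewrite -subr_eq0.
apply: contraT => h; have h0 : 0 < `|u - n%:~R| by rewrite normr_gt0.
have [c c0 hc] := ee_away h0 hn; have := hc _ (lexx _) hn.
by rewrite eeD E mul1r -intrN ee_int subrr nrm0 leNgt c0.
Qed.

Lemma chi_vec k l : chi (vec k) (vec l) = 1.
Proof.
rewrite chiE /dotp (_ : \sum_i _ = (\sum_i l i * k i)%:~R) ?ee_int//.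
by rewrite rmorph_sum; apply: eq_bigr => i _; rewrite !mxE rmorphM.
Qed.

(** The factor of proportionality of the coefficient is found with a tent times
    the character, whose periodization is that character. *)
Lemma bohr_comb_on g k : cc g -> bohr (convL g comb) (vec k) = Int (fun x => g x * cj (chi (vec k) x)).
Proof.
move=> cg; have [B tB] := tbf_comb.
have [c hc] := bohr_coefficient (vec k) tB convL_comb_ap.
suff c1 : c = 1 by rewrite /bohr hc// c1 mul1r.
pose g1 x : C := rc (tentV x) * chi (vec k) x.
have cg1 : cc g1.
  apply: (@cc_mul _ _ _ _ 1); [exact: cc_tentV|exact: uc_chi|].
  by move=> x; rewrite nrm_chi.
have := hc g1 cg1.
have -> : (fun x => g1 x * cj (chi (vec k) x)) = (fun x => rc (tentV x)).
  by apply/funext => x; rewrite /g1 -mulrA chi_conj mulr1.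
rewrite Int_tentV mulr1 => <-.
have -> : convL g1 comb = chi (vec k).
  apply/funext => x; rewrite -[RHS]mulr1 -(convL_comb_tentV x) /convL /g1 /comb.
  have ct : cc (fun y => rc (tentV (x - y)) : C) by exact: (cc_refl x (cc_tentV R d)).
  have [N sN] := supp_nat ct.
  have E (F : X -> C) : supp_in 0 N%:R F -> \sum_(k \in [set: K]) F (vec k) = \sum_(k <- box d N) F (vec k).
    by move=> sF; exact: combE sF (lexx _).
  rewrite (E (fun y => rc (tentV (x - y)))) // (E (fun y => rc (tentV (x - y)) * chi (vec k) (x - y))).
    rewrite mulr_sumr; apply: eq_bigr => j _.
    by rewrite chiDr chiNr chi_vec mulrC; congr (_ * _); rewrite -[1]/(rc 1) conjc_real mulr1.
  by move=> y i hy; rewrite (sN _ _ hy) mul0r.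
under eq_fun do rewrite chi_conj.
by rewrite Mean_cst.
Qed.

(** A lattice translation multiplies the twisted function by a number other than [1]. *)
Lemma bohr_comb_off g y : cc g -> (forall k, y <> vec k) -> bohr (convL g comb) y = 0.
Proof.
move=> cg hy.
have [i hi] : exists i, forall n : int, y 0 i <> n%:~R.
  apply: contrapT => /forallNP h; apply: (hy [ffun i => Num.floor (y 0 i)]).
  apply/rowP => i; rewrite !mxE ffunE; have /existsNP[n /contrapT ->] := h i.
  by rewrite intrKfloor.
pose l : K := [ffun j => (j == i)%:Z].
have vl : vec l = delta_mx 0 i.
  by apply/rowP => j; rewrite !mxE ffunE eqxx /=; case: eqP.
apply: (@Mean_eigen _ _ _ (vec l) (cj (ee (y 0 i)))); first by apply: ap_bohr; exact: (convL_comb_ap cg).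
  move=> x; rewrite convL_comb_period chiDr cjM.
  have -> : chi y (vec l) = ee (y 0 i) by rewrite vl chiE -[delta_mx _ _]scale1r dotp_delta mul1r.
  by ring.
apply/eqP => E; suff : ee (y 0 i) = 1 by case/ee_eq1 => n; exact: hi.
by rewrite -[LHS]cjK E -[1]/(rc 1) conjc_real.
Qed.

(** Unfolding: a periodic factor can be moved inside the periodization. *)
Lemma Mean_unfold g q : cc g -> uc q -> (forall x l, q (x + vec l) = q x) ->
  Mean (fun x => convL g comb x * q x) = Int (fun x => g x * q x).
Proof.
move=> cg uq pq; have [M M0 qM] := ap_bounded (periodic_ap uq pq).
have cgq : cc (fun x => g x * q x) by exact: cc_mul.
have := bohr_comb_on 0 cgq; rewrite vec0 /bohr.
under [fun x => _ * cj (chi 0 x)]eq_fun do rewrite chi0l -[1]/(rc 1) conjc_real mulr1.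
under [X in _ = Int X]eq_fun do rewrite chi0l -[1]/(rc 1) conjc_real mulr1.
move=> <-; congr Mean; apply/funext => x; rewrite /convL /comb.
have [N sN] := supp_nat (cc_refl x cg).
have E (F : X -> C) : supp_in 0 N%:R F -> \sum_(k \in [set: K]) F (vec k) = \sum_(k <- box d N) F (vec k).
  by move=> sF; exact: combE sF (lexx _).
rewrite (E (fun y => g (x - y))) // (E (fun y => g (x - y) * q (x - y))).
  by rewrite mulr_suml; apply: eq_bigr => j _; rewrite -vecN pq.
by move=> y i hy; rewrite (sN _ _ hy) mul0r.
Qed.

End comb.

(** * Sampling the Fourier transform of a compactly supported function *)

Section sampling.
Variables (R : realType) (d : nat).
Local Notation C := (CC R).
Local Notation X := 'rV[R]_d.
Local Notation K := {ffun 'I_d -> int}.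
Local Notation vec := (vec R).
Implicit Types (f g : X -> C) (x y a t u v : X) (k : K) (B M r e c : R).

Lemma cc_chi f y : cc f -> cc (fun x => f x * chi y x).
Proof.
move=> cf; apply: (@cc_mul _ _ _ _ 1) => //; first exact: uc_chi.
by move=> x; rewrite nrm_chi.
Qed.

Lemma inv_fourier_lin (z : C) f g y : cc f -> cc g ->
  inv_fourier (fun x => z * f x + g x) y = z * inv_fourier f y + inv_fourier g y.
Proof.
move=> cf cg; rewrite -[RHS](lin_Int z (cc_chi y cf) (cc_chi y cg)).
by congr Int; apply/funext => x; ring.
Qed.

Lemma inv_fourier_twist f y a : inv_fourier (fun x => f x * chi a x) y = inv_fourier f (y + a).
Proof. by congr Int; apply/funext => x; rewrite chiDl; ring. Qed.

Lemma inv_fourier_shift f t y : cc f ->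
  inv_fourier (fun x => f (x + t)) y = inv_fourier f y * cj (chi y t).
Proof.
move=> cf; rewrite [RHS]mulrC -[inv_fourier f y](tinv_Int t (cc_chi y cf)) -(linZ _ (@lin_Int R d)).
  congr Int; apply/funext => x; rewrite chiDr.
  transitivity (f (x + t) * chi y x * (chi y t * cj (chi y t))); first by rewrite chi_conj mulr1.
  by ring.
exact: cc_shift t (cc_chi y cf).
Qed.

Lemma inv_fourier_bound r : exists2 B, 0 <= B & forall f M, cc f -> supp_in 0 r f ->
  (forall x, nrm (f x) <= M) -> forall y, nrm (inv_fourier f y) <= B * M.
Proof.
have [B B0 hB] := @bdd_Int R d r; exists B => // f M cf sf fM y.
apply: hB; first exact: cc_chi.
  by move=> x i hx; rewrite (sf x i hx) mul0r.
by move=> x; rewrite nrmM nrm_chi mulr1.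
Qed.

Lemma chi_sub1 r v x : (forall i, `|x 0 i| <= r) ->
  nrm (chi v x - 1) <= 2 * pi * (r * \sum_i `|v 0 i|).
Proof.
move=> xr; rewrite chiE; apply: le_trans (ee_lip _) _.
rewrite ler_pM2l ?mulr_gt0 ?pi_gt0//; apply: le_trans (ler_norm_sum _ _ _) _.
rewrite mulr_sumr; apply: ler_sum => i _; rewrite normrM.
by rewrite ler_wpM2r.
Qed.

Lemma supp_chi1 f r a M e : supp_in 0 r f -> (forall x, nrm (f x) <= M) -> cc f ->
  (forall x, (forall i, `|x 0 i| <= r) -> nrm (chi a x - 1) <= e) -> 0 <= e ->
  [/\ cc (fun x => f x * (chi a x - 1)), supp_in 0 r (fun x => f x * (chi a x - 1)) &
      forall x, nrm (f x * (chi a x - 1)) <= e * M].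
Proof.
move=> sf fM cf he e0; have M0 : 0 <= M := le_trans (nrm_ge0 _) (fM 0); split.
- apply: (@cc_mul _ _ _ _ 2) => //.
    by apply: uc_add; [exact: uc_chi|exact: uc_cst].
  by move=> x; apply: le_trans (nrmB _ _) _; rewrite nrm_chi nrm1.
- by move=> x i hx; rewrite (sf x i hx) mul0r.
move=> x; have [h|/existsNP[i /negP]] := pselect (forall i, `|x 0 i| <= r).
  by rewrite nrmM mulrC ler_pM ?nrm_ge0//; exact: he.
by rewrite -ltNge => h; rewrite (sf x i) ?mul0r ?nrm0 ?mulr_ge0// mxE subr0.
Qed.

Lemma uc_inv_fourier f : cc f -> uc (inv_fourier f).
Proof.
move=> cf e e0; have [M M0 fM] := cc_bounded cf; have [_ [r0 sr0]] := cf.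
pose r := Num.max r0 0.
have sr : supp_in 0 r f by apply: supp_inW sr0; rewrite le_max lexx.
have r_ge0 : 0 <= r by rewrite le_max lexx orbT.
have [B B0 hB] := inv_fourier_bound r.
pose D := B * (2 * pi * (r * d%:R) * M).
have p0 : 0 <= pi :> R := pi_ge0 R.
have D0 : 0 <= D by rewrite !mulr_ge0.
exists (e / (D + 1)); first by rewrite divr_gt0// ltr_wpDl.
move=> y v hv; pose dl := e / (D + 1).
have dl0 : 0 <= dl by rewrite divr_ge0 ?addr_ge0// ltW.
have he x : (forall i, `|x 0 i| <= r) -> nrm (chi v x - 1) <= 2 * pi * (r * d%:R) * dl.
  move=> hx; apply: le_trans (chi_sub1 v hx) _; rewrite -!mulrA !ler_wpM2l//.
  rewrite mulr_natl -[X in _ *+ X]card_ord -sumr_const; apply: ler_sum => i _.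
  exact/ltW/hv.
have e1 : 0 <= 2 * pi * (r * d%:R) * dl by apply: mulr_ge0 => //; rewrite !mulr_ge0.
have [c1 c2 c3] := supp_chi1 sr fM cf he e1.
have -> : inv_fourier f (y + v) - inv_fourier f y = inv_fourier (fun x => f x * (chi v x - 1)) y.
  rewrite -inv_fourier_twist /inv_fourier -(linB (@lin_Int R d)).
  - by congr Int; apply/funext => x; ring.
  - exact: cc_chi y (cc_chi v cf).
  exact: cc_chi.
apply: le_trans (hB _ _ c1 c2 c3 y) _.
have -> : B * (2 * pi * (r * d%:R) * dl * M) = D * dl by rewrite /D; ring.
rewrite /dl mulrCA -[leRHS]mulr1 ler_pM2l// ler_pdivrMr ?ltr_wpDl//.
by rewrite mul1r lerDl.
Qed.

(** The samples on a translated lattice are Fourier coefficients of the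
    periodization of a modulation of [f], to which Bessel's inequality applies. *)
Lemma inv_fourier_bessel r : exists2 B, 0 <= B & forall f M a, cc f -> supp_in 0 r f ->
  (forall x, nrm (f x) <= M) -> forall s : seq K, uniq s ->
  \sum_(k <- s) nrm (inv_fourier f (vec k + a)) ^+ 2 <= B * M ^+ 2.
Proof.
have [B0 tB] := @tbf_comb R d; have [B B_ge0 hB] := convL_bound r tB.
exists (B ^+ 2); first exact: sqr_ge0.
move=> f M a cf sf fM s us.
pose g x := f x * chi a x.
have cg : cc g by exact: cc_chi.
have sg : supp_in 0 r g by move=> x i hx; rewrite /g (sf x i hx) mul0r.
have gM x : nrm (g x) <= M by rewrite nrmM nrm_chi mulr1.
have orth i j : i \in s -> j \in s ->
    Mean (fun x => chi (- vec i) x * cj (chi (- vec j) x)) = (i == j)%:R :> C.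
  by move=> _ _; rewrite chi_orth eqr_opp (inj_eq (@vec_inj R d)).
have := @Mean_bessel R X K (fun k => chi (- vec k)) (fun k => ap_chi _) s us orth
  (convL g (@comb R d)) (B * M) (convL_comb_ap cg) (hB g M cg sg gM).
rewrite exprMn; apply: le_trans.
apply: ler_sum => k _; rewrite -inv_fourier_twist -vecN -/(bohr _ _) bohr_comb_on//.
rewrite /inv_fourier -/(Int _); under [X in _ <= nrm (Int X) ^+ 2]eq_fun do rewrite vecN chiNl cjK.
exact: lexx.
Qed.

(** The sums of a subfamily of the steps [a] of [al], with bounds for
    [|chi a - 1|] on the support. *)
Fixpoint reach (al : seq (X * R)) u : Prop :=
  if al is p :: al' then reach al' u \/ reach al' (u - p.1) else u = 0.

Lemma reach_cat al al' u u' : reach al u -> reach al' u' -> reach (al ++ al') (u + u').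
Proof.
elim: al u => [|p al IH] u /=; first by move=> ->; rewrite add0r.
move=> [h|h] h'; [left|right]; first exact: IH.
by rewrite addrAC; exact: IH.
Qed.

Definition stepcost (al : seq (X * R)) : R := \prod_(p <- al) (1 + p.2).

Lemma sqr_young (p q e : R) : 0 < e -> (p + q) ^+ 2 <= (1 + e) * p ^+ 2 + (1 + e^-1) * q ^+ 2.
Proof.
move=> e0; rewrite -subr_ge0.
have -> : (1 + e) * p ^+ 2 + (1 + e^-1) * q ^+ 2 - (p + q) ^+ 2 = e^-1 * (e * p - q) ^+ 2.
  by field; rewrite gt_eqF.
by rewrite mulr_ge0 ?sqr_ge0// invr_ge0 ltW.
Qed.

(** Moving each point by a step [a] or not changes the sum of squares by the
    factor [(1 + e)^2] at most, since [f chi_a = f + f (chi_a - 1)]. *)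
Lemma inv_fourier_steps r : exists2 B, 0 <= B & forall al f M a, cc f -> supp_in 0 r f ->
  (forall x, nrm (f x) <= M) ->
  (forall p, p \in al -> 0 < p.2 /\
     forall x, (forall i, `|x 0 i| <= r) -> nrm (chi p.1 x - 1) <= p.2) ->
  forall (u : K -> X), (forall k, reach al (u k)) -> forall s : seq K, uniq s ->
  \sum_(k <- s) nrm (inv_fourier f (vec k + a + u k)) ^+ 2 <= B * stepcost al ^+ 2 * M ^+ 2.
Proof.
have [B B0 hB] := inv_fourier_bessel r; exists B => // al.
elim: al => [|[b e] al IH] f M a cf sf fM hal u hu s us.
  rewrite /stepcost big_nil expr1n mulr1; under eq_bigr do rewrite (hu _) addr0.
  exact: hB.
have [/= e0 he] := hal (b, e) (mem_head _ _).
have hal' p : p \in al -> 0 < p.2 /\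
     forall x, (forall i, `|x 0 i| <= r) -> nrm (chi p.1 x - 1) <= p.2.
  by move=> pal; apply: hal; rewrite inE pal orbT.
pose u' k := if pselect (reach al (u k)) then u k else u k - b.
have hu' k : reach al (u' k).
  by rewrite /u'; case: pselect => // h; have [|] := hu k.
have [c1 c2 c3] := supp_chi1 sf fM cf he (ltW e0).
have i1 := IH f M a cf sf fM hal' u' hu' s us.
have i2 := IH _ _ a c1 c2 c3 hal' u' hu' s us.
have pt k : nrm (inv_fourier f (vec k + a + u k)) ^+ 2 <=
    (1 + e) * nrm (inv_fourier f (vec k + a + u' k)) ^+ 2 +
    (1 + e^-1) * nrm (inv_fourier (fun x => f x * (chi b x - 1)) (vec k + a + u' k)) ^+ 2.
  apply: le_trans (sqr_young _ _ e0); rewrite ler_sqr ?nnegrE ?addr_ge0 ?nrm_ge0//.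
  rewrite /u'; case: pselect => h; first by rewrite lerDl nrm_ge0.
  apply: le_trans (nrmD _ _); set y := vec k + a + (u k - b).
  have -> : vec k + a + u k = y + b by rewrite /y addrA subrK.
  rewrite -inv_fourier_twist /inv_fourier -(linD (@lin_Int R d)).
  - by rewrite le_eqVlt; apply/orP; left; apply/eqP; congr (nrm (Int _)); apply/funext => x; ring.
  - exact: cc_chi.
  exact: cc_chi.
apply: le_trans (ler_sum _ (fun k _ => pt k)) _; rewrite big_split /= -!mulr_sumr.
apply: le_trans (lerD (ler_wpM2l _ i1) (ler_wpM2l _ i2)) _.
- by rewrite addr_ge0// ltW.
- by rewrite addr_ge0// invr_ge0 ltW.
rewrite /stepcost big_cons /= le_eqVlt; apply/orP; left; apply/eqP.
by field; rewrite gt_eqF.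
Qed.

End sampling.

Section amalgam_fourier.
Variables (R : realType) (d : nat).
Local Notation C := (CC R).
Local Notation X := 'rV[R]_d.
Local Notation K := {ffun 'I_d -> int}.
Local Notation vec := (vec R).
Implicit Types (f g : X -> C) (x y a u v : X) (k : K) (B M r e c t : R).

(** Binary digits: the steps [c, c/2, c/4, ...] in direction [i]. *)
Fixpoint halvings r (i : 'I_d) c n : seq (X * R) :=
  if n is n'.+1 then (c *: delta_mx 0 i, 2 * pi * (r * c)) :: halvings r i (c / 2) n' else [::].

Lemma halvings_reach r i c n t : 0 <= t <= 2 * c -> exists2 t' : R,
  reach (halvings r i c n) (t' *: delta_mx 0 i) & `|t - t'| <= 2 * c / 2 ^+ n.
Proof.
elim: n c t => [|n IH] c t /andP[t0 tc].
  by exists 0; rewrite /= ?scale0r// subr0 expr0 divr1 ger0_norm.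
have E : 2 * (c / 2) / 2 ^+ n = 2 * c / 2 ^+ n.+1 :> R.
  by rewrite exprS; field; rewrite expf_neq0.
have [ct|ct] := leP c t.
  have [|t' h1 h2] := IH (c / 2) (t - c); first by apply/andP; split; lra.
  exists (t' + c); last by rewrite opprD [- t' - c]addrC addrA -E.
  by right; rewrite /= -scalerBl addrK.
have [|t' h1 h2] := IH (c / 2) t; first by apply/andP; split; lra.
by exists t'; [left|rewrite -E].
Qed.

(** The bound does not depend on [n], because the steps are summable. *)
Lemma halvings_cost r i c n : 0 <= r -> 0 <= c ->
  1 <= stepcost (halvings r i c n) <= expR (4 * pi * (r * c)).
Proof.
move=> r0; elim: n c => [|n IH] c c0.
  rewrite /stepcost big_nil lexx /=; have := expR_ge1Dx (4 * pi * (r * c)).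
  apply: le_trans; rewrite lerDl !mulr_ge0 ?pi_ge0//.
rewrite /stepcost big_cons -/(stepcost _) /=.
have p0 : 0 <= 2 * pi * (r * c) by rewrite !mulr_ge0 ?pi_ge0.
have /andP[h1 h2] := IH (c / 2) (divr_ge0 c0 (ler0n _ 2)).
apply/andP; split; first by rewrite -[leLHS]mulr1 ler_pM// lerDl.
have -> : 4 * pi * (r * c) = 2 * pi * (r * c) + 4 * pi * (r * (c / 2)) by field.
rewrite expRD ler_pM//; [by rewrite addr_ge0|exact: le_trans h1|exact: expR_ge1Dx].
Qed.

Lemma halvings_bound r i c n p : 0 < r -> 0 < c -> p \in halvings r i c n ->
  0 < p.2 /\ forall x, (forall i, `|x 0 i| <= r) -> nrm (chi p.1 x - 1) <= p.2.
Proof.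
move=> r0; elim: n c => [//|n IH] c c0; rewrite /= inE => /orP[/eqP ->|]; last first.
  by apply: IH; rewrite divr_gt0.
split; first by rewrite /= !mulr_gt0 ?pi_gt0.
move=> x hx; apply: le_trans (chi_sub1 _ hx) _.
rewrite le_eqVlt; apply/orP; left; apply/eqP; congr (_ * (_ * _)).
rewrite (bigD1 i)//= big1 => [|j /negPf ji]; first by rewrite !mxE !eqxx mulr1 addr0 gtr0_norm.
by rewrite !mxE ji andbF mulr0 normr0.
Qed.

Definition grid r n : seq (X * R) := flatten [seq halvings r i 1 n | i <- enum 'I_d].

Lemma grid_reach r n u : (forall i, 0 <= u 0 i <= 2) -> exists2 u',
  reach (grid r n) u' & forall i, `|u 0 i - u' 0 i| <= 2 / 2 ^+ n.
Proof.
move=> hu.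
have ex i : exists t' : R, reach (halvings r i 1 n) (t' *: delta_mx 0 i) /\ `|u 0 i - t'| <= 2 / 2 ^+ n.
  have [|t' h1 h2] := @halvings_reach r i 1 n (u 0 i); first by rewrite mulr1.
  by exists t'; rewrite mulr1 in h2.
have [t ht] := choice ex; exists (\sum_i t i *: delta_mx 0 i).
  have -> : \sum_i t i *: delta_mx 0 i = \sum_(i <- enum 'I_d) t i *: delta_mx 0 i :> X.
    by rewrite big_enum.
  rewrite /grid.
  elim: (enum _) => [|i s IH]; first by rewrite big_nil.
  by rewrite big_cons /=; apply: reach_cat => //; have [] := ht i.
move=> i; have [_] := ht i.
rewrite summxE (bigD1 i)//= big1 ?addr0 => [|j /negPf ji]; first by rewrite !mxE !eqxx mulr1.
by rewrite !mxE eq_sym ji andbF mulr0.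
Qed.

Lemma grid_cost r n : 0 <= r -> 0 <= stepcost (grid r n) <= expR (4 * pi * r) ^+ d.
Proof.
move=> r0; rewrite /grid -[X in _ ^+ X](size_enum_ord d).
elim: (enum _) => [|i s IH] /=; first by rewrite /stepcost big_nil expr0 ler01 lexx.
have /andP[h1 h2] := @halvings_cost r i 1 n r0 ler01; have /andP[h3 h4] := IH.
rewrite /stepcost big_cat /= -!/(stepcost _); have h5 := le_trans ler01 h1.
by rewrite mulr_ge0//= exprS ler_pM//; rewrite mulr1 in h2.
Qed.

Lemma grid_bound r n p : 0 < r -> p \in grid r n ->
  0 < p.2 /\ forall x, (forall i, `|x 0 i| <= r) -> nrm (chi p.1 x - 1) <= p.2.
Proof. by move=> r0 /flattenP[_ /mapP[i _ ->]]; exact: halvings_bound. Qed.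

(** The point chosen in the cell of [k] is nearly the sum of a lattice point and
    binary digits in each direction. The cost of the digits does not depend on
    their number, so uniform continuity absorbs the remainder. *)
Lemma sampled_bessel f : cc f -> exists2 B, 0 <= B & forall (s : seq K) (y : K -> X), uniq s ->
  (forall k i, `|y k 0 i - (k i)%:~R| <= 1) ->
  \sum_(k <- s) nrm (inv_fourier f (y k)) ^+ 2 <= B.
Proof.
move=> cf; have [M M0 fM] := cc_bounded cf; have [_ [r0 sr0]] := cf.
pose r := Num.max r0 1.
have sr : supp_in 0 r f by apply: supp_inW sr0; rewrite le_max lexx.
have r_gt0 : 0 < r by rewrite lt_max ltr01 orbT.
have [B B0 hB] := @inv_fourier_steps R d r.
pose D := B * (expR (4 * pi * r) ^+ d) ^+ 2 * M ^+ 2.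
have D0 : 0 <= D by rewrite !mulr_ge0 ?sqr_ge0.
exists (2 * D + 2); first by rewrite addr_ge0// mulr_ge0.
move=> s y us hy.
(* [n] digits leave an error [e] at each of the points [s], small enough for
   the sum of the squared errors to be at most [1] *)
pose e : R := (size s).+1%:R^-1; have e0 : 0 < e by rewrite invr_gt0.
have [dl dl0 hdl] := uc_inv_fourier cf e0.
have [n hn] : exists n : nat, 2 / 2 ^+ n < dl.
  have [m hm] := inv_le_small (divr_gt0 dl0 (ltr0Sn R 2)).
  exists m; have m0 : 0 < 2 ^+ m :> R by rewrite exprn_gt0.
  have : (2 ^+ m : R)^-1 <= m.+1%:R^-1.
    by rewrite lef_pV2 ?posrE// -natrX ler_nat ltn_expl.
  move=> h; have := le_trans h hm; set q := (_ ^-1); lra.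
(* the shift by [1] makes the digits nonnegative *)
have ex k : exists u', reach (grid r n) u' /\ forall i, `|y k 0 i - (k i)%:~R + 1 - u' 0 i| <= 2 / 2 ^+ n.
  have [i|u' h1 h2] := @grid_reach r n (y k - vec k + const_mx 1).
    by rewrite !mxE; have := hy k i; rewrite ler_norml => /andP[*]; apply/andP; split; lra.
  by exists u'; split=> // i; have := h2 i; rewrite !mxE.
have [u hu] := choice ex.
have b1 := hB (grid r n) f M (- const_mx 1) cf sr fM (fun p => grid_bound r_gt0) u (fun k => (hu k).1) s us.
have b2 : B * stepcost (grid r n) ^+ 2 * M ^+ 2 <= D.
  have /andP[g0 g1] := grid_cost n (ltW r_gt0).
  by rewrite ler_wpM2r ?sqr_ge0// ler_wpM2l// ler_sqr ?nnegrE// exprn_ge0.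
have pt k : nrm (inv_fourier f (y k)) ^+ 2 <=
   2 * nrm (inv_fourier f (vec k + - const_mx 1 + u k)) ^+ 2 + 2 * e ^+ 2.
  set z := vec k + - const_mx 1 + u k.
  have h : nrm (inv_fourier f (y k) - inv_fourier f z) <= e.
    have -> : y k = z + (y k - z) by rewrite addrC subrK.
    apply: hdl => i; apply: le_lt_trans hn; have := (hu k).2 i.
    by rewrite !mxE; congr (`|_| <= _); ring.
  have := nrm_tri (inv_fourier f (y k)) (inv_fourier f z) 0; rewrite !subr0 => h'.
  have n0 := nrm_ge0 (inv_fourier f (y k)); have n1 := nrm_ge0 (inv_fourier f z).
  have := sqr_young (nrm (inv_fourier f z)) e ltr01; rewrite invr1; apply: le_trans.
  rewrite ler_sqr ?nnegrE ?(addr_ge0 n1 (ltW e0))//.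
  by apply: le_trans h' _; rewrite addrC lerD2l.
apply: le_trans (ler_sum _ (fun k _ => pt k)) _.
rewrite big_split /= -mulr_sumr; apply: lerD.
  by rewrite ler_wpM2l//; exact: le_trans b1 b2.
rewrite big_const_seq count_predT iter_addr_0 -[_ *+ _]mulr_natr -mulrA -[leRHS]mulr1 ler_wpM2l//.
have e_le1 : e <= 1 by rewrite /e invf_le1 ?ler1n.
have es : e * (size s)%:R <= 1 by rewrite /e mulrC ler_pdivrMr// mul1r ler_nat.
have es0 : 0 <= e * (size s)%:R by apply: mulr_ge0; [exact: ltW|].
by rewrite expr2 -mulrA; apply: mulr_ile1 => //; exact: ltW.
Qed.

(** The power spectrum. *)
Definition power f y : C := rc (nrm (inv_fourier f y) ^+ 2).

Lemma powerE f : (fun y => `|inv_fourier f y| ^+ 2) = power f.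
Proof. by apply/funext => y; rewrite nrmE -rmorphXn. Qed.

Lemma power_conj f y : power f y = inv_fourier f y * cj (inv_fourier f y).
Proof. by rewrite mulcJ. Qed.

Lemma uc_power f : cc f -> uc (power f).
Proof.
move=> cf; have [M M0 fM] := cc_bounded cf; have [_ [r sr]] := cf.
have [B B0 hB] := @inv_fourier_bound R d r; have h := hB f M cf sr fM.
rewrite (_ : power f = fun y => inv_fourier f y * cj (inv_fourier f y)); last first.
  by apply/funext => y; exact: power_conj.
apply: (@uc_mul _ _ _ _ (B * M)) => //; first by move=> x; rewrite nrm_conj.
  exact: uc_inv_fourier.
exact/uc_conj/uc_inv_fourier.
Qed.

(** A point where the supremum over the cell is nearly attained serves as a sample. *)
Lemma amal_power f : cc f -> exists w D, amal (power f) w D.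
Proof.
move=> cf; have [B B0 hB] := sampled_bessel cf.
have npow y : nrm (power f y) = nrm (inv_fourier f y) ^+ 2.
  by rewrite nrm_real ger0_norm// sqr_ge0.
pose cell k := [set x : X | forall i, `|x 0 i - (k i)%:~R| <= 1].
have cellk k : cell k (vec k) by move=> i; rewrite mxE subrr normr0.
pose w k := sup [set nrm (power f x) | x in cell k].
have hs k : has_sup [set nrm (power f x) | x in cell k].
  split; first by exists (nrm (power f (vec k))), (vec k).
  exists B => _ [x xk <-]; rewrite npow.
  have := hB [:: k] (fun j => if j == k then x else vec j) isT; rewrite big_seq1 eqxx; apply.
  by move=> j i; case: eqP => [->|_]; [exact: xk|exact: cellk].
have wub k x : cell k x -> nrm (power f x) <= w k.
  by move=> xk; apply: ub_le_sup; [exact: (hs k).2|exists x].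
have ex k : exists x, cell k x /\ w k <= 2 * nrm (power f x).
  have [w0|w0] := ltP 0 (w k); last first.
    by exists (vec k); split=> //; apply: le_trans w0 _; rewrite mulr_ge0 ?nrm_ge0.
  have [_ [x xk <-] h] := sup_adherent (divr_gt0 w0 (ltr0Sn R 1)) (hs k).
  by exists x; split=> //; rewrite -/(w k) in h; lra.
have [y hy] := choice ex; exists w, (2 * B); split; first exact: wub.
move=> s us; apply: le_trans (ler_sum _ (fun k _ => (hy k).2)) _.
rewrite -mulr_sumr ler_wpM2l//; under eq_bigr do rewrite npow.
by apply: hB => // k i; exact: (hy k).1.
Qed.

End amalgam_fourier.

(** * The Plancherel formula *)

Section plancherel.
Variables (R : realType) (d : nat).
Local Notation C := (CC R).
Local Notation X := 'rV[R]_d.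
Local Notation K := {ffun 'I_d -> int}.
Local Notation vec := (vec R).
Local Notation comb := (@comb R d).
Implicit Types (f g : X -> C) (x y a t u v : X) (k : K) (M r e : R) (N : nat).

(** Parseval for the periodization of [f], whose coefficients vanish off the lattice
    and are samples of the transform on it. *)
Lemma comb_parseval f : cc f ->
  ssum (fun k : K => power f (vec k)) (Mean (fun x => convL f comb x * cj (convL f comb x))).
Proof.
move=> cf e e0; set p := convL f comb.
have [Y0 hY] := parseval (convL_comb_ap cf) (convL_comb_uc cf) e0.
exists [seq [ffun i => - Num.floor (y 0 i)] | y : X <- Y0] => s us ss.
pose L := [seq - vec k | k <- s].
have uL : uniq L by rewrite map_inj_uniq// => k l /oppr_inj /vec_inj.
pose Y := L ++ [seq y <- undup Y0 | y \notin L].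
have uY : uniq Y.
  rewrite cat_uniq uL filter_uniq ?undup_uniq// andbT /=.
  by apply/hasPn => y; rewrite mem_filter => /andP[].
have sY : {subset Y0 <= Y}.
  move=> y yY; rewrite mem_cat mem_filter mem_undup yY andbT.
  by case: (y \in L).
have Z : \sum_(y <- [seq y <- undup Y0 | y \notin L]) rc (nrm (bohr p y) ^+ 2) = 0 :> C.
  rewrite big_seq big1// => y; rewrite mem_filter mem_undup => /andP[yL yY].
  rewrite bohr_comb_off// ?nrm0 ?expr0n// => k yk; case/negP: yL.
  apply/mapP; exists (- k); last by rewrite vecN opprK.
  apply: ss; apply/mapP; exists y => //; apply/ffunP => i.
  by rewrite !ffunE yk mxE intrKfloor.
have := hY Y uY sY; rewrite big_cat /= Z addr0 big_map; congr (nrm (_ - _) <= _); apply: eq_bigr => k _.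
suff -> : bohr p (- vec k) = inv_fourier f (vec k) by [].
rewrite -vecN bohr_comb_on//.
by congr Int; apply/funext => x; rewrite vecN chiNl cjK.
Qed.

Lemma cc_modulate f a : cc f -> cc (fun x => f x * cj (chi a x)).
Proof.
move=> cf; apply: (@cc_mul _ _ _ _ 1) => //; first exact/uc_conj/uc_chi.
by move=> x; rewrite nrm_conj nrm_chi.
Qed.

Lemma power_modulate f a y : power (fun x => f x * cj (chi a x)) y = power f (y - a).
Proof.
suff E : inv_fourier (fun x => f x * cj (chi a x)) y = inv_fourier f (y - a) by rewrite /power E.
rewrite -inv_fourier_twist; congr inv_fourier.
by apply/funext => x; rewrite chiNl.
Qed.

(** The square mean of the periodization of [f] modulated by [a]. *)
Definition period_mean f a : C :=
  Mean (fun x => convL (fun x => f x * cj (chi a x)) comb x *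
                 cj (convL (fun x => f x * cj (chi a x)) comb x)).

(** Modulating [f] translates its power spectrum, so this is Parseval again. *)
Lemma ext_comb f F a : cc f -> ext_lim comb (power f) F -> F a = period_mean f a.
Proof.
move=> cf hF; apply: nrm_eq => e e0.
have e8 : 0 < e / 8 by rewrite divr_gt0.
have [w [D am]] := amal_power cf; have uh := uc_power cf.
set S := period_mean f a.
have [s0 hs0] := comb_parseval (cc_modulate a cf) e8.
have [N0 hN0] := hF _ e8; have [N1 hN1] := seq_in_box s0.
pose r := \sum_i `|a 0 i|.
have ar i : `|a 0 i| <= r by rewrite /r (bigD1 i)//= lerDl sumr_ge0.
pose N := (N0 + N1 + (Num.truncn r).+1)%N.
have [N2 sN2] := supp_nat (cc_trunc N a uh am).
pose N3 := maxn N1 N2.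
pose u k := nrm (inv_fourier f (vec k - a)) ^+ 2.
pose v k := u k * cutoff N (vec k - a).
have u0 k : 0 <= u k by exact: sqr_ge0.
have v0 k : 0 <= v k by rewrite mulr_ge0 ?cut_ge0.
have vu k : v k <= u k by rewrite -[leRHS]mulr1 ler_wpM2l// cut_le1.
have vE k : k \in box d N1 -> v k = u k.
  move=> kN; rewrite /v cut1 ?mulr1// => i; have := mem_box_le R kN i; have := ar i.
  rewrite !mxE; have := ler_normB (k i)%:~R (a 0 i); have := ltW (truncnS_gt r).
  rewrite /N !natrD; have := ler0n R N0; lra.
have T : comb (trunc (power f) N a) = rc (\sum_(k <- box d N3) v k).
  rewrite (combE sN2 (N := N3)); last by rewrite ler_nat leq_maxr.
  by rewrite rmorph_sum; apply: eq_bigr => k _; rewrite /v [RHS]rmorphM.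
have pE s : \sum_(k <- s) power (fun x => f x * cj (chi a x)) (vec k) = rc (\sum_(k <- s) u k).
  by rewrite rmorph_sum; apply: eq_bigr => k _; rewrite power_modulate.
have sub13 k : k \in box d N1 -> k \in box d N3.
  rewrite !mem_box => /forallP h; apply/forallP => i; apply: leq_trans (h i) _.
  exact: leq_maxl.
have b1 := hs0 (box d N1) (box_uniq d N1) hN1.
have b3 := hs0 (box d N3) (box_uniq d N3) (fun k ks => sub13 _ (hN1 _ ks)).
rewrite pE -/S in b1; rewrite pE -/S in b3.
have lo : \sum_(k <- box d N1) u k <= \sum_(k <- box d N3) v k.
  rewrite [leRHS](bigID (mem (box d N1))) /= -[leLHS]addr0; apply: lerD; last by apply: sumr_ge0.
  rewrite le_eqVlt; apply/orP; left; apply/eqP.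
  rewrite -[RHS]big_filter big_seq; under eq_bigr => k kN do rewrite -(vE k kN).
  rewrite -big_seq; have pe : perm_eq (box d N1) [seq k <- box d N3 | k \in box d N1].
    apply: uniq_perm => [||k]; rewrite ?filter_uniq ?box_uniq// mem_filter.
    by case kN: (k \in box d N1) => //=; rewrite sub13.
  by rewrite (perm_big _ pe).
have hi : \sum_(k <- box d N3) v k <= \sum_(k <- box d N3) u k by exact: ler_sum.
have b4 : nrm (F a - rc (\sum_(k <- box d N3) v k)) <= e / 8.
  by rewrite -T; apply: hN0; rewrite /N -addnA leq_addr.
have b5 : nrm (rc (\sum_(k <- box d N3) v k) - rc (\sum_(k <- box d N3) u k) : C) <= e / 4.
  have := nrm_tri (rc (\sum_(k <- box d N3) u k) : C) S (rc (\sum_(k <- box d N1) u k)).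
  rewrite (nrmC (rc (\sum_(k <- box d N3) u k)) S) -rmorphB nrm_real => h.
  rewrite -rmorphB nrm_real distrC ger0_norm ?subr_ge0//.
  have := ler_norm (\sum_(k <- box d N3) u k - \sum_(k <- box d N1) u k); lra.
have := nrm_tri (F a) (rc (\sum_(k <- box d N3) v k)) S.
have := nrm_tri (rc (\sum_(k <- box d N3) v k)) (rc (\sum_(k <- box d N3) u k)) S.
by rewrite (nrmC (rc (\sum_(k <- box d N3) u k)) S); lra.
Qed.

Lemma cc_corr f g t : cc f -> cc g -> cc (fun x => f x * cj (g (x - t))).
Proof.
move=> cf cg; have [M M0 gM] := cc_bounded cg; apply: (@cc_mul _ _ _ _ M) => //.
  by apply: uc_conj; apply: uc_shift; case: cg.
by move=> x; rewrite nrm_conj.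
Qed.

(** By unfolding, the square mean of the periodization is a trigonometric
    polynomial in the modulation parameter. *)
Lemma period_meanE f : cc f -> exists N, forall a, period_mean f a =
  \sum_(k <- box d N) Int (fun x => f x * cj (f (x - vec k))) * cj (chi (vec k) a).
Proof.
move=> cf; have [N0 sN] := supp_nat cf; exists (N0 + N0)%N => a.
pose g x := f x * cj (chi a x); have cg : cc g by exact: cc_modulate.
rewrite /period_mean (Mean_unfold cg (q := fun x => cj (convL g comb x))); last 2 first.
- exact/uc_conj/(convL_comb_uc cg).
- by move=> x l; rewrite convL_comb_period.
transitivity (Int (fun x => \sum_(k <- box d (N0 + N0)) cj (chi (vec k) a) * (f x * cj (f (x - vec k))))).
  congr Int; apply/funext => x.
  have [fx|fx] := eqVneq (f x) 0.
    by rewrite /g fx !mul0r big1// => k _; rewrite mul0r mulr0.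
  have xN i : `|x 0 i| <= N0%:R.
    by rewrite leNgt; apply: contra_neqN fx => h; apply: (sN x i); rewrite mxE subr0.
  rewrite /convL (@combE _ _ _ (N0 + N0)%:R (N0 + N0))//; last first.
    move=> y i hy; rewrite /g (sN _ i) ?mul0r//; move: hy; rewrite !mxE !subr0 natrD.
    have := ler_normD (x 0 i - y 0 i) (- x 0 i).
    by rewrite normrN addrAC subrr add0r normrN; have := xN i; lra.
  rewrite cj_sum mulr_sumr; apply: eq_bigr => k _.
  rewrite /g cjM chiDr chiNr !cjM !cjK (chiC a (vec k)).
  transitivity (cj (chi (vec k) a) * (f x * cj (f (x - vec k))) * (chi a x * cj (chi a x))).
    by ring.
  by rewrite chi_conj mulr1.
rewrite (lin_sum _ (@lin_Int R d)); last by move=> k; apply: cc_scale; exact: cc_corr.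
by apply: eq_bigr => k _; rewrite [RHS]mulrC; exact: (linZ _ (@lin_Int R d) (cc_corr (vec k) cf cf)).
Qed.

Lemma Mean_period f : cc f -> Mean (period_mean f) = Int (fun x => f x * cj (f x)).
Proof.
move=> cf; have [N hN] := period_meanE cf.
rewrite (funext hN).
have ac (k : K) : ap (fun a : X => cj (chi (vec k) a)) by exact: ap_cchi.
rewrite Mean_sum; last by move=> k; exact: (ap_scale _ (ac k)).
rewrite (bigD1_seq 0) ?box_uniq//=; last by rewrite mem_box; apply/forallP => i; rewrite ffunE.
rewrite big1 ?addr0 => [|k k0].
  rewrite vec0 (MeanZ _ (ap_cchi 0)) Mean_conj; last exact: ap_chi.
  rewrite Mean_chi eqxx -[1%:R]/(rc 1 : C) conjc_real mulr1.
  by congr Int; apply/funext => x; rewrite subr0.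
rewrite (MeanZ _ (ac k)) Mean_conj; last exact: ap_chi.
rewrite Mean_chi -vec0 (inj_eq (@vec_inj R d)) (negPf k0).
by rewrite -[0%:R]/(rc 0 : C) conjc_real mulr0.
Qed.

(** Apply the machinery to the comb, whose coefficient at the origin is [1]: the
    mean of its function [F] is the integral of the power spectrum, and, [F]
    being a trigonometric polynomial, it is also the constant term. *)
Theorem plancherel f e : cc f -> 0 < e -> exists N0, forall N, (N0 <= N)%N ->
  nrm (Int (fun x => f x * cj (f x)) - Int (trunc (power f) N 0)) <= e.
Proof.
move=> cf e0; have [w [D am]] := amal_power cf; have uh := uc_power cf.
have [B tB] := @tbf_Int R d; have [B' tB'] := @tbf_comb R d.
have [J hJ] := ext_exists tB uh am; have [F hF] := ext_exists tB' uh am.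
have EF : F = period_mean f by apply/funext => a; exact: ext_comb.
have co g : cc g -> Mean (fun x => convL g comb x * cj (chi 0 x)) = 1 * Int (fun x => g x * cj (chi 0 x)).
  by move=> cg; have := bohr_comb_on 0 cg; rewrite vec0 mul1r.
have := @ext_coefficient R d comb B' (power f) w D F 0 1 (J 0) tB' (@convL_comb_ap R d) uh am hF co.
rewrite mul1r.
have E1 : (fun x => F x * cj (chi 0 x)) = period_mean f.
  by apply/funext => x; rewrite chi0l -[1]/(rc 1) conjc_real mulr1 EF.
rewrite E1 (Mean_period cf) => ->.
  by have [N0 h] := hJ e e0; exists N0 => N hN; exact: h.
move=> e1 /hJ[N0 h]; exists N0 => N hN.
by under [X in Int X]eq_fun do rewrite chi0l mulr1; exact: h.
Qed.

End plancherel.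

Section inversion.
Variables (R : realType) (d : nat).
Local Notation C := (CC R).
Local Notation X := 'rV[R]_d.
Implicit Types (f g : X -> C) (x y t : X) (M r e : R) (N : nat) (z w c : C) (L : (X -> C) -> C).

Let im : C := (0 +i* 1)%C.

Let im2 : im * im = -1.
Proof. by apply/eqP; rewrite eq_complex /= !(mul0r, mulr0, mulr1, add0r, addr0, sub0r, oppr0) !eqxx. Qed.

Let cj_im : cj im = - im.
Proof. by apply/eqP; rewrite eq_complex /= oppr0 !eqxx. Qed.

Let cj0 : cj 0 = 0 :> C. Proof. exact: (conjc_real (0 : R)). Qed.

Lemma polarization z w : 4 * (z * cj w) =
  (z + w) * cj (z + w) - (z - w) * cj (z - w) +
  im * ((z + im * w) * cj (z + im * w)) - im * ((z - im * w) * cj (z - im * w)).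
Proof.
rewrite !cjB !cjD !cjM cj_im.
transitivity (2 * (z * cj w) + 2 * (w * cj z) - 2 * (im * im) * (z * cj w) + 2 * (im * im) * (w * cj z)); last by ring.
by rewrite im2; ring.
Qed.

Lemma lin4 L c f1 f2 f3 f4 : lin L -> cc f1 -> cc f2 -> cc f3 -> cc f4 ->
  L (fun x => f1 x - f2 x + c * f3 x - c * f4 x) = L f1 - L f2 + c * L f3 - c * L f4.
Proof.
move=> lL c1 c2 c3 c4.
rewrite (linB (f := fun x => f1 x - f2 x + c * f3 x) (g := fun x => c * f4 x) lL); last 2 first.
- by apply: cc_add; [exact: cc_sub|exact: cc_scale].
- exact: cc_scale.
rewrite (linD (f := fun x => f1 x - f2 x) (g := fun x => c * f3 x) lL); last 2 first.
- exact: cc_sub.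
- exact: cc_scale.
by rewrite linB// !linZ.
Qed.

Definition cross f g y : C := inv_fourier f y * cj (inv_fourier g y).

(** The Plancherel formula for two functions, by polarization. *)
Lemma plancherel2 f g e : cc f -> cc g -> 0 < e -> exists N0, forall N, (N0 <= N)%N ->
  nrm (Int (fun x => f x * cj (g x)) - Int (trunc (cross f g) N 0)) <= e.
Proof.
move=> cf cg e0.
pose h (c : C) x := c * g x + f x.
have ch c : cc (h c) by apply: cc_add => //; exact: cc_scale.
have fh c y : inv_fourier (h c) y = inv_fourier f y + c * inv_fourier g y.
  by rewrite inv_fourier_lin// addrC.
have [N1 p1] := plancherel (ch 1) e0; have [N2 p2] := plancherel (ch (-1)) e0.
have [N3 p3] := plancherel (ch im) e0; have [N4 p4] := plancherel (ch (- im)) e0.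
exists (N1 + N2 + N3 + N4)%N => N hN.
pose De c := Int (fun x => h c x * cj (h c x)) - Int (trunc (power (h c)) N 0).
have {}p1 : nrm (De 1) <= e by apply: p1; lia.
have {}p2 : nrm (De (-1)) <= e by apply: p2; lia.
have {}p3 : nrm (De im) <= e by apply: p3; lia.
have {}p4 : nrm (De (- im)) <= e by apply: p4; lia.
have cI c : cc (fun x => h c x * cj (h c x)).
  by have := cc_corr 0 (ch c) (ch c); under eq_fun do rewrite subr0.
have cT c : cc (trunc (power (h c)) N 0).
  by have [w [D am]] := amal_power (ch c); apply: cc_trunc am; exact: uc_power.
have cfg : cc (fun x => f x * cj (g x)).
  by have := cc_corr 0 cf cg; under eq_fun do rewrite subr0.
have E1 : 4 * Int (fun x => f x * cj (g x)) =
   Int (fun x => h 1 x * cj (h 1 x)) - Int (fun x => h (-1) x * cj (h (-1) x)) +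
   im * Int (fun x => h im x * cj (h im x)) - im * Int (fun x => h (- im) x * cj (h (- im) x)).
  rewrite -(lin4 im (@lin_Int R d) (cI 1) (cI (-1)) (cI im) (cI (- im))) -(linZ _ (@lin_Int R d))//.
  congr Int; apply/funext => x; rewrite polarization /h.
  by congr (_ * cj _ - _ * cj _ + im * (_ * cj _) - im * (_ * cj _)); ring.
have E2 : (fun x => 4 * trunc (cross f g) N 0 x) =
   (fun x => trunc (power (h 1)) N 0 x - trunc (power (h (-1))) N 0 x +
     im * trunc (power (h im)) N 0 x - im * trunc (power (h (- im))) N 0 x).
  apply/funext => x; rewrite /trunc !power_conj !fh /cross; set q := rc _.
  transitivity (4 * (inv_fourier f (x - 0) * cj (inv_fourier g (x - 0))) * q); first by ring.
  rewrite polarization mul1r mulN1r mulNr; ring.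
have ccr : cc (trunc (cross f g) N 0).
  have c4 : cc (fun x => 4 * trunc (cross f g) N 0 x).
    by rewrite E2; apply: cc_sub; [apply: cc_add; [exact: cc_sub|exact: cc_scale]|exact: cc_scale].
  have := cc_scale 4^-1 c4; congr cc; apply/funext => x.
  by rewrite mulKf// pnatr_eq0.
have E3 : 4 * Int (trunc (cross f g) N 0) =
   Int (trunc (power (h 1)) N 0) - Int (trunc (power (h (-1))) N 0) +
   im * Int (trunc (power (h im)) N 0) - im * Int (trunc (power (h (- im))) N 0).
  rewrite -(lin4 im (@lin_Int R d) (cT 1) (cT (-1)) (cT im) (cT (- im))) -(linZ _ (@lin_Int R d))//.
  by rewrite E2.
have alg (a1 b1 a2 b2 a3 b3 a4 b4 : C) :
    a1 - a2 + im * a3 - im * a4 - (b1 - b2 + im * b3 - im * b4) =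
    (a1 - b1) - (a2 - b2) + im * (a3 - b3) - im * (a4 - b4) by ring.
have E : 4 * (Int (fun x => f x * cj (g x)) - Int (trunc (cross f g) N 0)) =
    De 1 - De (-1) + im * De im - im * De (- im).
  by rewrite mulrBr E1 E3; exact: alg.
have ni : nrm im = 1.
  by have := mulcJ im; rewrite cj_im mulrN im2 opprK => /(congr1 (@complex.Re R)) /= /esym /eqP;
    rewrite sqrp_eq1 ?nrm_ge0// => /eqP.
have : nrm (4 * (Int (fun x => f x * cj (g x)) - Int (trunc (cross f g) N 0))) <= 4 * e.
  rewrite E; apply: le_trans (nrmB _ _) _; rewrite nrmM ni mul1r.
  have n1 := nrmD (De 1 - De (-1)) (im * De im); rewrite [nrm (im * _)]nrmM ni mul1r in n1.
  have n2 := le_trans (nrmB _ _) (lerD p1 p2).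
  apply: le_trans (lerD (le_trans n1 (lerD n2 p3)) p4) _.
  by rewrite (_ : e + e + e + e = 4 * e)//; ring.
by rewrite nrmM -[4]/(4%:R) nrm_nat ler_pM2l.
Qed.

(** Fourier inversion for [f * tilde f], whose transform is the power spectrum. *)
Lemma inversion f y e : cc f -> 0 < e -> exists N0, forall N, (N0 <= N)%N ->
  nrm (convolve f (tilde f) (- y) - Int (fun x => trunc (power f) N 0 x * chi y x)) <= e.
Proof.
move=> cf e0; have cfy := cc_shift (- y) cf.
have [N0 h] := plancherel2 cfy cf e0; exists N0 => N hN; have := h N hN.
have -> : Int (fun x => f (x - y) * cj (f x)) = convolve f (tilde f) (- y).
  rewrite -Int_neg.
    by congr Int; apply/funext => t; rewrite /tilde [- t - y]addrC.
  have := cc_conj cf; have := cc_corr 0 cfy cf.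
  by under eq_fun do rewrite subr0.
have -> : trunc (cross (fun x => f (x - y)) f) N 0 = (fun x => trunc (power f) N 0 x * chi y x).
  apply/funext => x; rewrite /trunc /cross power_conj !subr0 inv_fourier_shift// chiNr cjK.
  by rewrite (chiC y x); ring.
by [].
Qed.

Lemma convolve_tilde f x : cc f -> convolve f (tilde f) x = Int (fun t => f (t + x) * cj (f t)).
Proof.
move=> cf; rewrite -Int_neg.
  by congr Int; apply/funext => t; rewrite /tilde addrC.
by have := cc_corr 0 (cc_shift x cf) cf; under eq_fun do rewrite subr0.
Qed.

Lemma cc_convolve f : cc f -> cc (convolve f (tilde f)).
Proof.
move=> cf; have [N sN] := supp_nat cf; have [M M0 fM] := cc_bounded cf; have [uf _] := cf.
have ci x : cc (fun t => f (t + x) * cj (f t)).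
  by have := cc_corr 0 (cc_shift x cf) cf; under eq_fun do rewrite subr0.
split.
  have [B B0 hB] := @bdd_Int R d N%:R; move=> e e0.
  have D0 : 0 < B * M + 1 by rewrite ltr_wpDl// mulr_ge0.
  have [dl dl0 hd] := uf (e / (B * M + 1)) (divr_gt0 e0 D0); exists dl => // x v hv.
  rewrite !convolve_tilde// -(linB (@lin_Int R d)); try exact: ci.
  apply: le_trans (hB _ (e / (B * M + 1) * M) _ _ _) _.
  - by apply: cc_sub; exact: ci.
  - by move=> t i ht; rewrite (sN t i ht) cj0 !mulr0 subrr.
  - move=> t; rewrite -mulrBl nrmM nrm_conj ler_pM ?nrm_ge0// addrA.
    exact: hd.
  rewrite -[leRHS]mulr1; have -> : B * (e / (B * M + 1) * M) = e * (B * M / (B * M + 1)) by field; rewrite gt_eqF.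
  by rewrite ler_pM2l// ler_pdivrMr// mul1r lerDl.
exists (N%:R + N%:R) => x i; rewrite mxE subr0 => hx; rewrite convolve_tilde//.
rewrite (_ : (fun t => _) = (fun=> 0)); first exact: lin0 (@lin_Int R d).
apply/funext => t; have [ft|ft] := ltP N%:R `|t 0 i|.
  by rewrite (sN t i) ?mxE ?subr0// cj0 mulr0.
rewrite (sN (t + x) i) ?mul0r// !mxE subr0.
have := ler_normB (t 0 i + x 0 i) (t 0 i); rewrite addrAC subrr add0r; lra.
Qed.

End inversion.

(** * Unordered sums *)

Section unordered_sums.
Variables (R : realType) (d : nat).
Local Notation C := (CC R).
Local Notation X := 'rV[R]_d.
Implicit Types (a : X -> R) (z : X -> C) (s : seq X) (B e : R).

Lemma fsets_seq (A : set X) : fsets setT A <-> exists2 s, uniq s & A = [set` s].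
Proof.
split=> [[/finite_seqP[s ->] _]|[s us ->]]; last by split=> //; exact: finite_seq.
by exists (undup s); [exact: undup_uniq|apply/seteqP; split=> x /=; rewrite mem_undup].
Qed.

Lemma esum_le a B : (forall s, uniq s -> \sum_(k <- s) a k <= B) ->
  (esum setT (EFin \o a) <= B%:E)%E.
Proof.
move=> aB; apply: ge_ereal_sup => _ [A /fsets_seq[s us ->] <-].
by rewrite -fsbig_seq// sumEFin lee_fin aB.
Qed.

Lemma esum_ge a s : uniq s -> ((\sum_(k <- s) a k)%:E <= esum setT (EFin \o a))%E.
Proof.
move=> us; apply: ereal_sup_ubound; exists [set` s].
  by apply/fsets_seq; exists s.
by rewrite -fsbig_seq// sumEFin.
Qed.

Lemma esum_bounded a : (esum setT (EFin \o a) < +oo)%E ->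
  exists B, forall s, uniq s -> \sum_(k <- s) a k <= B.
Proof.
move=> afin; exists (fine (esum setT (EFin \o a))) => s us.
have h0 := @esum_ge a [::] isT; rewrite big_nil in h0.
rewrite -lee_fin fineK; first exact: esum_ge.
by rewrite ge0_fin_numE.
Qed.

Lemma ssum_sup a B : (forall y, 0 <= a y) -> (forall s, uniq s -> \sum_(k <- s) a k <= B) ->
  exists2 S : R, esum setT (EFin \o a) = S%:E & ssum (fun y => rc (a y) : C) (rc S).
Proof.
move=> a0 aB; have h0 := @esum_ge a [::] isT; rewrite big_nil in h0.
have fin : esum setT (EFin \o a) \is a fin_num.
  by rewrite ge0_fin_numE//; apply: le_lt_trans (esum_le aB) _; rewrite ltry.
exists (fine (esum setT (EFin \o a))); first by rewrite fineK.
have ub s : uniq s -> \sum_(k <- s) a k <= fine (esum setT (EFin \o a)).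
  by move=> us; rewrite -lee_fin fineK//; exact: esum_ge.
move=> e e0.
have : ((fine (esum setT (EFin \o a)) - e)%:E < esum setT (EFin \o a))%E.
  by rewrite EFinB fineK// lteBlDr// lteDl// lte_fin.
move=> /ereal_sup_gt[_ [A /fsets_seq[s0 us0 ->] <-]].
rewrite -fsbig_seq// sumEFin lte_fin => hs; exists s0 => s us ss.
rewrite -rmorph_sum -rmorphB nrm_real ger0_norm ?subr_ge0 ?ub//.
have : \sum_(k <- s0) a k <= \sum_(k <- s) a k.
  rewrite [leRHS](bigID (mem s0)) /= -[leLHS]addr0; apply: lerD; last by apply: sumr_ge0.
  rewrite -[leRHS]big_filter; have pe : perm_eq s0 [seq k <- s | k \in s0].
    apply: uniq_perm => [||k]; rewrite ?filter_uniq// mem_filter.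
    by case ks: (k \in s0) => //=; rewrite ss.
  by rewrite (perm_big _ pe).
lra.
Qed.

Lemma ssum_lin (c : C) z z' S S' : ssum z S -> ssum z' S' ->
  ssum (fun y => c * z y + z' y) (c * S + S').
Proof.
move=> h h' e e0; have n1 : 0 < nrm c + 1 by rewrite ltr_wpDl ?nrm_ge0.
have e2 : 0 < e / 2 by rewrite divr_gt0.
have [s0 h0] := h _ (divr_gt0 e2 n1); have [s1 h1] := h' _ e2.
exists (s0 ++ s1) => s us ss.
have b0 := h0 s us; have b1 := h1 s us.
rewrite big_split /= -mulr_sumr.
have -> : c * S + S' - (c * (\sum_(i <- s) z i) + \sum_(i <- s) z' i) =
    c * (S - \sum_(i <- s) z i) + (S' - \sum_(i <- s) z' i) by ring.
apply: le_trans (nrmD _ _) _; rewrite [leRHS]splitr nrmM; apply: lerD; last first.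
  by apply: b1 => k ks; apply: ss; rewrite mem_cat ks orbT.
apply: le_trans (_ : nrm c * (e / 2 / (nrm c + 1)) <= _).
  by apply: ler_wpM2l; [exact: nrm_ge0|apply: b0 => k ks; apply: ss; rewrite mem_cat ks].
rewrite mulrCA ler_piMr//; first exact: ltW.
by rewrite ler_pdivrMr// mul1r lerDl.
Qed.

Lemma ssum_bound z S B : (forall s, uniq s -> \sum_(k <- s) nrm (z k) <= B) -> ssum z S ->
  nrm S <= B.
Proof.
move=> zB h; apply/ler_addgt0Pr => e /h[s0 h0].
have us := undup_uniq s0; have := h0 (undup s0) us.
have ss : {subset s0 <= undup s0} by move=> k; rewrite mem_undup.
move=> /(_ ss) b; have := nrm_tri S (\sum_(k <- undup s0) z k) 0; rewrite !subr0.
have := nrm_sum (undup s0) xpredT z; have := zB _ us; lra.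
Qed.

Lemma ssum_rsum a B : (forall s, uniq s -> \sum_(k <- s) `|a k| <= B) ->
  ssum (fun y => rc (a y) : C) (rc (rsum a)).
Proof.
move=> aB.
pose p y := Num.max (a y) 0; pose q y := Num.max (- a y) 0.
have p0 y : 0 <= p y by rewrite le_max lexx orbT.
have q0 y : 0 <= q y by rewrite le_max lexx orbT.
have pB s : uniq s -> \sum_(k <- s) p k <= B.
  by move=> us; apply: le_trans (aB s us); apply: ler_sum => k _; rewrite ge_max normr_ge0 ler_norm.
have qB s : uniq s -> \sum_(k <- s) q k <= B.
  move=> us; apply: le_trans (aB s us); apply: ler_sum => k _.
  by rewrite ge_max normr_ge0 -normrN ler_norm.
have [S ES hS] := ssum_sup p0 pB; have [T ET hT] := ssum_sup q0 qB.
have -> : rsum a = S - T.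
  rewrite /rsum.
  have -> : (EFin \o a)^\+%E = EFin \o p by apply/funext => y; rewrite funeposE /= EFin_max.
  have -> : (EFin \o a)^\-%E = EFin \o q by apply/funext => y; rewrite funenegE /= EFin_max.
  by rewrite ES ET.
have := ssum_lin (-1) hT hS; rewrite mulN1r addrC -rmorphB.
congr ssum; apply/funext => y; rewrite mulN1r addrC -rmorphB; congr (rc _).
rewrite /p /q; have [h|h] := leP 0 (a y).
  by rewrite max_r ?oppr_le0 ?subr0.
by rewrite max_l ?oppr_ge0 ?ltW// opprK add0r.
Qed.

Definition csum z : C :=
  (rsum (fun y => complex.Re (z y)) +i* rsum (fun y => complex.Im (z y)))%C.

Lemma csumP z B : (forall s, uniq s -> \sum_(k <- s) nrm (z k) <= B) -> ssum z (csum z).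
Proof.
move=> zB.
have hR : ssum (fun y => rc (complex.Re (z y)) : C) (rc (rsum (fun y => complex.Re (z y)))).
  apply: (@ssum_rsum _ B) => s us; apply: le_trans (zB s us); apply: ler_sum => k _; exact: Re_nrm.
have hI : ssum (fun y => rc (complex.Im (z y)) : C) (rc (rsum (fun y => complex.Im (z y)))).
  apply: (@ssum_rsum _ B) => s us; apply: le_trans (zB s us); apply: ler_sum => k _; exact: Im_nrm.
have E (u v : R) : (0 +i* 1)%C * rc v + rc u = (u +i* v)%C :> C.
  by apply/eqP; rewrite eq_complex /=; apply/andP; split; apply/eqP; ring.
have := ssum_lin (0 +i* 1)%C hI hR; rewrite E -/(csum z).
by congr ssum; apply/funext => y; rewrite E; case: (z y).
Qed.

End unordered_sums.

(** * Radon measures and the Fourier-Bohr coefficients *)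

Section radon.
Variables (R : realType) (d : nat).
Local Notation C := (CC R).
Local Notation X := 'rV[R]_d.
Implicit Types (f g h : X -> C) (x y a t : X) (mu L : (X -> C) -> C) (M B r e : R).

Lemma radon_lin L : radon_measure L -> lin L.
Proof. by move=> [lL _] c f g cf cg; apply: lL; exact: cc_Cc. Qed.

Lemma radon_bdd L : radon_measure L -> bdd L.
Proof.
move=> [_ bL] r; have [B hB] := bL _ (@cube_compact R d r); exists `|B| => // f M cf sf fM.
apply: le_trans (hB f (cc_Cc cf) (supp_sub sf)) _.
apply: le_trans (ler_wpM2r (sup_norm_ge0 cf) (ler_norm B)) _.
by apply: ler_wpM2l => //; exact: sup_norm_le.
Qed.

Lemma lin_bdd_radon L : lin L -> bdd L -> radon_measure L.
Proof.
move=> lL bL; split=> [c f g cf cg|K cK]; first by apply: lL; exact: Cc_cc.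
have [r _ Kr] := compact_in_cube cK; have [B B0 hB] := bL r; exists B => f cf sf.
apply: hB; first exact: Cc_cc.
  by apply: sub_supp; exact: subset_trans sf Kr.
by move=> x; exact: (cc_sup_norm (Cc_cc cf)).
Qed.

Lemma radon_dagger L : radon_measure L -> radon_measure (dagger_measure L).
Proof.
move=> rL; apply: lin_bdd_radon => [c f g cf cg|r].
  by rewrite /dagger_measure -(radon_lin rL)//; exact: cc_neg.
have [B B0 hB] := radon_bdd rL r; exists B => // f M cf sf fM.
apply: hB; [exact: cc_neg| |by move=> x; exact: fM].
by move=> x i; rewrite mxE subr0 => hx; apply: (sf _ i); rewrite !mxE subr0 normrN.
Qed.

(** A function supported in a translate of the unit cube is dominated by its
    indicator, so the variation of the translate bounds the functional. *)
Lemma translation_bounded_tbf L : radon_measure L -> translation_bounded L -> exists B, tbf L B.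
Proof.
move=> rL tL; have lL := radon_lin rL.
have := tL _ (@cube_compact R d 1); set V := ereal_sup _ => Vfin.
have [B VB] : exists B : R, (V <= B%:E)%E.
  by case: V Vfin => [r _|//|_]; [exists r|exists 0; rewrite leNye].
exists B; split=> // a g M cg sg gM.
have M0 : 0 <= M := le_trans (nrm_ge0 _) (gM 0).
have [M00|M_neq0] := eqVneq M 0.
  have -> : g = (fun=> 0).
    by apply/funext => x; apply/eqP; rewrite -nrm_eq0 eq_le nrm_ge0 andbT -M00.
  by rewrite lin0// nrm0 M00 mulr0.
have Mgt0 : 0 < M by rewrite lt_def M_neq0.
pose g1 x := rc M^-1 * g x; have cg1 : cc g1 by exact: cc_scale.
have n1 x : nrm (g1 x) <= 1.
  by rewrite nrmM nrm_real ger0_norm ?invr_ge0// mulrC ler_pdivrMr// mul1r.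
have out x : ~ translate a (cube d 1) x -> g1 x = 0.
  move=> h; rewrite /g1; have [hx|/existsNP[i /negP hx]] := pselect (forall i, `|x 0 i - a 0 i| <= 1).
    case: h; exists (x - a); last by rewrite addrC subrK.
    by move=> i; rewrite !mxE.
  by rewrite (sg x i) ?mulr0// ltNge.
have le1 : ((nrm (L g1))%:E <= Defs.variation L (translate a (cube d 1)))%E.
  apply: le_ereal_inf_tmp => _ [k [lk hk] <-].
  apply: ereal_sup_ubound; exists g1 => //; split; first exact: cc_Cc.
  move=> x; apply: le_trans (hk x); rewrite lee_fin indicE.
  have [xa|xa] := pselect (translate a (cube d 1) x); first by rewrite mem_set// n1.
  by rewrite memNset// out// nrm0.
have le2 : nrm (L g1) <= B.
  rewrite -lee_fin; apply: le_trans le1 (le_trans _ VB).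
  by apply: ereal_sup_ubound; exists a.
have -> : L g = rc M * L g1.
  by rewrite (linZ _ lL)// mulrA -rmorphM divff// mul1r.
by rewrite nrmM nrm_real ger0_norm// mulrC ler_wpM2r.
Qed.

Variable mu : functional R d.
Hypothesis sap : strongly_ap mu.

Lemma sap_radon : radon_measure mu. Proof. by case: sap. Qed.

Lemma sap_tbf : exists B, tbf mu B.
Proof. by case: sap => rmu tmu _; exact: translation_bounded_tbf. Qed.

Lemma sap_ap g : cc g -> ap (convL g mu).
Proof. by case: sap => _ _ h cg; apply: strongly_ap_fun_ap; apply: h; exact: cc_Cc. Qed.

(** The abstract coefficient is the mean of the twisted measure, by the agreement
    of the mean with the means along Folner sequences. *)
Lemma fourier_bohrP y g : cc g ->
  Mean (fun x => convL g mu x * cj (chi y x)) = fourier_bohr mu y * Int (fun x => g x * cj (chi y x)).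
Proof.
have [B tB] := sap_tbf; have [c hc] := bohr_coefficient y tB sap_ap.
suff -> : fourier_bohr mu y = c by move=> cg; exact: hc.
have E f x : cc f -> convolve_measure f (twist y mu) x =
    convL (fun z => f z * chi y z) mu x * cj (chi y x).
  move=> cf; have cG := cc_refl x (cc_chi y cf).
  rewrite [RHS]mulrC -[RHS](linZ (cj (chi y x)) (radon_lin sap_radon) cG).
  rewrite /convolve_measure /twist; congr mu; apply/funext => z.
  rewrite chiDr chiNr.
  transitivity (cj (chi y z) * f (x - z) * (chi y x * cj (chi y x))); last by ring.
  by rewrite chi_conj mulr1.
have mm : measure_has_mean (twist y mu) c.
  move=> f /Cc_cc cf; have cfy := cc_chi y cf.
  have -> : convolve_measure f (twist y mu) =
      (fun x => convL (fun z => f z * chi y z) mu x * cj (chi y x)).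
    by apply/funext => x; exact: E.
  have au := sap_ap cfy; have uu := convL_uc tB cfy.
  have := has_mean_ap (ap_bohr y au).
  rewrite /bohr hc//.
  have -> : (fun x => f x * chi y x * cj (chi y x)) = f.
    by apply/funext => x; rewrite -mulrA chi_conj mulr1.
  apply; have [M M0 hM] := ap_bounded au.
  apply: (@uc_mul _ _ _ _ (Num.max M 1)) => //.
  - by move=> x; apply: le_trans (hM x) _; rewrite le_max lexx.
  - by move=> x; rewrite nrm_conj nrm_chi le_max lexx orbT.
  exact/uc_conj/uc_chi.
have mu1 : measure_has_mean (twist y mu) (fourier_bohr mu y).
  by apply: (@xgetPex _ 0 [set m | measure_has_mean (twist y mu) m]); exists c.
have ct := cc_Cc (cc_tentV R d).
have := has_mean_uniq (mu1 _ ct) (mm _ ct).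
by rewrite -/(Int _) Int_tentV !mulr1.
Qed.

End radon.

(** * Integrals of power spectra *)

Section integrals.
Variables (R : realType) (d : nat).
Local Notation C := (CC R).
Local Notation X := 'rV[R]_d.
Local Notation K := {ffun 'I_d -> int}.
Implicit Types (f g h F : X -> C) (x y a t : X) (mu L : (X -> C) -> C) (M B r e : R) (N : nat).

Lemma uc_lsc f : uc f -> lower_semicontinuous (fun x => (nrm (f x))%:E).
Proof.
move=> uf x b; rewrite lte_fin => hb; pose e := (nrm (f x) - b) / 2.
have e0 : 0 < e by rewrite divr_gt0// subr_gt0.
have := @uc_continuous R d f uf x => /(@cvgrPdist_le _ _ _ _ (nbhs_filter x))/(_ (rc e)).
rewrite rc_lt0 => /(_ e0) h; exists [set y | `|f x - f y| <= rc e] => // y /=.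
rewrite nrmE rc_le lte_fin => hy.
have := nrm_tri (f x) (f y) 0; rewrite !subr0 /e in hy * => hx; lra.
Qed.

(** The error [|h - trunc h N 0|] is itself lower semicontinuous, so the upper
    integral is bounded by testing against functions below it, and these are
    covered by the tail estimate. *)
Lemma ext_has_integral L B h (w : K -> R) D F : tbf L B -> uc h -> amal h w D -> ext_lim L h F ->
  has_integral L h (F 0).
Proof.
move=> tL uh am hF e e0; have e2 : 0 < e / 2 by rewrite divr_gt0.
have [N1 h1] := hF _ e2; have [N2 h2] := amal_tail tL am e2.
pose N := maxn N1 N2; have ct := cc_trunc N 0 uh am.
exists (trunc h N 0); split; first exact: cc_Cc.
  apply: le_lt_trans (_ : (_ <= (e / 2)%:E)%E) _; last by rewrite lte_fin ltr_pdivrMr// ltr_pMr// ltr1n.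
  apply: le_trans (_ : variation_lsc L (fun x => (nrm (h x - trunc h N 0 x))%:E) <= _)%E.
    apply: ereal_inf_lbound; exists (fun x => (nrm (h x - trunc h N 0 x))%:E) => //; split=> //.
    apply: (@uc_lsc (fun x => h x - trunc h N 0 x)); apply: uc_add => //; apply: uc_opp.
    by case: ct.
  apply: ge_ereal_sup => _ [g [cg gle] <-]; rewrite lee_fin.
  have {}gle x : nrm (g x) <= nrm (h x - trunc h N 0 x) by rewrite -lee_fin.
  apply: (h2 0) => [|x|x hx]; first exact: Cc_cc.
    apply: le_trans (gle x) _; rewrite subr0 /trunc subr0 -[X in X - _]mulr1 -mulrBr nrmM.
    rewrite -[leRHS]mulr1 ler_wpM2l ?nrm_ge0// -[1]/(rc 1) -rmorphB nrm_real.
    have := cut_ge0 N x; have := cut_le1 N x => *.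
    by rewrite ger0_norm ?subr_ge0// lerBlDr lerDl.
  apply/eqP; rewrite -nrm_eq0 eq_le nrm_ge0 andbT; apply: le_trans (gle x) _.
  rewrite trunc_in ?subr0 ?subrr ?nrm0// => i; apply: le_trans (hx i) _.
  by rewrite ler_nat leq_maxr.
apply: le_lt_trans (_ : e / 2 < e); last by rewrite ltr_pdivrMr// ltr_pMr// ltr1n.
by rewrite nrmC; apply: h1; exact: leq_maxl.
Qed.

(** Two approximants of [h (x - a)]: the truncation agrees with the function
    near [a], and the other approximant vanishes elsewhere, so the error bound
    of the latter dominates their difference everywhere. *)
Lemma ext_integral L h (w : K -> R) D F a (z : C) : lin L -> uc h -> amal h w D -> ext_lim L h F ->
  has_integral L (fun x => h (x - a)) z -> F a = z.
Proof.
move=> lL uh am hF hz; apply: nrm_eq => e e0; have e4 : 0 < e / 4 by rewrite divr_gt0.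
have [f2 [/Cc_cc cf2 up f2z]] := hz _ e4.
have [v [k [lk hk] <-] vk] := ereal_inf_lt up.
have [N0 hN0] := hF _ e4.
have [_ [r0 sr0]] := cf2; have [r sr] := @supp_in_move _ _ 0 a _ _ sr0.
pose N := maxn N0 (Num.truncn r).+1.
have rN : r <= N%:R.
  by apply: le_trans (ltW (truncnS_gt r)) _; rewrite ler_nat leq_maxr.
have ct := cc_trunc N a uh am.
have b1 := hN0 N (leq_maxl _ _) a.
have b2 : nrm (L (trunc h N a) - L f2) <= e / 4.
  rewrite -linB// -lee_fin; apply: le_trans (ltW vk).
  apply: ereal_sup_ubound; exists (fun x => trunc h N a x - f2 x) => //; split.
    by apply: cc_Cc; exact: cc_sub.
  move=> x; apply: le_trans (hk x); rewrite lee_fin.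
  have [hx|/existsNP[i /negP hx]] := pselect (forall i, `|x 0 i - a 0 i| <= N%:R).
    by rewrite trunc_in.
  have -> : f2 x = 0 by apply: (sr x i); rewrite (le_lt_trans rN)// ltNge.
  rewrite !subr0 /trunc nrmM -[leRHS]mulr1 ler_wpM2l ?nrm_ge0//.
  exact: cut_nrm.
have := nrm_tri (F a) (L (trunc h N a)) z; have := nrm_tri (L (trunc h N a)) (L f2) z.
lra.
Qed.

Lemma has_integral_L1 mu h z : has_integral mu h z -> L1 mu h.
Proof. by move=> H e /H[f [cf up _]]; exists f. Qed.

Variable mu : functional R d.
Hypothesis sap : strongly_ap mu.

(** Fourier inversion evaluates the integral of the power spectrum against a
    character. *)
Lemma power_ext f : cc f -> exists F, [/\ ext_lim mu (power f) F, ap F, uc F &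
  forall y, bohr F y = fourier_bohr mu y * convolve f (tilde f) (- y)].
Proof.
move=> cf; have [B tB] := sap_tbf sap; have uh := uc_power cf.
have [w [D am]] := amal_power cf; have [F hF] := ext_exists tB uh am.
exists F; split=> //; [exact: ext_ap (sap_ap sap) uh am hF|exact: ext_uc tB uh am hF|].
move=> y; apply: (ext_coefficient tB (sap_ap sap) uh am hF (fun g cg => fourier_bohrP sap y cg)).
by move=> e e0; exact: inversion.
Qed.

(** [F 0], the integral of the power spectrum, is the sum of the Bohr series of
    [F], hence the value of the reflected Fourier-Bohr series at [f * tilde f]. *)
Theorem fourier_bohr_transform : formal_sum_is_measure (fourier_bohr mu) ->
  is_fourier_transform (dagger_measure (formal_sum (fourier_bohr mu))) mu.
Proof.
move=> [sm rm]; have rmu := sap_radon sap; split=> // [|f /Cc_cc cf].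
  exact: radon_dagger.
suff H : has_integral mu (power f)
    (dagger_measure (formal_sum (fourier_bohr mu)) (convolve f (tilde f))).
  by rewrite powerE; split=> //; exact: has_integral_L1 H.
have [F [hF aF uF bF]] := power_ext cf.
have [B tB] := sap_tbf sap; have uh := uc_power cf; have [w [D am]] := amal_power cf.
have := ext_has_integral tB uh am hF; congr has_integral.
have cP : cc (dagger (convolve f (tilde f))) by apply: cc_neg; exact: cc_convolve.
have [B1 hB1] := esum_bounded (sm _ (cc_Cc cP)).
have s1 := csumP hB1.
have s2 : ssum (fun y => bohr F y * chi y 0) (F 0).
  apply: (@bohr_expansion _ _ _ B1) => // Y uY; apply: le_trans (hB1 Y uY).
  by apply: ler_sum => y _; rewrite bF /dagger mulrC.
apply: (ssum_uniq s2); move: s1; congr ssum; apply/funext => y.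
by rewrite chi0r mulr1 bF /dagger mulrC.
Qed.

End integrals.

(** * Summability of the coefficients of a Fourier transform *)

Section dirichlet.
Variables (R : realType) (d : nat).
Local Notation C := (CC R).
Local Notation X := 'rV[R]_d.
Implicit Types (f g h F : X -> C) (x y z a t : X) (B M r e : R) (N n : nat) (Y p q : seq X).

(** The value of the Dirichlet kernel of [p] at [z]. *)
Definition kernel p z : C := avg id p (fun a => cj (chi z a)) 0.

Lemma kernel_padd p q z : p != [::] -> q != [::] ->
  nrm (kernel (padd p q) z) <= nrm (kernel p z) /\ nrm (kernel (padd p q) z) <= nrm (kernel q z).
Proof.
move=> p0 q0.
have E s x : avg id s (fun a => cj (chi z a)) x = cj (chi z x) * kernel s z.
  rewrite /kernel /avg mulrCA; congr (_ * _); rewrite mulr_sumr; apply: eq_bigr => t _.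
  by rewrite add0r chiDr cjM.
have le s s' x : s != [::] -> nrm (avg id s (avg id s' (fun a => cj (chi z a))) x) <= nrm (kernel s' z).
  move=> s0; rewrite -[X in nrm X]subr0; apply: avg_near => // t.
  by rewrite subr0 E nrmM nrm_conj nrm_chi mul1r.
have D : {morph (id : X -> X) : a b / a + b >-> a + b} by [].
have A := avg_avg D p q (fun a => cj (chi z a)) 0.
split; rewrite /kernel -A; last exact: le.
by rewrite avg_avgC//; exact: le.
Qed.

Lemma kernel_le1 p z : p != [::] -> nrm (kernel p z) <= 1.
Proof.
move=> p0; rewrite -[kernel p z]subr0; apply: avg_near => // t.
by rewrite subr0 nrm_conj nrm_chi.
Qed.

Definition progression n c (i : 'I_d) : seq X := [seq (j%:R * c) *: delta_mx 0 i | j <- iota 0 n].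

(** The geometric sum, with the small denominator on the left. *)
Lemma kernel_progression n c i z : nrm (ee (- (c * z 0 i)) - 1) * nrm (kernel (progression n.+1 c i) z) <=
  2 * n.+1%:R^-1.
Proof.
set w := ee (- (c * z 0 i)).
have -> : kernel (progression n.+1 c i) z = n.+1%:R^-1 * \sum_(j < n.+1) w ^+ j.
  rewrite /kernel /avg /progression size_map size_iota big_map; congr (_ * _).
  rewrite -/(index_iota 0 n.+1) big_mkord; apply: eq_bigr => j _.
  rewrite add0r /id chiE dotp_delta cj_ee -eeMn; congr ee.
  by rewrite -mulr_natl; ring.
rewrite -nrmM mulrCA -subrX1 nrmM nrmV nrm_nat [leRHS]mulrC ler_wpM2l ?invr_ge0//.
by apply: le_trans (nrmB _ _) _; rewrite nrmX nrm_ee expr1n nrm1.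
Qed.

Definition dgrid n c (s : seq 'I_d) : seq X :=
  foldr (fun i p => padd (progression n.+1 c i) p) [:: 0] s.

Lemma dgrid_neq0 n c s : dgrid n c s != [::].
Proof. by elim: s => //= i s IH; apply: padd_neq0. Qed.

(** The kernel of a grid is the product of the kernels of its progressions, so it
    is small as soon as one coordinate is away from the peak. *)
Lemma kernel_dgrid n c s i z : i \in s ->
  nrm (kernel (dgrid n c s) z) <= nrm (kernel (progression n.+1 c i) z).
Proof.
elim: s => //= j s IH; rewrite inE => /orP[/eqP ->|/IH h].
  by have [] := @kernel_padd (progression n.+1 c j) (dgrid n c s) z isT (dgrid_neq0 n c s).
apply: le_trans h.
by have [] := @kernel_padd (progression n.+1 c j) (dgrid n c s) z isT (dgrid_neq0 n c s).
Qed.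

Lemma finite_min (T : eqType) (s : seq T) (u : T -> R) : (forall k, 0 < u k) ->
  exists2 e, 0 < e & forall k, k \in s -> e <= u k.
Proof.
move=> u0; elim: s => [|t s [e e0 he]]; first by exists 1.
exists (Num.min (u t) e); first by rewrite lt_min u0.
by move=> t'; rewrite inE ge_min => /orP[/eqP ->|/he ->]; rewrite ?lexx ?orbT.
Qed.

Lemma separated Y : exists2 e, 0 < e & forall y y', y \in Y -> y' \in Y ->
  (forall i, `|y 0 i - y' 0 i| < e + e) -> y = y'.
Proof.
have ex (p : X * X) : exists e : R, 0 < e /\
    ((forall i, `|p.1 0 i - p.2 0 i| < e + e) -> p.1 = p.2).
  have [h|/existsNP[i hi]] := pselect (forall i, p.1 0 i = p.2 0 i).
    by exists 1; split=> // _; apply/rowP.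
  have h0 : 0 < `|p.1 0 i - p.2 0 i| by rewrite normr_gt0 subr_eq0; apply/eqP.
  exists (`|p.1 0 i - p.2 0 i| / 2); split; first by rewrite divr_gt0.
  by move=> /(_ i); rewrite -splitr ltxx.
have [u hu] := choice ex.
have [e e0 he] := finite_min [seq (y, y') | y <- Y, y' <- Y] (fun yy => (hu yy).1).
exists e => // y y' yY y'Y h; apply: (hu (y, y')).2 => i /=.
apply: lt_le_trans (h i) _; have : e <= u (y, y').
  by apply: he; apply/allpairsP; exists (y, y'); split.
by move=> ?; apply: lerD.
Qed.

Lemma ee_away_sym e : 0 < e -> e <= 1 / 2 -> exists2 c : R, 0 < c & forall u, e <= `|u| ->
  `|u| <= 1 / 2 -> c <= nrm (ee (- u) - 1).
Proof.
move=> e0 e1; have [c c0 hc] := ee_away e0 e1; exists c => // u h1 h2.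
by apply: hc; rewrite normrN.
Qed.

(** A grid whose kernel is, on a bounded set, concentrated at the points [- y];
    these are separated, so at most one of them is close to a given point. *)
Lemma concentrated_grid Y r : uniq Y -> exists2 p, p != [::] &
  forall x, (forall i, `|x 0 i| <= r) -> \sum_(y <- Y) nrm (kernel p (x + y)) <= 2.
Proof.
move=> uY; have [eta eta0 heta] := separated Y.
pose S := `|r| + \sum_(y <- Y) \sum_i `|y 0 i| + eta.
have S0 : 0 < S by rewrite ltr_wpDl// addr_ge0// sumr_ge0// => y _; rewrite sumr_ge0.
(* with this step no other peak of the kernels meets the bounded set *)
pose c := (2 * S)^-1; have c0 : 0 < c by rewrite invr_gt0 mulr_gt0.
have cS : c * S = 1 / 2 by rewrite /c; field; rewrite gt_eqF.
have ceta0 : 0 < c * eta by rewrite mulr_gt0.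
have ceta : c * eta <= 1 / 2.
  rewrite -cS ler_pM2l// lerDr addr_ge0// sumr_ge0// => y _; exact: sumr_ge0.
have [k k0 hk] := ee_away_sym ceta0 ceta.
have [n hn] : exists n : nat, 2 * n.+1%:R^-1 <= k * (size Y).+1%:R^-1.
  have [|n hn] := @inv_le_small R (k * (size Y).+1%:R^-1 / 2).
    by rewrite divr_gt0// mulr_gt0// invr_gt0.
  by exists n; rewrite mulrC -ler_pdivlMr.
exists (dgrid n c (enum 'I_d)); first exact: dgrid_neq0.
move=> x xr.
pose near y := [forall i, `|(x + y) 0 i| < eta].
have far y : y \in Y -> ~~ near y -> nrm (kernel (dgrid n c (enum 'I_d)) (x + y)) <= (size Y).+1%:R^-1.
  move=> yY; rewrite negb_forall => /existsP[i hi]; rewrite -leNgt in hi.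
  have iE : i \in enum 'I_d by rewrite mem_enum.
  apply: le_trans (kernel_dgrid _ _ _ iE) _.
  have := kernel_progression n c i (x + y).
  have : k <= nrm (ee (- (c * (x + y) 0 i)) - 1).
    apply: hk; rewrite normrM (gtr0_norm c0) ?ler_pM2l//.
    rewrite -cS ler_pM2l// mxE; apply: le_trans (ler_normD _ _) _.
    have h1 : `|y 0 i| <= \sum_(y <- Y) \sum_i `|y 0 i|.
      rewrite (big_rem y)//= (bigD1 i)//= -addrA lerDl addr_ge0 ?sumr_ge0// => z _.
      exact: sumr_ge0.
    have := xr i; have := ler_norm r; have := ltW eta0; rewrite /S; lra.
  move=> h1 h2; rewrite -(ler_pM2l k0); apply: le_trans hn; apply: le_trans h2.
  by rewrite ler_wpM2r// nrm_ge0.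
rewrite (bigID near) /=; apply: (@le_trans _ _ (1 + 1)) => //; apply: lerD.
  have [/hasP[y0 y0Y ny0]|/hasPn nn] := boolP (has near Y); last first.
    by rewrite big_seq_cond big1 ?ler01// => y /andP[/nn /negPf ->].
  rewrite -big_filter (bigD1_seq y0) ?mem_filter ?ny0 ?filter_uniq//=.
  rewrite big_seq_cond big1 ?addr0 => [|y].
    by apply: kernel_le1; exact: dgrid_neq0.
  rewrite mem_filter => /andP[/andP[ny yY] /eqP[]]; apply: heta => // i.
  move: ny ny0 => /forallP/(_ i) ny /forallP/(_ i) ny0; move: ny ny0; rewrite !mxE => ny ny0.
  have -> : y 0 i - y0 0 i = (x 0 i + y 0 i) - (x 0 i + y0 0 i) by ring.
  by apply: le_lt_trans (ler_normB _ _) _; rewrite ltrD.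
rewrite big_seq_cond; apply: le_trans (_ : \sum_(y <- Y) (size Y).+1%:R^-1 <= _).
  rewrite -big_seq_cond [leRHS](bigID near) /= -[leLHS]add0r; apply: lerD.
    by apply: sumr_ge0 => y _; rewrite invr_ge0.
  by rewrite big_seq_cond [leRHS]big_seq_cond; apply: ler_sum => y /andP[yY ny]; exact: far.
rewrite big_const_seq count_predT iter_addr_0 -[_ *+ _]mulr_natl ler_pdivrMr// mul1r.
by rewrite ler_nat.
Qed.

(** The function [a |-> L (g conj(chi a))] behaves like the Fourier transform of
    a measure of finite mass: testing the coefficients against phases and
    averaging over a grid turns their sum into the value of [L] at [g] times a
    bounded kernel. *)
Lemma transform_coefficients L g : lin L -> bdd L -> cc g ->
  ap (fun a => L (fun x => g x * cj (chi a x))) ->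
  exists B, forall Y, uniq Y ->
    \sum_(y <- Y) nrm (bohr (fun a => L (fun x => g x * cj (chi a x))) y) <= B.
Proof.
move=> lL bL cg aF; set F := (fun a : X => L _) in aF *; have [_ [r sr]] := cg.
have [M M0 gM] := cc_bounded cg; have [B B0 hB] := bL r.
exists (B * (M * 2)) => Y uY.
have [w hw] := choice (fun y => let: ex_intro2 w h1 h2 := phaseP (bohr F y) in
   ex_intro (fun w => nrm w <= 1 /\ w * bohr F y = rc (nrm (bohr F y))) w (conj h1 h2)).
pose T a : C := \sum_(y <- Y) w y * cj (chi y a).
have apT : ap T by apply: ap_sum => y; apply: ap_scale; exact: ap_cchi.
have aFT : ap (fun a => F a * T a) by exact: ap_mul.
have EM : Mean (fun a => F a * T a) = rc (\sum_(y <- Y) nrm (bohr F y)).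
  have -> : (fun a => F a * T a) = (fun a => \sum_(y <- Y) w y * (F a * cj (chi y a))).
    by apply/funext => a; rewrite /T mulr_sumr; apply: eq_bigr => y _; ring.
  rewrite Mean_sum; last by move=> y; apply: ap_scale; exact: ap_bohr.
  rewrite rmorph_sum; apply: eq_bigr => y _.
  by rewrite (MeanZ _ (ap_bohr y aF)); exact: (hw y).2.
have [G G0 hG] := concentrated_grid r uY.
apply/ler_addgt0Pr => e e0.
have [p p0 hp] := (MeanP aFT).2 e e0.
have D : {morph (id : X -> X) : a b / a + b >-> a + b} by [].
(* averaging over the concentrated grid [G] as well keeps the approximation *)
have h1 := isexp_avg D (f := fun a => F a * T a) (m := fun=> Mean (fun a => F a * T a)) 0 p0 G0
  (fun _ _ => erefl) hp.
set P := padd p G in h1.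
have P0 : P != [::] by exact: padd_neq0.
pose Dk x : C := \sum_(y <- Y) w y * kernel P (x + y).
have ccm a : cc (fun x => g x * cj (chi a x)) by exact: cc_modulate.
have E : avg id P (fun a => F a * T a) 0 = L (fun x => g x * Dk x).
  have -> : (fun x => g x * Dk x) =
      (fun x => (size P)%:R^-1 * \sum_(a <- P) T (0 + a) * (g x * cj (chi (0 + a) x))).
    apply/funext => x; rewrite /Dk mulr_sumr.
    transitivity (\sum_(y <- Y) \sum_(a <- P) (size P)%:R^-1 * (w y * cj (chi y (0 + a)) * (g x * cj (chi (0 + a) x)))).
      apply: eq_bigr => y _; rewrite /kernel /avg !mulr_sumr; apply: eq_bigr => a _.
      rewrite chiDl cjM (chiC x); ring.
    rewrite exchange_big mulr_sumr; apply: eq_bigr => a _.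
    by rewrite /T mulr_suml mulr_sumr.
  rewrite linZ//; last by apply: cc_sum => a; apply: cc_scale; exact: ccm.
  rewrite lin_sum//; last by move=> a; apply: cc_scale; exact: ccm.
  rewrite /avg; congr (_ * _); apply: eq_bigr => a _.
  by rewrite [LHS]mulrC (linZ _ lL (ccm _)).
have b : nrm (L (fun x => g x * Dk x)) <= B * (M * 2).
  have DkC : cc (fun x => g x * Dk x).
    have Dk1 x : nrm (Dk x) <= \sum_(y <- Y) 1.
      apply: le_trans (nrm_sum _ _ _) _; apply: ler_sum => y _; rewrite nrmM -[leRHS]mulr1.
      by apply: ler_pM; rewrite ?nrm_ge0 ?(hw y).1//; exact: kernel_le1.
    apply: (cc_mul cg) Dk1; apply: uc_sum => y.
    have -> : (fun x => w y * kernel P (x + y)) = (fun x => \sum_(a <- P)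
        (w y * (size P)%:R^-1 * cj (chi y a)) * cj (chi a x)).
      apply/funext => x; rewrite /kernel /avg !mulr_sumr; apply: eq_bigr => a _.
      by rewrite add0r chiDl cjM (chiC x); ring.
    apply: uc_sum => a; set k := w y * _ * _.
    apply: (@uc_mul _ _ (fun=> k) _ (Num.max (nrm k) 1)).
    - by move=> x; rewrite le_max lexx.
    - by move=> x; rewrite nrm_conj nrm_chi le_max lexx orbT.
    - exact: uc_cst.
    exact/uc_conj/uc_chi.
  apply: hB => // [x i hx|x]; first by rewrite (sr x i hx) mul0r.
  have [hx|/existsNP[i /negP hx]] := pselect (forall i, `|x 0 i| <= r); last first.
    by rewrite (sr x i) ?mul0r ?nrm0 ?mulr_ge0// mxE subr0 ltNge.
  rewrite nrmM ler_pM ?nrm_ge0//; apply: le_trans (hG x hx).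
  apply: le_trans (nrm_sum _ _ _) _; apply: ler_sum => y _; rewrite nrmM -[leRHS]mul1r.
  apply: ler_pM; rewrite ?nrm_ge0 ?(hw y).1//.
  by have [] := kernel_padd (x + y) p0 G0.
rewrite E EM in h1.
have := nrm_tri (rc (\sum_(y <- Y) nrm (bohr F y)) : C) (L (fun x => g x * Dk x)) 0.
rewrite !subr0 nrm_real ger0_norm; last by apply: sumr_ge0 => y _; exact: nrm_ge0.
rewrite nrmC => h; apply: le_trans h _; rewrite addrC; exact: lerD.
Qed.

End dirichlet.

Section necessity.
Variables (R : realType) (d : nat).
Local Notation C := (CC R).
Local Notation X := 'rV[R]_d.
Implicit Types (f g h F : X -> C) (x y a t : X) (B M r e : R) (N : nat) (Y s : seq X).

(** For [t] in the support of a unit tent both [t] and [t - y] lie where the wider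
    cutoff is [1], so the autocorrelation is at least the integral of the tent. *)
Lemma cutoff_autocorrelation N y : (forall i, `|y 0 i| <= N%:R) ->
  1 <= nrm (convolve (fun x => rc (cutoff N.+1 x)) (tilde (fun x => rc (cutoff N.+1 x))) (- y) : C).
Proof.
move=> hy; set f := fun x => _; have cf : cc f by exact: cc_cut.
have cfy : cc (fun t => f (t - y) * cj (f t)).
  by have := cc_corr 0 (cc_shift (- y) cf) cf; under eq_fun do rewrite subr0.
apply: le_trans (Re_lenrm _); rewrite convolve_tilde//.
have ct := cc_tentV R d.
have : 0 <= complex.Re (Int (fun t => f (t - y) * cj (f t) - rc (tentV t))).
  apply: Int_ge0 => t; rewrite /f conjc_real -rmorphM -rmorphB /=.
  have c0 : 0 <= cutoff N.+1 (t - y) * cutoff N.+1 t by rewrite mulr_ge0 ?cut_ge0.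
  have [ht|/existsNP[i /negP hi]] := pselect (forall i, `|t 0 i| <= 1); last first.
    by rewrite (@tentV_out _ _ _ i) ?subr0// ltW// ltNge.
  rewrite !cut1 ?mulr1 ?subr_ge0 ?tentV_le1// => i; rewrite -natr1.
    by apply: le_trans (ht i) _; rewrite lerDr.
  by rewrite !mxE addrC; apply: le_trans (ler_normD _ _) _; rewrite normrN lerD.
rewrite (linB (@lin_Int R d) cfy ct) Int_tentV ReD ReN /=; lra.
Qed.

Variable mu : functional R d.
Hypothesis sap : strongly_ap mu.

(** A test function meets a bounded set of frequencies only, over which the series
    converges absolutely. *)
Lemma locally_summable_measure (w : X -> C) :
  (forall N, exists B, forall Y, uniq Y -> (forall y, y \in Y -> forall i, `|y 0 i| <= N%:R) ->
     \sum_(y <- Y) nrm (w y) <= B) ->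
  formal_sum_is_measure w.
Proof.
move=> hw.
have bd N : exists2 B, 0 <= B & forall f M, supp_in 0 N%:R f -> (forall x, nrm (f x) <= M) ->
    forall Y, uniq Y -> \sum_(y <- Y) nrm (f y * w y) <= B * M.
  have [B hB] := hw N; have B0 : 0 <= B by have := hB [::] isT; rewrite big_nil; apply.
  exists B => // f M sf fM Y uY; have M0 : 0 <= M := le_trans (nrm_ge0 _) (fM 0).
  pose near y := [forall i, `|y 0 i| <= N%:R]; pose Z := [seq y <- Y | near y].
  apply: le_trans (_ : \sum_(y <- Z) nrm (w y) * M <= _); last first.
    rewrite -mulr_suml ler_wpM2r//; apply: hB; first exact: filter_uniq.
    by move=> y; rewrite mem_filter => /andP[/forallP].
  rewrite big_filter [leRHS]big_mkcond; apply: ler_sum => y _; rewrite nrmM.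
  case: ifPn => [_|]; first by rewrite mulrC ler_wpM2l ?nrm_ge0.
  rewrite negb_forall => /existsP[i hi]; rewrite (sf y i) ?nrm0 ?mul0r//.
  by rewrite mxE subr0 ltNge.
have cs f : cc f -> ssum (fun y => f y * w y) (formal_sum w f).
  move=> cf; have [N sN] := supp_nat cf; have [M M0 fM] := cc_bounded cf.
  have [B _ hB] := bd N; exact: csumP (hB f M sN fM).
split=> [f /Cc_cc cf|].
  have [N sN] := supp_nat cf; have [M M0 fM] := cc_bounded cf; have [B _ hB] := bd N.
  apply: le_lt_trans (ltry (B * M)).
  exact: (esum_le (a := fun y => nrm (f y * w y)) (hB f M sN fM)).
apply: lin_bdd_radon => [c f g cf cg|r].
  apply: ssum_uniq (cs _ (cc_add (cc_scale c cf) cg)) _.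
  have := ssum_lin c (cs _ cf) (cs _ cg); congr ssum; apply/funext => y; ring.
have rN : r <= (Num.truncn r).+1%:R by exact: ltW (truncnS_gt r).
have [B B0 hB] := bd (Num.truncn r).+1; exists B => // f M cf sf fM.
exact: ssum_bound (hB f M (supp_inW rN sf) fM) (cs f cf).
Qed.

(** With [f] a wide cutoff, the coefficients of [a |-> nu (P * conj(chi a))]
    dominate those of [mu] on a ball. *)
Theorem transform_fourier_bohr nu : is_fourier_transform nu mu ->
  formal_sum_is_measure (fourier_bohr mu).
Proof.
move=> [rnu rmu hft]; apply: locally_summable_measure => N.
pose f (x : X) : C := rc (cutoff N.+1 x); have cf : cc f by exact: cc_cut.
pose P := convolve f (tilde f); have cP : cc P by exact: cc_convolve.
have [F [hF aF uF bF]] := power_ext sap cf.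
have [w [D am]] := amal_power cf; have uh := uc_power cf.
have EF a : F a = nu (fun x => P x * cj (chi a x)).
  apply: (ext_integral (radon_lin rmu) uh am hF).
  have E1 : power (fun x => f x * cj (chi a x)) = (fun y => power f (y - a)).
    by apply/funext => y; rewrite power_modulate.
  have E2 : convolve (fun x => f x * cj (chi a x)) (tilde (fun x => f x * cj (chi a x))) =
      (fun x => P x * cj (chi a x)).
    apply/funext => x; rewrite convolve_tilde; last exact: cc_modulate.
    rewrite /P convolve_tilde// [RHS]mulrC.
    have ci : cc (fun t => f (t + x) * cj (f t)).
      by have := cc_corr 0 (cc_shift x cf) cf; under eq_fun do rewrite subr0.
    rewrite -[RHS](linZ (cj (chi a x)) (@lin_Int R d) ci); congr Int; apply/funext => t.
    rewrite cjM cjK chiDr cjM.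
    transitivity (cj (chi a x) * (f (t + x) * cj (f t)) * (chi a t * cj (chi a t))); first by ring.
    by rewrite chi_conj mulr1.
  by have [_] := hft _ (cc_Cc (cc_modulate a cf)); rewrite powerE E1 E2.
have aF' : ap (fun a => nu (fun x => P x * cj (chi a x))) by rewrite -(funext EF).
have [B hB] := transform_coefficients (radon_lin rnu) (radon_bdd rnu) cP aF'.
exists B => Y uY hY; apply: le_trans (hB Y uY); rewrite -(funext EF) big_seq [leRHS]big_seq.
apply: ler_sum => y yY; rewrite bF nrmM -[leLHS]mulr1 ler_wpM2l ?nrm_ge0//.
exact: cutoff_autocorrelation (hY y yY).
Qed.

End necessity.

Theorem theorem8p2 (R : realType) (d : nat) (mu : functional R d)
    (mu_sap : strongly_ap mu) :
  ((exists nu : functional R d, is_fourier_transform nu mu) <->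
   formal_sum_is_measure (fourier_bohr mu)) /\
  (formal_sum_is_measure (fourier_bohr mu) ->
   is_fourier_transform (dagger_measure (formal_sum (fourier_bohr mu))) mu).
Proof.
split; last exact: fourier_bohr_transform.
split=> [[nu]|h]; first exact: transform_fourier_bohr.
by exists (dagger_measure (formal_sum (fourier_bohr mu))); exact: fourier_bohr_transform.
Qed.
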